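(* Let $a\ge 0$, $M=\mathbb{H}^N(-a^2)$ and $0\le k\le N$. If $\alpha$ is an $L^2$ harmonic $k$-form on $M$, then $\alpha\in H^1(\Lambda^k)$ and $$\int_M|\nabla\alpha|^2\,\mathrm{Vol}_M\le 2a^2k(N-k)\int_M|\alpha|^2\,\mathrm{Vol}_M .$$
   Context: $M=\mathbb{H}^N(-a^2)$ denotes the $N$-dimensional complete simply connected Riemannian manifold without boundary of constant sectional curvature $-a^2$ (so $M=\mathbb{R}^N$ if $a=0$), with metric $g$ and Levi-Civita connection $\nabla$. For covariant tensors of the same rank, $g(\cdot,\cdot)$ is the full contraction $g^{i_1j_1}\cdots g^{i_mj_m}\alpha_{i_1\dots i_m}\beta_{j_1\dots j_m}$, $|\cdot|^2=g(\cdot,\cdot)$, and $(u,v)=\int_M g(u,v)\,\mathrm{Vol}_M$ (in particular $\nabla\alpha$ is treated as a covariant $(k+1)$-tensor). $H^1(\Lambda^k)$ is the closure (completion) of the smooth compactly supported $k$-forms in the norm $\|u\|_{H^1}=\big((u,u)+(\nabla u,\nabla u)\big)^{1/2}$. A $k$-form $\alpha$ is harmonic if $(dd^\ast+d^\ast d)\alpha=0$, where $d^\ast$ is the usual codifferential (formal adjoint of $d$ for the standard $L^2$ inner product on forms). *)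

(* Defs.v *)
From HB Require Import structures.
From mathcomp Require Import all_boot all_order all_algebra all_fingroup.
From mathcomp Require Import all_classical all_reals all_analysis.

Set Implicit Arguments.
Unset Strict Implicit.
Unset Printing Implicit Defensive.

Import Order.TTheory GRing.Theory Num.Theory.
Import numFieldNormedType.Exports.

Local Open Scope classical_set_scope.
Local Open Scope ring_scope.

(* Lebesgue measure on R^n, on the product sigma-algebra of n.-tuple. *)
Section lebesgue_tuple.
Variable R : realType.
Local Notation RR := (measurableTypeR R).

Definition tcons n (p : RR * n.-tuple RR) : n.+1.-tuple RR :=
  [tuple of p.1 :: p.2].

Fixpoint lebesgue_tuple n : set (n.-tuple RR) -> \bar R :=
  match n with
  | 0 => \d_ ([tuple] : 0.-tuple RR)
  | n'.+1 => pushforward (lebesgue_measure \x lebesgue_tuple (n := n'))%E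
                         (@tcons n')
  end.

Lemma measurable_tcons n : measurable_fun setT (@tcons n).
Proof. exact: measurable_cons. Qed.

Definition tuncons n (t : n.+1.-tuple RR) : RR * n.-tuple RR :=
  (thead t, [tuple of behead t]).

Lemma tunconsK n : cancel (@tcons n) (@tuncons n).
Proof.
move=> [x t]; rewrite /tuncons /tcons /= theadE; congr (_, _).
exact/val_inj.
Qed.

Lemma measurable_tuncons n : measurable_fun setT (@tuncons n).
Proof.
apply/measurable_fun_pairP; split.
  exact: (@measurable_tnth _ RR n.+1 ord0).
exact: (@measurable_behead _ RR n).
Qed.

Lemma lebesgue_tuple_sigma_finite n :
  exists mu : {sigma_finite_measure set (n.-tuple RR) -> \bar R},
    mu = @lebesgue_tuple n :> (set (n.-tuple RR) -> \bar R).
Proof.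
elim: n => [|n [mu muE]] /=.
  by exists (\d_ ([tuple] : 0.-tuple RR)).
rewrite -muE.
pose nu := pushforward (lebesgue_measure \x mu)%E (@tcons n).
have nusf : sigma_finite setT nu.
  have /sigma_finiteP[F [TF ndF Foo]] := sigma_finiteT (@lebesgue_measure R).
  have /sigma_finiteP[G [TG ndG Goo]] := sigma_finiteT mu.
  exists (fun i => @tuncons n @^-1` (F i `*` G i)).
    rewrite -preimage_bigcup (_ : \bigcup_i _ = setT) ?preimage_setT//.
    apply/seteqP; split=> // -[x y] _.
    have [i _ Fix] : (\bigcup_i F i) x by rewrite -TF.
    have [j _ Gjy] : (\bigcup_i G i) y by rewrite -TG.
    exists (maxn i j) => //; split => /=.
      by move: x Fix; exact/subsetPset/ndF/leq_maxl.
    by move: y Gjy; exact/subsetPset/ndG/leq_maxr.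
  move=> i; have [mF ltF] := Foo i; have [mG ltG] := Goo i.
  have mFG : measurable (F i `*` G i) by exact: measurableX.
  split; first by rewrite -[_ @^-1` _]setTI; exact: measurable_tuncons.
  rewrite /nu /pushforward -comp_preimage.
  rewrite (_ : _ \o _ = id) ?preimage_id; last first.
    by apply/funext => p /=; rewrite tunconsK.
  by rewrite product_measure1E// lte_mul_pinfty// ge0_fin_numE.
pose m1 : {measure set (n.+1.-tuple RR) -> \bar R} :=
  measure_function_pushforward__canonical__measure_function_Measure
    (lebesgue_measure \x mu)%E (measurable_tcons (n := n)).
pose b2 := Measure_isSigmaFinite.Build _ _ _ m1 nusf.
pose m2 : {sigma_finite_measure set (n.+1.-tuple RR) -> \bar R} :=
  HB.pack (m1 : set _ -> \bar R) m1 b2.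
by exists m2.
Qed.

Let leb0 n : @lebesgue_tuple n set0 = 0%E.
Proof. by have [mu <-] := lebesgue_tuple_sigma_finite n; exact: measure0. Qed.

Let leb_ge0 n A : (0 <= @lebesgue_tuple n A)%E.
Proof. by have [mu <-] := lebesgue_tuple_sigma_finite n; exact: measure_ge0. Qed.

Let leb_add n : semi_sigma_additive (@lebesgue_tuple n).
Proof.
have [mu <-] := lebesgue_tuple_sigma_finite n.
exact: measure_semi_sigma_additive.
Qed.

HB.instance Definition _ n := isMeasure.Build _ _ _ (@lebesgue_tuple n)
  (leb0 n) (@leb_ge0 n) (@leb_add n).

Let leb_sf n : sigma_finite setT (@lebesgue_tuple n).
Proof.
by have [mu <-] := lebesgue_tuple_sigma_finite n; exact: sigma_finiteT.
Qed.

HB.instance Definition _ n := Measure_isSigmaFinite.Build _ _ _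
  (@lebesgue_tuple n) (@leb_sf n).

End lebesgue_tuple.

(* An open subset of R^N with a Riemannian metric given in the standard
   coordinates; only the values of [metric] on [dom] matter. *)
Record chart (R : realType) (N : nat) := Chart {
  dom : set 'rV[R]_N;
  metric : 'rV[R]_N -> 'M[R]_N
}.

(* H^N(-a^2) in Riemann's form of the metric of constant curvature -a^2:
     g = (1 - a^2 |x|^2 / 4)^-2 (dx_1^2 + ... + dx_N^2)
   on the ball a^2 |x|^2 < 4, which is Euclidean R^N when a = 0.
   The norm of 'rV[R]_N is the sup norm, hence the explicit sum of squares. *)
Definition sqeucl (R : realType) (N : nat) (x : 'rV[R]_N) : R :=
  \sum_(i < N) x ord0 i ^+ 2.

Definition hyperbolic (R : realType) (N : nat) (a : R) : chart R N :=
  Chart [set x | a ^+ 2 * sqeucl x < 4]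
        (fun x => ((1 - a ^+ 2 * sqeucl x / 4) ^- 2)%:M).

(* Covariant k-tensor fields, by their components; only the values at the
   points of the domain matter. *)
Definition tensor (R : realType) (N k : nat) : Type :=
  {ffun 'I_k -> 'I_N} -> 'rV[R]_N -> R.

Definition tsub (R : realType) (N k : nat) (u v : tensor R N k) :
  tensor R N k := fun I x => u I x - v I x.

Section tensor_calculus.
Variables (R : realType) (N : nat).

Definition dpartial (i : 'I_N) (f : 'rV[R]_N -> R) (x : 'rV[R]_N) : R :=
  'D_(delta_mx ord0 i) f x.

Fixpoint Cn (n : nat) (U : set 'rV[R]_N) (f : 'rV[R]_N -> R) : Prop :=
  (forall x, U x -> {for x, continuous f}) /\
  match n with
  | 0 => True
  | n'.+1 => forall i : 'I_N,
      (forall x, U x -> derivable f x (delta_mx ord0 i)) /\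
      Cn n' U (dpartial i f)
  end.

Definition smooth_on (U : set 'rV[R]_N) (f : 'rV[R]_N -> R) : Prop :=
  forall n, Cn n U f.

Variable M : chart R N.
Let g := metric M.

Definition diff_form k (u : tensor R N k) : Prop :=
  (forall I, smooth_on (dom M) (u I)) /\
  (forall (s : 'S_k) (I : {ffun 'I_k -> 'I_N}) x, dom M x ->
     u [ffun t => I (s t)] x = (-1) ^+ odd_perm s * u I x).

Definition test_form k (u : tensor R N k) : Prop :=
  diff_form u /\
  exists K : set 'rV[R]_N, [/\ compact K, K `<=` dom M &
    forall I x, dom M x -> ~ K x -> u I x = 0].

Definition christoffel (m i j : 'I_N) (x : 'rV[R]_N) : R :=
  2^-1 * \sum_(l < N) invmx (g x) m l *
    (dpartial i (fun y => g y j l) x + dpartial j (fun y => g y i l) x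
     - dpartial l (fun y => g y i j) x).

Definition itail k (I : {ffun 'I_k.+1 -> 'I_N}) : {ffun 'I_k -> 'I_N} :=
  [ffun t => I (lift ord0 t)].

Definition isubst k (I : {ffun 'I_k -> 'I_N}) (s : 'I_k) (m : 'I_N) :
  {ffun 'I_k -> 'I_N} := [ffun t => if t == s then m else I t].

(* Levi-Civita connection; the new index comes first. *)
Definition covd k (u : tensor R N k) : tensor R N k.+1 := fun I x =>
  dpartial (I ord0) (u (itail I)) x
  - \sum_(s < k) \sum_(m < N)
      christoffel m (I ord0) (itail I s) x * u (isubst (itail I) s m) x.

Definition extd k (u : tensor R N k) : tensor R N k.+1 := fun I x =>
  \sum_(s < k.+1) (-1) ^+ s *
    dpartial (I s) (u [ffun t => I (lift s t)]) x.

Definition tinner k (u v : tensor R N k) (x : 'rV[R]_N) : R :=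
  \sum_(I : {ffun 'I_k -> 'I_N}) \sum_(J : {ffun 'I_k -> 'I_N})
    (\prod_(s < k) invmx (g x) (I s) (J s)) * u I x * v J x.

Definition volint (f : 'rV[R]_N -> R) : \bar R :=
  let vec (t : N.-tuple (measurableTypeR R)) := \row_(i < N) tnth t i in
  (\int[@lebesgue_tuple R N]_(t in [set t | dom M (vec t)])
     (f (vec t) * Num.sqrt (\det (g (vec t))))%:E)%E.

Definition sqL2 k (u : tensor R N k) : \bar R := volint (tinner u u).

Definition normH1 k (u : tensor R N k) : \bar R :=
  ((sqL2 u + sqL2 (covd u)) `^ 2^-1)%E.

(* For smooth u, where the covariant derivative exists classically. *)
Definition inH1 k (u : tensor R N k) : Prop :=
  forall e : R, 0 < e ->
    exists2 phi : tensor R N k, test_form phi & (normH1 (tsub u phi) < e%:E)%E.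

(* The standard inner product of k-forms, for which the
   dx_i1 /\ ... /\ dx_ik with i1 < ... < ik are orthonormal in the Euclidean
   case: 1/k! times the full contraction. *)
Definition formip k (u v : tensor R N k) : \bar R :=
  volint (fun x => (k`!)%:R^-1 * tinner u v x).

(* v = d^* u *)
Definition is_codiff k (u : tensor R N k.+1) (v : tensor R N k) : Prop :=
  diff_form v /\ forall phi : tensor R N k, test_form phi ->
    formip (extd phi) u = formip phi v.

(* d d^* u + d^* d u = 0, where d^* = 0 on functions. *)
Definition harmonic_form k : tensor R N k -> Prop :=
  match k with
  | 0 => fun u => exists2 w : tensor R N 0, is_codiff (extd u) w &
      forall I x, dom M x -> w I x = 0
  | k'.+1 => fun u => exists v : tensor R N k', exists w : tensor R N k'.+1,
      [/\ is_codiff u v, is_codiff (extd u) w &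
          forall I x, dom M x -> extd v I x + w I x = 0]
  end.

End tensor_calculus.

(* Main.v *)
Require Import Defs.
From HB Require Import structures.
From mathcomp Require Import all_boot all_order all_algebra all_fingroup.
From mathcomp Require Import all_classical all_reals all_analysis.
From mathcomp Require Import measurable_realfun ring lra.

(* An L^2 harmonic form u is closed and coclosed (Andreotti-Vesentini, Gaffney):
   pair the equation (dd* + d*d)u = 0 with chi_n^2 u and integrate by parts,
   where the cutoffs chi_n satisfy |d chi_n| = O(1/n). They exist by
   completeness, and are obtained by composing a flat function with
   ln ((1 + |x|^2) / rho), where rho^-2 is the conformal factor of the metric.
   In the orthonormal frame rho d/dx_i the divergence of the vector field
   sum_j h(j, .) nabla_j h(i, .), for a closed and coclosed k-form h, equals
   |nabla h|^2 / k - a^2 (N - k) |h|^2. Multiplying by chi_n^2, integrating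
   and absorbing the cutoff errors gives |nabla u|^2 <= a^2 k (N - k) |u|^2
   in L^2, and then chi_n u -> u in H^1. *)

Set Implicit Arguments.
Unset Strict Implicit.
Unset Printing Implicit Defensive.

Import Order.TTheory GRing.Theory Num.Theory.
Import numFieldNormedType.Exports.
Local Open Scope classical_set_scope.
Local Open Scope ring_scope.

(** Three features of the statement shape the argument. The codifferential is given only weakly,
    against compactly supported forms; to become a pointwise divergence condition, the vanishing of
    the codifferential of u is tested on a cutoff of that divergence itself. Finiteness of the
    integral of |nabla u|^2 is part of the claim, so that integral must not be subtracted before the
    cutoff is removed: errors are absorbed into a factor 1 - O(1/n) and the limit is monotone. Every
    integration by parts is the Euclidean divergence theorem for compactly supported fields, with
    the density rho^-N moved into the field. The orthonormal frame turns contractions into plain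
    sums and makes the connection matrices skew, so inner products obey the product rule without
    correction. Closedness exchanges nabla_i h(j, J) with nabla_j h(i, J), slot by slot, which is
    the origin of the factor k. Curvature enters when nabla_i and nabla_j are commuted in the trace
    of nabla_i nabla_j h(i, .); with coclosedness this trace contributes - a^2 (N - k) h. Degree 0
    stands apart: closedness alone gives nabla u = 0. *)

(** * Insertion, deletion and substitution in multi-indices *)

Section multi_index.
Variable N : nat.
Local Notation idx k := {ffun 'I_k -> 'I_N}.

Definition iins k (s : 'I_k.+1) (i : 'I_N) (J : idx k) : idx k.+1 :=
  [ffun t => if unlift s t is Some t' then J t' else i].

Definition idel k (s : 'I_k.+1) (I : idx k.+1) : idx k :=
  [ffun t => I (lift s t)].

Definition icons k := @iins k ord0.

Lemma iins_id k s i (J : idx k) : iins s i J s = i.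
Proof. by rewrite ffunE unlift_none. Qed.

Lemma iins_lift k s i (J : idx k) t : iins s i J (lift s t) = J t.
Proof. by rewrite ffunE liftK. Qed.

Lemma iinsK k s i (J : idx k) : idel s (iins s i J) = J.
Proof. by apply/ffunP => t; rewrite ffunE iins_lift. Qed.

Lemma idelK k s (I : idx k.+1) : iins s (I s) (idel s I) = I.
Proof. by apply/ffunP => t; rewrite ffunE; case: unliftP => [t' ->|->]; rewrite ?ffunE. Qed.

Lemma itailE k (I : idx k.+1) : itail I = idel ord0 I.
Proof. by []. Qed.

Lemma isubst_iins k s i m (J : idx k) : isubst (iins s i J) s m = iins s m J.
Proof.
apply/ffunP => t; rewrite ffunE; case: (unliftP s t) => [t' ->|->].
  by rewrite eq_sym (negbTE (neq_lift _ _)) !iins_lift.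
by rewrite eqxx iins_id.
Qed.

Lemma isubst_icons_lift k i m (J : idx k) (t : 'I_k) :
  isubst (icons i J) (lift ord0 t) m = icons i (isubst J t m).
Proof.
apply/ffunP => r; rewrite ffunE; case: (unliftP ord0 r) => [r' ->|->].
  by rewrite (inj_eq (@lift_inj _ _)) !iins_lift ffunE.
by rewrite (negbTE (neq_lift _ _)) !iins_id.
Qed.

Lemma isubst_id k (I : idx k) s : isubst I s (I s) = I.
Proof. by apply/ffunP => t; rewrite ffunE; case: eqP => // ->. Qed.

Lemma isubst_isubst k (I : idx k) s i j : isubst (isubst I s i) s j = isubst I s j.
Proof. by apply/ffunP => t; rewrite !ffunE; case: eqP. Qed.

Lemma isubst_eq k (I : idx k) s i : isubst I s i s = i.
Proof. by rewrite ffunE eqxx. Qed.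

Lemma isubst_neq k (I : idx k) s t i : t != s -> isubst I s i t = I t.
Proof. by move=> /negbTE ts; rewrite ffunE ts. Qed.

Lemma isubstC k (I : idx k) s t i j : s != t ->
  isubst (isubst I s i) t j = isubst (isubst I t j) s i.
Proof.
move=> st; apply/ffunP => r; rewrite !ffunE.
by have [->|//] := eqVneq r t; rewrite eq_sym (negbTE st).
Qed.

(** The slot s is arbitrary: together with [alt_iins] this moves any slot of an alternating tensor
    to the front inside a sum, so that all slots contribute equally. *)
Lemma sum_iins (V : nmodType) k (s : 'I_k.+1) (F : idx k.+1 -> V) :
  \sum_I F I = \sum_i \sum_J F (iins s i J).
Proof.
rewrite pair_big /=.
rewrite (reindex (fun p : 'I_N * idx k => iins s p.1 p.2)) //=.
exists (fun I : idx k.+1 => (I s, idel s I)) => [[i J] _|I _] /=.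
  by rewrite iins_id iinsK.
exact: idelK.
Qed.

End multi_index.

(** * Linear algebra of covariant tensors at a single point *)

Section pointwise.
Variables (R : realFieldType) (N : nat).
Local Notation idx k := {ffun 'I_k -> 'I_N}.

(* The action of gl_N on covariant k-tensors by derivations. *)
Definition glact k (A : 'M[R]_N) (u : idx k -> R) : idx k -> R :=
  fun I => \sum_(s < k) \sum_m A (I s) m * u (isubst I s m).

(** The interior product with the i-th basis vector. *)
Definition slot k (u : idx k.+1 -> R) (i : 'I_N) : idx k -> R :=
  fun J => u (icons i J).

(** A derivation acts on slot 0 plus on the remaining slots; this splitting is the induction step on
    the degree. *)
Lemma glact_cons k A (u : idx k.+1 -> R) j J :
  glact A u (icons j J) = \sum_m A j m * u (icons m J) + glact A (slot u j) J.
Proof.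
rewrite /glact big_ord_recl iins_id; congr (_ + _).
  by apply: eq_bigr => m _; rewrite isubst_iins.
apply: eq_bigr => s _; rewrite iins_lift.
by apply: eq_bigr => m _; rewrite isubst_icons_lift.
Qed.

Lemma eq_act k A (u v : idx k -> R) : u =1 v -> glact A u =1 glact A v.
Proof.
by move=> uv I; apply: eq_bigr => s _; apply: eq_bigr => m _; rewrite uv.
Qed.

Lemma glact_comb k A (r : seq 'I_N) (c : 'I_N -> R) (u : 'I_N -> idx k -> R) I :
  glact A (fun J => \sum_(i <- r) c i * u i J) I = \sum_(i <- r) c i * glact A (u i) I.
Proof.
rewrite /glact.
under [RHS]eq_bigr do rewrite mulr_sumr.
rewrite [RHS]exchange_big; apply: eq_bigr => s _ /=.
under [RHS]eq_bigr do rewrite mulr_sumr.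
rewrite [RHS]exchange_big; apply: eq_bigr => m _ /=.
by rewrite mulr_sumr; apply: eq_bigr => i _; rewrite mulrCA.
Qed.

Lemma glactDr k A (u v : idx k -> R) I :
  glact A (fun J => u J + v J) I = glact A u I + glact A v I.
Proof.
rewrite /glact -big_split; apply: eq_bigr => s _; rewrite -big_split /=.
by apply: eq_bigr => m _; rewrite mulrDr.
Qed.

Lemma glactZr k A c (u : idx k -> R) I :
  glact A (fun J => c * u J) I = c * glact A u I.
Proof.
rewrite /glact mulr_sumr; apply: eq_bigr => s _; rewrite mulr_sumr.
by apply: eq_bigr => m _; rewrite mulrCA.
Qed.

Lemma glactDl k A B (u : idx k -> R) I :
  glact (A + B) u I = glact A u I + glact B u I.
Proof.
rewrite /glact -big_split; apply: eq_bigr => s _; rewrite -big_split /=.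
by apply: eq_bigr => m _; rewrite !mxE mulrDl.
Qed.

Lemma glactZl k A c (u : idx k -> R) I : glact (c *: A) u I = c * glact A u I.
Proof.
rewrite /glact mulr_sumr; apply: eq_bigr => s _; rewrite mulr_sumr.
by apply: eq_bigr => m _; rewrite mxE mulrA.
Qed.

Lemma glactNl k A (u : idx k -> R) I : glact (- A) u I = - glact A u I.
Proof. by rewrite -scaleN1r glactZl mulN1r. Qed.

Lemma glactBl k A B (u : idx k -> R) I :
  glact (A - B) u I = glact A u I - glact B u I.
Proof. by rewrite glactDl glactNl. Qed.

Lemma glact_suml k (A : 'I_N -> 'M[R]_N) (u : idx k -> R) I :
  glact (\sum_i A i) u I = \sum_i glact (A i) u I.
Proof.
rewrite /glact [RHS]exchange_big; apply: eq_bigr => s _ /=; rewrite [RHS]exchange_big /=.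
by apply: eq_bigr => m _; rewrite summxE mulr_suml.
Qed.

Lemma glact_scalar k c (u : idx k -> R) I : glact c%:M u I = k%:R * c * u I.
Proof.
rewrite /glact (eq_bigr (fun=> c * u I)) => [|s _].
  by rewrite sumr_const card_ord -mulrA mulr_natl.
rewrite (bigD1 (I s)) //= big1 => [|m ms]; rewrite mxE.
  by rewrite eqxx addr0 isubst_id.
by rewrite eq_sym (negbTE ms) mul0r.
Qed.

(** [glact] is a representation of the Lie algebra gl_N. By induction on the degree: slot 0 produces
    the matrix commutator, and the mixed terms, where one matrix acts on slot 0 and the other behind
    it, cancel. *)
Lemma glact_commute k A B (u : idx k -> R) I :
  glact A (glact B u) I - glact B (glact A u) I = glact (A *m B - B *m A) u I.
Proof.
elim: k u I => [|k IH] u I; first by rewrite /glact !big_ord0 subrr.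
rewrite -(idelK ord0 I); move: (I ord0) (idel _ I) => j J {I}.
rewrite -!/(icons _ _) !glact_cons -IH.
under eq_bigr do rewrite glact_cons mulrDr mulr_sumr.
under [X in _ - (X + _)]eq_bigr do rewrite glact_cons mulrDr mulr_sumr.
rewrite !big_split /=.
have slotE C (v : idx k.+1 -> R) i K : slot (glact C v) i K =
    \sum_m C i m * slot v m K + glact C (slot v i) K by rewrite /slot glact_cons.
rewrite !(eq_act _ (slotE _ _ _)) !glactDr !glact_comb.
have mE (C D : 'M[R]_N) : \sum_m \sum_n C j m * (D m n * u (icons n J)) =
    \sum_n (C *m D) j n * u (icons n J).
  rewrite exchange_big; apply: eq_bigr => n _ /=.
  by rewrite mxE mulr_suml; apply: eq_bigr => m _; rewrite mulrA.
rewrite !mE.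
have -> : \sum_m (A *m B - B *m A) j m * u (icons m J) =
    \sum_n (A *m B) j n * u (icons n J) - \sum_n (B *m A) j n * u (icons n J).
  rewrite -sumrB; apply: eq_bigr => n _.
  by rewrite [X in X * _ = _]mxE [X in (_ + X) * _]mxE mulrBl.
ring.
Qed.

(** On each slot this is the adjunction between a matrix and its transpose. For skew A the two sides
    are opposite, which makes the frame connection compatible with the inner product. *)
Lemma glact_adj k A (u w : idx k -> R) :
  \sum_I glact A u I * w I = \sum_I u I * glact A^T w I.
Proof.
rewrite /glact; under eq_bigr do rewrite mulr_suml.
under [RHS]eq_bigr do rewrite mulr_sumr.
rewrite exchange_big [RHS]exchange_big /=; apply: eq_bigr => s _.
case: k s u w => [[]//|k] s u w.
rewrite (sum_iins s) [RHS](sum_iins s).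
under eq_bigr do under eq_bigr do rewrite iins_id mulr_suml.
under [RHS]eq_bigr do under eq_bigr do rewrite iins_id mulr_sumr.
under eq_bigr do rewrite exchange_big /=.
rewrite exchange_big /=.
under [RHS]eq_bigr do rewrite exchange_big /=.
do 3![apply: eq_bigr => ? _]; rewrite !isubst_iins !mxE; ring.
Qed.

Definition alt k (u : idx k -> R) :=
  forall (s : 'S_k) (I : idx k), u [ffun t => I (s t)] = (-1) ^+ odd_perm s * u I.

(** The permutation [lift_perm ord0 s 1] sends 0 to s and keeps the order of the other positions; it
    is a cycle of sign (-1)^s. *)
Lemma alt_iins k (u : idx k.+1 -> R) : alt u -> forall s i J,
  u (iins s i J) = (-1) ^+ s * u (icons i J).
Proof.
move=> au s i J; have := au (lift_perm ord0 s 1%g) (iins s i J).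
have -> : [ffun t => iins s i J (lift_perm ord0 s 1%g t)] = icons i J.
  apply/ffunP => t; rewrite ffunE; case: (unliftP ord0 t) => [t' ->|->].
    by rewrite lift_perm_lift perm1 !iins_lift.
  by rewrite lift_perm_id !iins_id.
move=> ->; rewrite odd_lift_perm odd_perm1 /= addbF signr_odd mulrA.
by rewrite -expr2 sqrr_sign mul1r.
Qed.

Lemma alt_swap k (u : idx k -> R) : alt u -> forall a b i j I, a != b ->
  u (isubst (isubst I a i) b j) = - u (isubst (isubst I a j) b i).
Proof.
move=> au a b i j I ab; have := au (tperm a b) (isubst (isubst I a j) b i).
rewrite odd_tperm ab expr1 mulN1r => <-; congr (u _).
apply/ffunP => t; rewrite !ffunE.
have [->|tb] := eqVneq t b; first by rewrite tpermR (negbTE ab) eqxx.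
have [->|ta] := eqVneq t a; first by rewrite tpermL eqxx.
rewrite tpermD 1?[_ == t]eq_sym//; by rewrite ?(negbTE tb) ?(negbTE ta).
Qed.

Lemma alt_eq0 k (u : idx k -> R) : alt u -> forall a b (I : idx k), a != b ->
  I a = I b -> u I = 0.
Proof.
move=> au a b I ab Iab; have := au (tperm a b) I.
have -> : [ffun t => I (tperm a b t)] = I.
  by apply/ffunP => t; rewrite ffunE; case: tpermP => [->|->|//]; rewrite Iab.
by rewrite odd_tperm ab expr1; lra.
Qed.

Lemma alt_slot k (u : idx k.+1 -> R) i : alt u -> alt (slot u i).
Proof.
move=> au s I; have := au (lift_perm ord0 ord0 s) (icons i I).
rewrite odd_lift_perm /= => <-; congr (u _).
apply/ffunP => t; rewrite [RHS]ffunE; case: (unliftP ord0 t) => [t' ->|->].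
  by rewrite lift_perm_lift !iins_lift ffunE.
by rewrite lift_perm_id !iins_id.
Qed.

(* The algebraic part of the Weitzenboeck curvature term on k-forms. *)
Lemma glact_curvature k (u : idx k.+1 -> R) q J : alt u ->
  \sum_i glact (delta_mx q i - delta_mx i q) u (icons i J) =
  (k.+1%:R - N%:R) * u (icons q J).
Proof.
move=> au.
have h1 i : \sum_m (delta_mx q i - delta_mx i q : 'M[R]_N) i m * u (icons m J) =
    (i == q)%:R * u (icons q J) - u (icons q J).
  rewrite (eq_bigr (fun m => (i == q)%:R * ((m == i)%:R * u (icons m J))
     - (m == q)%:R * u (icons m J))) => [|m _]; last first.
    by rewrite !mxE eqxx andTb mulrBl mulrA -natrM mulnb.
  rewrite sumrB -mulr_sumr; congr (_ - _).
    rewrite (bigD1 i) //= big1 => [|m /negbTE ->]; last by rewrite mul0r.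
    by rewrite eqxx mul1r addr0; case: eqP => [->|]; rewrite ?mul0r.
  rewrite (bigD1 q) //= big1 => [|m /negbTE ->]; last by rewrite mul0r.
  by rewrite eqxx mul1r addr0.
under eq_bigr do rewrite glact_cons h1 glactBl.
rewrite big_split /= sumrB -mulr_suml.
have -> : \sum_i (i == q)%:R = 1 :> R.
  by rewrite (bigD1 q) //= eqxx big1 ?addr0// => i /negbTE ->.
rewrite sumr_const card_ord.
(* Slot 0 has given 1 - N; the slots behind it give k. The matrices [delta_mx q i] create a repeated
   index i, hence 0; the matrices [delta_mx i q] exchange q with the entry J s, and each of the k
   slots yields minus u(q, J). *)
have -> : \sum_i (glact (delta_mx q i) (slot u i) J
                  - glact (delta_mx i q) (slot u i) J) = k%:R * u (icons q J).
  rewrite -[RHS]opprK sumrB -[X in _ = X]add0r; congr (_ - _).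
    apply: big1 => i _; apply: big1 => s _; apply: big1 => m _.
    rewrite mxE; have [->|] := eqVneq m i; last by rewrite andbF mul0r.
    rewrite /slot (_ : u _ = 0) ?mulr0//.
    apply: (alt_eq0 au (a := ord0) (b := lift ord0 s)) => //.
    by rewrite iins_id iins_lift isubst_eq.
  rewrite /glact exchange_big /= (eq_bigr (fun=> - u (icons q J))) => [|s _].
    by rewrite sumr_const card_ord mulNrn mulr_natl.
  rewrite (bigD1 (J s)) //= [X in _ + X]big1 ?addr0 => [|i iJ]; last first.
    by apply: big1 => m _; rewrite mxE eq_sym (negbTE iJ) mul0r.
  rewrite (bigD1 q) //= big1 ?addr0 => [|m /negbTE mq]; last first.
    by rewrite mxE mq andbF mul0r.
  rewrite mxE !eqxx mul1r /slot.
  have := alt_swap au (J s) q (icons q J) (neq_lift ord0 s).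
  rewrite !isubst_iins !isubst_icons_lift => ->; congr (- u _).
  by rewrite isubst_id.
rewrite -mulr_natl -[k.+1%:R]natr1; ring.
Qed.

(** Here [C i I] stands for nabla_i u_I and the second hypothesis for du = 0. That hypothesis
    rewrites one factor of the square as a sum over slots; moving slot s to the front costs (-1)^s
    in both factors, so the slots contribute the same and their number comes out. *)
Lemma sqnorm_closed k (C : 'I_N -> idx k.+1 -> R) :
    (forall i, alt (C i)) ->
    (forall i I, C i I = \sum_s C (I s) (isubst I s i)) ->
  \sum_i \sum_I C i I ^+ 2 =
  k.+1%:R * \sum_i \sum_j \sum_J C i (icons j J) * C j (icons i J).
Proof.
move=> aC cC.
transitivity (\sum_i \sum_I \sum_s C i I * C (I s) (isubst I s i)).
  by do 2![apply: eq_bigr => ? _]; rewrite expr2 {2}cC mulr_sumr.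
under eq_bigr do rewrite exchange_big /=.
rewrite exchange_big /=.
rewrite mulr_natl -[k.+1 in RHS]card_ord -sumr_const; apply: eq_bigr => s _.
apply: eq_bigr => i _; rewrite (sum_iins s); apply: eq_bigr => j _.
apply: eq_bigr => J _; rewrite iins_id isubst_iins (alt_iins (aC i) s) (alt_iins (aC j) s).
by rewrite mulrACA -expr2 sqrr_sign mul1r.
Qed.

(* For a symmetric connection the Christoffel symbols cancel in the exterior
   derivative. *)
Lemma glact_symmetric k (G : 'I_N -> 'M[R]_N) (u : idx k -> R) i (I : idx k) : alt u ->
  (forall i j m, G i j m = G j i m) ->
  \sum_s glact (G (I s)) u (isubst I s i) = glact (G i) u I.
Proof.
move=> au sG; rewrite /glact.
transitivity (\sum_s (\sum_m G i (I s) m * u (isubst I s m) +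
  \sum_(t | t != s) \sum_m G (I s) (I t) m * u (isubst (isubst I s i) t m))).
  apply: eq_bigr => s _; rewrite (bigD1 s) //= isubst_eq; congr (_ + _).
    by apply: eq_bigr => m _; rewrite isubst_isubst sG.
  by apply: eq_bigr => t ts; rewrite isubst_neq.
rewrite big_split /= -[RHS]addr0; congr (_ + _).
(* The terms with t <> s change sign when s and t are exchanged: G is symmetric in its first two
   indices and u is alternating. *)
set S := \sum_s _; suff : S = - S by lra.
rewrite {2}/S (exchange_big_dep xpredT) //= -sumrN; apply: eq_bigr => t _.
rewrite -sumrN; apply: eq_big => [s|s st]; first by rewrite eq_sym.
rewrite -sumrN; apply: eq_bigr => m _.
rewrite sG -mulrN; congr (_ * _).
by rewrite (isubstC _ _ _ st) alt_swap ?opprK// eq_sym.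
Qed.

End pointwise.

(** * Chain rule for directional derivatives *)

Section chain.
Variables (R : realType) (V : normedModType R).

(** Reduces a directional derivative to a derivative in one real variable at 0, where the
    one-variable chain rule applies. *)
Lemma is_derive_line (f : V -> R) x v d :
  is_derive x v f d <-> is_derive (0 : R) 1 (fun t : R => f (t *: v + x)) d.
Proof.
have e : (fun h : R => h^-1 *: ((f \o shift x) (h *: v) - f x)) =
  (fun h : R => h^-1 *: (((fun t : R => f (t *: v + x)) \o shift 0) (h *: 1)
     - f (0 *: v + x))).
  by apply/funext => h /=; rewrite addr0 scale0r add0r [_%:A]mulr1.
by split=> -[dv <-]; split; rewrite ?/derivable ?/derive ?e// -e.
Qed.

Lemma is_derive_comp (phi : R -> R) (h : V -> R) x v d d' :
  is_derive (h x) 1 phi d' -> is_derive x v h d ->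
  is_derive x v (phi \o h) (d' * d).
Proof.
move=> dphi /is_derive_line dh; apply/is_derive_line.
have -> : (fun t : R => (phi \o h) (t *: v + x)) = phi \o (fun t : R => h (t *: v + x)) by [].
by apply: is_derive1_comp => //=; rewrite scale0r add0r.
Qed.

End chain.

(** * Functions p(1/t) exp(-1/t), flat at the origin *)

Section flat.
Variable R : realType.
Implicit Types (p : {poly R}) (t : R).

(* Each flat p is smooth: flat p' is again of this form, and all vanish to
   infinite order at 0. *)
Definition flat p t : R := if t <= 0 then 0 else p.[t^-1] * expR (- t^-1).

Lemma horner_bound p : exists2 C, 0 <= C &
  forall s : R, 1 <= s -> `|p.[s]| <= C * s ^+ size p.
Proof.
exists (\sum_(i < size p) `|p`_i|) => [|s s1]; first by rewrite sumr_ge0.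
rewrite horner_coef (le_trans (ler_norm_sum _ _ _))// mulr_suml.
apply: ler_sum => i _; rewrite normrM ler_wpM2l// normrX ger0_norm; last lra.
by rewrite ler_weXn2l// ltnW.
Qed.

Lemma expX_expR_bound n (s : R) : 0 <= s -> s ^+ n * expR (- s) <= n`!%:R.
Proof.
move=> s0; rewrite expRN ler_pdivrMr ?expR_gt0//.
case: n => [|n]; first by rewrite fact0 mul1r expr0 (le_trans _ (expR_ge1Dx s))// lerDl.
rewrite -ler_pdivrMl ?ltr0n ?fact_gt0// mulrC.
by rewrite (le_trans _ (expR_ge1Dxn n s0))// lerDr.
Qed.

(** With s = 1/t >= 1 the polynomial is at most C s^(size p), and s^(size p + 2) exp(-s) is at most
    (size p + 2)!. Order two in t is what makes the derivative at 0 vanish. *)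
Lemma flat_bound p : exists2 C, 0 <= C &
  forall t, 0 < t -> t <= 1 -> `|flat p t| <= C * t ^+ 2.
Proof.
have [C C0 HC] := horner_bound p.
exists (C * (size p).+2`!%:R) => [|t t0 t1]; first by rewrite mulr_ge0.
rewrite /flat [t <= 0]leNgt t0 /= normrM (ger0_norm (expR_ge0 _)).
have s1 : 1 <= t^-1 by rewrite invf_ge1.
have := expX_expR_bound (size p).+2 (le_trans ler01 s1).
have := HC _ s1; set s := t^-1; set e := expR _ => h1 h2.
have -> : t ^+ 2 = s ^- 2 by rewrite /s exprVn invrK.
have s0 : 0 < s by rewrite invr_gt0.
rewrite ler_pdivlMr ?exprn_gt0//.
apply: (@le_trans _ _ ((C * s ^+ size p) * e * s ^+ 2)).
  apply: ler_wpM2r; first by rewrite exprn_ge0 ?ltW.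
  by apply: ler_wpM2r => //; rewrite expR_ge0.
rewrite -!mulrA ler_wpM2l//; apply: le_trans h2; rewrite le_eqVlt; apply/orP; left.
by apply/eqP; rewrite -[(size p).+2]addn2 exprD; ring.
Qed.

(** With s = 1/t the derivative of p(s) exp(-s) in t is s^2 (p - p')(s) exp(-s). *)
Definition flat_deriv p : {poly R} := 'X^2 * (p - p^`()).

Lemma is_derive_flat p t : is_derive t 1 (flat p) (flat (flat_deriv p) t).
Proof.
have [t0|t0|->] := ltgtP t 0.
- have -> : flat (flat_deriv p) t = 0 by rewrite /flat ltW.
  apply: (@near_eq_is_derive _ _ _ (cst 0)).
  near=> s; rewrite /flat ifT//; apply: ltW; near: s; exact: lt_nbhsl.
- have tn : t != 0 by rewrite gt_eqF.
  apply: (@near_eq_is_derive _ _ _ (fun s : R => p.[s^-1] * expR (- s^-1))).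
    near=> s; rewrite /flat ifF//; apply/negbTE; rewrite -ltNge.
    by near: s; exact: lt_nbhsr.
  have dV : is_derive t 1 (fun s : R => s^-1) (- t ^- 2).
    apply: is_derive_eq; first exact: is_deriveV.
    by rewrite [_ *: _]mulr1.
  have dp : is_derive t 1 (fun s : R => p.[s^-1]) (p^`().[t^-1] * - t ^- 2).
    apply: (@is_derive1_comp _ (horner p) (fun s => s^-1)).
  have de : is_derive t 1 (fun s : R => expR (- s^-1)) (expR (- t^-1) * - - t ^- 2).
    apply: (@is_derive1_comp _ expR (fun s => - s^-1)).
  have := is_deriveM dp de; rewrite /flat [t <= 0]leNgt t0 /=.
  move=> dd; apply: is_derive_eq dd _; rewrite /flat_deriv !hornerE /= exprVn.
  rewrite /GRing.scale /=; ring.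
- rewrite {2}/flat lexx.
  have [C C0 HC] := flat_bound p.
  have : (fun h : R => h^-1 *: ((flat p \o shift 0) (h *: 1) - flat p 0)) @ 0^' --> (0 : R).
    apply/cvgrPdist_le => e e0; near=> h.
    rewrite /= addr0 [h%:A]mulr1 {2}/flat lexx subr0 sub0r normrN /GRing.scale /=.
    have h0 : h != 0 by near: h; exact: nbhs_dnbhs_neq.
    (* The bound 1 puts h in the range of [flat_bound]; the denominator C + 1 stays positive when C
       = 0. *)
    have hb : `|h| <= Num.min 1 (e / (C + 1)).
      near: h; apply: dnbhs0_le; rewrite lt_min ltr01/= divr_gt0//; lra.
    move: hb; rewrite le_min => /andP[h1 h2].
    have [hn|hp] := leP h 0; first by rewrite /flat hn mulr0 normr0 ltW.
    rewrite normrM normfV ler_pdivrMl ?normr_gt0//.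
    move: h1 h2; rewrite (gtr0_norm hp) => h1 h2.
    apply: le_trans (HC _ hp h1) _; rewrite expr2 mulrCA ler_pM2l//.
    rewrite ler_pdivlMr in h2; last lra.
    by apply: le_trans h2; rewrite mulrC ler_pM2l//; lra.
  by move=> h; split; [apply/cvg_ex; exists 0 | exact/cvg_lim].
Unshelve. all: by end_near. Qed.

Lemma continuous_flat p : continuous (flat p).
Proof.
by move=> t; apply/differentiable_continuous/derivable1_diffP;
  have [] := is_derive_flat p t.
Qed.

End flat.

(** * Derivatives along lines, of finite sums and of inverses *)

Section line.
Variables (R : realType) (V : normedModType R).

Lemma is_derive_along_line (f : V -> R) (t : R) v y d :
  is_derive (t *: v + y) v f d -> is_derive t 1 (fun s : R => f (s *: v + y)) d.
Proof.
have e : (fun h : R => h^-1 *: ((f \o shift (t *: v + y)) (h *: v) - f (t *: v + y))) =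
  (fun h : R => h^-1 *: (((fun s : R => f (s *: v + y)) \o shift t) (h *: 1)
     - f (t *: v + y))).
  by apply/funext => h /=; rewrite addrA -scalerDl [h%:A]mulr1.
by move=> -[dv <-]; split; rewrite /derivable /derive -e.
Qed.

Lemma is_derive_bigsum (I : Type) (r : seq I) (P : pred I) (f : I -> V -> R) x v
    (d : I -> R) : (forall i, P i -> is_derive x v (f i) (d i)) ->
  is_derive x v (fun y => \sum_(i <- r | P i) f i y) (\sum_(i <- r | P i) d i).
Proof.
move=> H; elim: r => [|i r IH].
  have -> : (fun y => \sum_(i <- [::] | P i) f i y) = cst 0.
    by apply/funext => y; rewrite big_nil.
  by rewrite big_nil; exact: is_derive_cst.
rewrite big_cons; case: ifPn => Pi.
  rewrite (_ : (fun y => _) = f i + (fun y => \sum_(i <- r | P i) f i y)).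
    exact: (is_deriveD (H _ Pi) IH).
  by apply/funext => y; rewrite big_cons Pi.
rewrite (_ : (fun y => _) = (fun y => \sum_(i <- r | P i) f i y))//.
by apply/funext => y; rewrite big_cons (negbTE Pi).
Qed.

Lemma is_derive_inv (f : V -> R) x v d : f x != 0 -> is_derive x v f d ->
  is_derive x v (fun y => (f y)^-1) (- (f x) ^- 2 * d).
Proof.
by move=> f0 [df <-]; split; [exact: derivableV | exact: deriveV].
Qed.

End line.

(** * Calculus of smooth functions on an open set *)

Section smooth.
Variables (R : realType) (N : nat) (U : set 'rV[R]_N).
Hypothesis oU : open U.
Local Notation "'e_ i" := (delta_mx ord0 i : 'rV[R]_N) (at level 8, i at level 2).
Implicit Types f g : 'rV[R]_N -> R.

Lemma CnS n f : Cn n.+1 U f -> Cn n U f.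
Proof.
elim: n f => [|n IH] f; first by move=> [].
by move=> [cf df]; split=> // i; have [di /IH] := df i.
Qed.

Lemma Cn_eq n f g : (forall x, U x -> f x = g x) -> Cn n U f -> Cn n U g.
Proof.
have nU h h' x : (forall x, U x -> h x = h' x) -> U x ->
    \forall y \near x, h y = h' y :> R.
  by move=> hh Ux; near do apply: hh; exact: open_nbhs_nbhs.
elim: n f g => [|n IH] f g fg [cf df]; (split;
    first by move=> x Ux; rewrite /prop_for /continuous_at -(fg _ Ux);
      exact: cvg_trans (near_eq_cvg (nU _ _ _ fg Ux)) (cf x Ux)) => // i.
have [di ci] := df i; split=> [x Ux|].
  exact: near_eq_derivable (nU _ _ _ fg Ux) (di x Ux).
apply: IH ci => x Ux; exact: near_eq_derive (nU _ _ _ fg Ux).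
Unshelve. all: by end_near. Qed.

Lemma smooth_eq f g : (forall x, U x -> f x = g x) ->
  smooth_on U f -> smooth_on U g.
Proof. by move=> fg sf n; exact: Cn_eq fg (sf n). Qed.

Lemma smooth_continuous f x : smooth_on U f -> U x -> {for x, continuous f}.
Proof. by move=> /(_ 0%N)[cf _]; exact: cf. Qed.

Lemma smooth_derivable f i x : smooth_on U f -> U x -> derivable f x 'e_i.
Proof. by move=> /(_ 1%N)[_ /(_ i)[df _]]; exact: df. Qed.

Lemma smooth_is_derive f i x : smooth_on U f -> U x ->
  is_derive x 'e_i f (dpartial i f x).
Proof. by move=> sf Ux; split=> //; exact: smooth_derivable. Qed.

Lemma smooth_dpartial f i : smooth_on U f -> smooth_on U (dpartial i f).
Proof. by move=> sf n; have [_ /(_ i)[]] := sf n.+1. Qed.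

(** Lets the partial derivatives be supplied by a formula valid only on U; since U is open, [Cn_eq]
    transfers regularity from the formula to [dpartial]. *)
Lemma CnS_intro n f (df : 'I_N -> 'rV[R]_N -> R) :
  (forall x, U x -> {for x, continuous f}) ->
  (forall i x, U x -> is_derive x 'e_i f (df i x)) ->
  (forall i, Cn n U (df i)) -> Cn n.+1 U f.
Proof.
move=> cf dfE sdf; split=> // i; split=> [x Ux|]; first by have [] := dfE i x Ux.
by apply: Cn_eq (sdf i) => x Ux; have [_ <-] := dfE i x Ux.
Qed.

Lemma smooth_intro f (df : 'I_N -> 'rV[R]_N -> R) :
  (forall x, U x -> {for x, continuous f}) ->
  (forall i x, U x -> is_derive x 'e_i f (df i x)) ->
  (forall i, smooth_on U (df i)) -> smooth_on U f.
Proof.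
move=> cf dfE sdf n; apply: CnS; apply: CnS_intro cf dfE _ => i; exact: sdf.
Qed.

Lemma smooth_cst c : smooth_on U (fun=> c).
Proof.
move=> n; elim: n c => [|n IH] c; first by split=> // x _; exact: cst_continuous.
apply: (@CnS_intro _ _ (fun _ _ => 0)) => // x _; exact: cst_continuous.
Qed.

Lemma is_derive_coord i j (x : 'rV[R]_N) :
  is_derive x 'e_i (fun y : 'rV[R]_N => y ord0 j) (i == j)%:R.
Proof.
apply/is_derive_line.
have -> : (fun t : R => (t *: 'e_i + x) ord0 j) =
    ((fun t => (i == j)%:R * t) \+ cst (x ord0 j)).
  by apply/funext => t; rewrite !mxE /= mulrC eq_sym.
rewrite -[X in is_derive _ _ _ X]addr0; apply: is_deriveD.
by apply: is_derive_eq; rewrite /GRing.scale /= !mulr1 ?mulr0 ?addr0.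
Qed.

Lemma smooth_coord j : smooth_on U (fun x => x ord0 j).
Proof.
apply: (@smooth_intro _ (fun i _ => (i == j)%:R)) => [x _|i x _|i].
- exact: coord_continuous.
- exact: is_derive_coord.
- exact: smooth_cst.
Qed.

Lemma CnD n f g : Cn n U f -> Cn n U g -> Cn n U (fun x => f x + g x).
Proof.
elim: n f g => [|n IH] f g [cf df] [cg dg].
  by split=> // x Ux; exact: (cvgD (cf _ Ux) (cg _ Ux)).
apply: (@CnS_intro _ _ (fun i x => dpartial i f x + dpartial i g x)).
- by move=> x Ux; exact: (cvgD (cf _ Ux) (cg _ Ux)).
- move=> i x Ux; apply: is_deriveD; apply: derivableP.
    by have [+ _] := df i; apply.
  by have [+ _] := dg i; apply.
- by move=> i; have [_ ?] := df i; have [_ ?] := dg i; exact: IH.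
Qed.

Lemma CnM n f g : Cn n U f -> Cn n U g -> Cn n U (fun x => f x * g x).
Proof.
elim: n f g => [|n IH] f g Cf Cg; have [cf df] := Cf; have [cg dg] := Cg.
  by split=> // x Ux; exact: (cvgM (cf _ Ux) (cg _ Ux)).
apply: (@CnS_intro _ _ (fun i x => f x * dpartial i g x + g x * dpartial i f x)).
- by move=> x Ux; exact: (cvgM (cf _ Ux) (cg _ Ux)).
- move=> i x Ux; apply: is_deriveM; apply: derivableP.
    by have [+ _] := df i; apply.
  by have [+ _] := dg i; apply.
- move=> i; have [_ ?] := df i; have [_ ?] := dg i.
  by apply: CnD; apply: IH => //; exact: CnS.
Qed.

Lemma smoothD f g : smooth_on U f -> smooth_on U g ->
  smooth_on U (fun x => f x + g x).
Proof. by move=> sf sg n; exact: CnD. Qed.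

Lemma smoothM f g : smooth_on U f -> smooth_on U g ->
  smooth_on U (fun x => f x * g x).
Proof. by move=> sf sg n; exact: CnM. Qed.

Lemma smoothN f : smooth_on U f -> smooth_on U (fun x => - f x).
Proof.
move=> sf; apply: (@smooth_eq (fun x => (-1) * f x)) => [x _|].
  by rewrite mulN1r.
by apply: smoothM => //; exact: smooth_cst.
Qed.

Lemma smoothB f g : smooth_on U f -> smooth_on U g ->
  smooth_on U (fun x => f x - g x).
Proof. by move=> sf sg; apply: smoothD => //; exact: smoothN. Qed.

Lemma smoothX f n : smooth_on U f -> smooth_on U (fun x => f x ^+ n).
Proof.
move=> sf; elim: n => [|n IH]; first exact: smooth_cst.
by apply: (@smooth_eq (fun x => f x * f x ^+ n)) => [x _|]; [rewrite exprS|exact: smoothM].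
Qed.

Lemma smooth_sum (I : Type) (r : seq I) (P : pred I) (f : I -> 'rV[R]_N -> R) :
  (forall i, P i -> smooth_on U (f i)) ->
  smooth_on U (fun x => \sum_(i <- r | P i) f i x).
Proof.
move=> sf; elim: r => [|i r IH].
  by apply: smooth_eq (smooth_cst 0) => x _; rewrite big_nil.
have [Pi|Pi] := boolP (P i); last first.
  by apply: smooth_eq IH => x _; rewrite big_cons (negbTE Pi).
by apply: smooth_eq (smoothD (sf _ Pi) IH) => x _; rewrite big_cons Pi.
Qed.

Lemma CnV n f : (forall x, U x -> f x != 0) -> Cn n U f ->
  Cn n U (fun x => (f x)^-1).
Proof.
move=> f0; elim: n => [|n IH] Cf; have [cf df] := Cf.
  by split=> // x Ux; exact: (cvgV (f0 _ Ux) (cf _ Ux)).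
have IHn := IH (CnS Cf).
apply: (@CnS_intro _ _ (fun i x => - ((f x)^-1 * (f x)^-1) * dpartial i f x)).
- by move=> x Ux; exact: (cvgV (f0 _ Ux) (cf _ Ux)).
- move=> i x Ux; have [dfi _] := df i.
  apply: is_derive_eq; first by apply: (is_derive_inv (f0 x Ux)); apply: derivableP; exact: dfi.
  by rewrite expr2 invfM.
- move=> i; have [_ ci] := df i; apply: CnM ci.
  apply: (@Cn_eq _ (fun x => (-1) * ((f x)^-1 * (f x)^-1))) => [x _|].
    by rewrite mulN1r.
  by apply: CnM; [exact: smooth_cst|exact: CnM].
Qed.

Lemma smoothV f : (forall x, U x -> f x != 0) -> smooth_on U f ->
  smooth_on U (fun x => (f x)^-1).
Proof. by move=> f0 sf n; exact: CnV. Qed.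

Lemma smooth_ln f : (forall x, U x -> 0 < f x) -> smooth_on U f ->
  smooth_on U (fun x => ln (f x)).
Proof.
move=> f0 sf.
apply: (@smooth_intro _ (fun i x => (f x)^-1 * dpartial i f x)) => [x Ux|i x Ux|i].
- apply: (@continuous_comp _ _ _ f (@ln R)); first exact: smooth_continuous.
  exact: continuous_ln (f0 x Ux).
- apply: (is_derive_comp (phi := @ln R)); first exact/is_derive1_ln/f0.
  exact: smooth_is_derive.
- apply: smoothM; last exact: smooth_dpartial.
  by apply: smoothV => // x Ux; rewrite gt_eqF// f0.
Qed.

(** The induction on the order is made for all p at once, since differentiating replaces p by
    [flat_deriv p]. *)
Lemma smooth_flat p f : smooth_on U f -> smooth_on U (fun x => flat p (f x)).
Proof.
move=> sf n; elim: n p => [|n IH] p.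
  split=> // x Ux; apply: (@continuous_comp _ _ _ f (flat p)).
    exact: smooth_continuous.
  exact: continuous_flat.
apply: (@CnS_intro _ _ (fun i x => flat (flat_deriv p) (f x) * dpartial i f x)).
- move=> x Ux; apply: (@continuous_comp _ _ _ f (flat p)).
    exact: smooth_continuous.
  exact: continuous_flat.
- move=> i x Ux; apply: (is_derive_comp (phi := flat p)); first exact: is_derive_flat.
  exact: smooth_is_derive.
- by move=> i; apply: CnM => //; exact: smooth_dpartial.
Qed.

Lemma dpartial_val f i x d : is_derive x 'e_i f d -> dpartial i f x = d.
Proof. by case. Qed.

Lemma dpartial_eq f g i x : (forall x, U x -> f x = g x) -> U x ->
  dpartial i f x = dpartial i g x.
Proof.
move=> fg Ux; apply: near_eq_derive.
by near do apply: fg; exact: open_nbhs_nbhs.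
Unshelve. all: by end_near. Qed.

Lemma dpartialM f g i x : smooth_on U f -> smooth_on U g -> U x ->
  dpartial i (fun y => f y * g y) x = dpartial i f x * g x + f x * dpartial i g x.
Proof.
move=> sf sg Ux; apply: dpartial_val; apply: is_derive_eq.
  by apply: is_deriveM; apply: smooth_is_derive.
by rewrite addrC [X in X + _]mulrC.
Qed.

Lemma dpartialD f g i x : smooth_on U f -> smooth_on U g -> U x ->
  dpartial i (fun y => f y + g y) x = dpartial i f x + dpartial i g x.
Proof.
by move=> sf sg Ux; apply: dpartial_val; apply: is_deriveD; apply: smooth_is_derive.
Qed.

Lemma dpartialB f g i x : smooth_on U f -> smooth_on U g -> U x ->
  dpartial i (fun y => f y - g y) x = dpartial i f x - dpartial i g x.
Proof.
by move=> sf sg Ux; apply: dpartial_val; apply: is_deriveB; apply: smooth_is_derive.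
Qed.

Lemma dpartial_sum (I : Type) (r : seq I) (P : pred I) (f : I -> 'rV[R]_N -> R) i x :
  (forall j, P j -> smooth_on U (f j)) -> U x ->
  dpartial i (fun y => \sum_(j <- r | P j) f j y) x =
  \sum_(j <- r | P j) dpartial i (f j) x.
Proof.
move=> sf Ux; apply: dpartial_val; apply: is_derive_bigsum => j Pj.
exact: smooth_is_derive (sf j Pj) Ux.
Qed.

Lemma dpartial_cst c i (x : 'rV[R]_N) : dpartial i (fun=> c) x = 0.
Proof. by apply: dpartial_val; exact: is_derive_cst. Qed.

Lemma dpartialX f n i x : smooth_on U f -> U x ->
  dpartial i (fun y => f y ^+ n) x = n%:R * f x ^+ n.-1 * dpartial i f x.
Proof.
move=> sf Ux; elim: n => [|n IH]; first by rewrite dpartial_cst !mul0r.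
rewrite (_ : (fun y => f y ^+ n.+1) = (fun y => f y * f y ^+ n)).
  rewrite dpartialM ?IH//; last exact: smoothX.
  case: n {IH} => [|n]; first by rewrite !expr0; ring.
  by rewrite /= -[n.+2%:R]natr1 exprS; ring.
by apply/funext => y; rewrite exprS.
Qed.

Lemma dpartialV f i x : (forall x, U x -> f x != 0) -> smooth_on U f -> U x ->
  dpartial i (fun y => (f y)^-1) x = - (f x) ^- 2 * dpartial i f x.
Proof.
move=> f0 sf Ux; apply: dpartial_val; apply: (is_derive_inv (f0 x Ux)).
exact: smooth_is_derive.
Qed.

End smooth.

(** * Symmetry of second partial derivatives *)

Section schwarz.
Variables (R : realType) (N : nat) (U : set 'rV[R]_N).
Hypothesis oU : open U.
Local Notation "'e_ i" := (delta_mx ord0 i : 'rV[R]_N) (at level 8, i at level 2).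

Lemma is_derive_translate (V : normedModType R) (f : V -> R) x v w d :
  is_derive (x + w) v f d -> is_derive x v (fun z => f (z + w)) d.
Proof.
move=> /is_derive_line H; apply/is_derive_line.
rewrite (_ : (fun t => _) = (fun t : R => f (t *: v + (x + w))))//.
by apply/funext => t; rewrite addrA.
Qed.

Lemma mvt_dpartial (f : 'rV[R]_N -> R) i (y : 'rV[R]_N) (h : R) : 0 < h ->
  (forall s, 0 <= s <= h -> derivable f (s *: 'e_i + y) 'e_i) ->
  exists2 s, 0 < s < h & f (h *: 'e_i + y) - f y = h * dpartial i f (s *: 'e_i + y).
Proof.
move=> h0 df.
have dl s : 0 <= s <= h ->
    is_derive s 1 (fun t : R => f (t *: 'e_i + y)) (dpartial i f (s *: 'e_i + y)).
  by move=> sh; apply: is_derive_along_line; apply: derivableP; exact: df.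
have [||s sh e] := MVT h0 (f := fun t : R => f (t *: 'e_i + y))
    (df := fun s => dpartial i f (s *: 'e_i + y)).
- by move=> x; rewrite in_itv /= => /andP[x0 xh]; apply: dl; rewrite !ltW.
- apply: derivable_within_continuous => x; rewrite in_itv /= => xh.
  by have [] := dl x xh.
exists s; first by move: sh; rewrite in_itv.
by move: e; rewrite scale0r add0r subr0 mulrC.
Qed.

(** Two mean values: first for f(z + h e_j) - f(z) in direction i, then for the i-th partial
    derivative in direction j. *)
Lemma second_difference (f : 'rV[R]_N -> R) i j (x : 'rV[R]_N) (h : R) : 0 < h ->
  smooth_on U f ->
  (forall s t, 0 <= s <= h -> 0 <= t <= h -> U (s *: 'e_i + (t *: 'e_j + x))) ->
  exists s t, [/\ 0 <= s <= h, 0 <= t <= h &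
    f (h *: 'e_i + (h *: 'e_j + x)) - f (h *: 'e_j + x)
      - (f (h *: 'e_i + x) - f x)
    = h * (h * dpartial j (dpartial i f) (s *: 'e_i + (t *: 'e_j + x)))].
Proof.
move=> h0 sf UU.
have hh : 0 <= h <= h by rewrite lexx ltW.
have h00 : 0 <= (0 : R) <= h by rewrite lexx ltW.
pose g z := f (z + h *: 'e_j) - f z.
have dg s : 0 <= s <= h ->
    is_derive (s *: 'e_i + x) 'e_i g
      (dpartial i f (s *: 'e_i + x + h *: 'e_j) - dpartial i f (s *: 'e_i + x)).
  move=> sh; apply: is_deriveB.
    apply: is_derive_translate; apply: smooth_is_derive; first exact: sf.
    by rewrite -addrA [x + _]addrC; exact: UU.
  apply: smooth_is_derive; first exact: sf.
  by have := UU s 0 sh h00; rewrite scale0r add0r.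
have [s sh e1] : exists2 s, 0 < s < h & g (h *: 'e_i + x) - g x = h * dpartial i g (s *: 'e_i + x).
  by apply: (@mvt_dpartial g i x h h0) => s sh; have [] := dg s sh.
have sh' : 0 <= s <= h by case/andP: sh => s0 s1; rewrite !ltW.
have [_ e2] := dg s sh'.
have [t th e3] : exists2 t, 0 < t < h &
    dpartial i f (h *: 'e_j + (s *: 'e_i + x)) - dpartial i f (s *: 'e_i + x) =
    h * dpartial j (dpartial i f) (t *: 'e_j + (s *: 'e_i + x)).
  apply: (@mvt_dpartial (dpartial i f) j (s *: 'e_i + x) h h0) => t th.
  apply: (smooth_derivable (smooth_dpartial i sf)).
  by rewrite addrCA; exact: UU.
exists s, t; split=> //; first by case/andP: th => t0 t1; rewrite !ltW.
move: e1; rewrite [dpartial i g _]e2 [_ + h *: 'e_j]addrC e3 /g => e1.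
rewrite [t *: _ + _]addrCA in e1; rewrite -e1.
by rewrite -[h *: 'e_i + x + _]addrA ![x + _]addrC; ring.
Qed.

(** One and the same second difference, divided by h^2, is a value of either mixed derivative near
    x. If these differed at x by 2e, continuity within e of both would contradict this. *)
Lemma dpartialC (f : 'rV[R]_N -> R) i j x : smooth_on U f -> U x ->
  dpartial i (dpartial j f) x = dpartial j (dpartial i f) x.
Proof.
move=> sf Ux; apply/eqP; rewrite -subr_eq0 -normr_eq0; apply/negP => /negP ne0.
have e0 : 0 < `|dpartial i (dpartial j f) x - dpartial j (dpartial i f) x| / 2.
  by rewrite divr_gt0// lt_def ne0 normr_ge0.
set e := _ / 2 in e0.
have ev i' j' : \forall y \near x, `|dpartial i' (dpartial j' f) x -
    dpartial i' (dpartial j' f) y| < e.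
  have := smooth_continuous (smooth_dpartial i' (smooth_dpartial j' sf)) Ux.
  by move=> /cvgrPdist_lt; apply.
have UE : \forall y \near x, U y by exact: open_nbhs_nbhs.
have : \forall y \near x, [/\ U y,
    `|dpartial i (dpartial j f) x - dpartial i (dpartial j f) y| < e &
    `|dpartial j (dpartial i f) x - dpartial j (dpartial i f) y| < e].
  by apply: filterS3 UE (ev i j) (ev j i) => y.
move=> /nbhs_ballP[d /= d0 dU].
(* The displaced points lie within 2h < d of x, each unit vector having sup norm at most 1. *)
pose h := d / 3.
have h0 : 0 < h by rewrite divr_gt0.
have inb i' j' s t : 0 <= s <= h -> 0 <= t <= h ->
    ball x d (s *: 'e_i' + (t *: 'e_j' + x)).
  move=> /andP[s0 sh] /andP[t0 th].
  rewrite -ball_normE /ball_ /= addrA opprD addrCA subrr addr0 normrN.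
  apply: (@le_lt_trans _ _ (`|s *: 'e_i'| + `|t *: 'e_j'|)); first exact: ler_normD.
  have ne k : `|('e_k : 'rV[R]_N)| <= 1.
    rewrite [leLHS]/Num.norm /= mx_normrE; apply/bigmax_leP; split=> // -[i0 k0] _ /=.
    by rewrite mxE; case: (_ && _); rewrite ?normr1 ?normr0.
  have h3 : d = h + h + h by rewrite /h; lra.
  rewrite !normrZ (ger0_norm s0) (ger0_norm t0).
  have := ne i'; have := ne j'; have := normr_ge0 ('e_i'); have := normr_ge0 ('e_j').
  nra.
have [s [t [sh th e1]]] := second_difference (i := i) (j := j) h0 sf
  (fun s t sh th => let: And3 u _ _ := dU _ (inb i j s t sh th) in u).
have [s' [t' [sh' th' e2]]] := second_difference (i := j) (j := i) h0 sf
  (fun s t sh th => let: And3 u _ _ := dU _ (inb j i s t sh th) in u).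
have [_ _ b1] := dU _ (inb i j s t sh th).
have [_ b2 _] := dU _ (inb j i s' t' sh' th').
have : dpartial j (dpartial i f) (s *: 'e_i + (t *: 'e_j + x)) =
  dpartial i (dpartial j f) (s' *: 'e_j + (t' *: 'e_i + x)).
  apply: (mulfI (lt0r_neq0 h0)); apply: (mulfI (lt0r_neq0 h0)).
  rewrite (addrCA (h *: 'e_i)) in e1; apply: etrans (esym e1) _; apply: etrans _ e2; ring.
move=> e3; rewrite e3 in b1.
have : `|dpartial i (dpartial j f) x - dpartial j (dpartial i f) x| < e + e.
  apply: le_lt_trans (ltrD b2 b1).
  rewrite [X in _ <= _ + X]distrC; apply: le_trans (ler_normD _ _).
  by rewrite addrA subrK.
by rewrite /e -splitr ltxx.
Qed.

End schwarz.

(** * Lebesgue measure and the topology of row vectors *)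

Section lebesgue_rV.
Variable R : realType.
Local Notation RR := (measurableTypeR R).
Local Notation mu n := (@lebesgue_tuple R n).

(** The same map as [vec] inside [volint]: tuples carry the measure, row vectors the topology and
    the derivatives. *)
Definition rV_of_tuple N (t : N.-tuple RR) : 'rV[R]_N := \row_(i < N) tnth t i.
Local Notation vec := (@rV_of_tuple _).

Lemma measurable_slab n (r : R) (c : 'I_n -> R) :
  measurable [set t : n.-tuple RR | forall i, `|tnth t i - c i| <= r].
Proof.
have -> : [set t : n.-tuple RR | forall i, `|tnth t i - c i| <= r] =
   \bigcap_(i in [set: 'I_n]) ((fun t : n.-tuple RR => tnth t i) @^-1` `[c i - r, c i + r]).
  apply/seteqP; split=> t /= H i.
    by move=> _; rewrite /= in_itv /=; have := H i; rewrite ler_distl.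
  by have := H i I; rewrite /= in_itv /= ler_distl.
apply: fin_bigcap_measurable => // i _.
rewrite -[X in measurable X]setTI; apply: measurable_tnth => //.
Qed.

Lemma lebesgue_tuple_box n (r : R) (c : 'I_n -> R) : 0 <= r ->
  mu n [set t | forall i, `|tnth t i - c i| <= r] = ((2 * r) ^+ n)%:E.
Proof.
move=> r0; elim: n c => [|n IH] c.
  rewrite /= diracE expr0 mem_set//= => i; by case: i.
rewrite /= /pushforward.
have -> : @tcons R n @^-1` [set t | forall i, `|tnth t i - c i| <= r] =
  `[c ord0 - r, c ord0 + r] `*`
  [set t | forall i, `|tnth t i - c (lift ord0 i)| <= r].
  apply/seteqP; split=> -[x t] /= H; [split => [|i]|move=> i].
  - by have := H ord0; rewrite /tcons (tnth_nth 0) /= in_itv /= ler_distl.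
  - by have := H (lift ord0 i); rewrite /tcons !(tnth_nth 0).
  - case: (unliftP ord0 i) => [j ->|->]; case: H => H1 H2.
      by have := H2 j; rewrite /tcons !(tnth_nth 0).
    by move: H1; rewrite /tcons (tnth_nth 0) /= in_itv /= ler_distl.
have [m mE] := lebesgue_tuple_sigma_finite R n.
rewrite -mE product_measure1E//; last exact: measurable_slab.
have lE : lebesgue_measure (`[c ord0 - r, c ord0 + r]%classic : set R) = (2 * r)%:E.
  rewrite lebesgue_measure_itv /= lte_fin; case: ltP => h.
    by rewrite -EFinD; congr EFin; lra.
  by rewrite (_ : r = 0) ?mulr0//; lra.
by rewrite mE IH [X in (X * _)%E]lE -EFinM exprS.
Qed.

(** The sigma-algebra on tuples is the product one, so an open set is written as a countable union
    of closed boxes with rational centres and radii 1/(n+1) contained in it. Around a point with a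
    ball of radius d inside A, any n with 2/(n+1) < d works: one radius for approximating the point
    by the centre, one for the box. *)
Lemma measurable_vec_open N (A : set 'rV[R]_N) : open A -> measurable (vec @^-1` A).
Proof.
move=> oA.
pose B (p : N.-tuple rat * nat) : set 'rV[R]_N :=
  [set x | forall i, `|x ord0 i - ratr (tnth p.1 i)| <= p.2.+1%:R^-1].
pose F p : set (N.-tuple RR) := if `[< B p `<=` A >] then vec @^-1` B p else set0.
have -> : vec @^-1` A = \bigcup_p F p.
  apply/seteqP; split=> t /= => [At|[p _]]; last first.
    by rewrite /F; case: ifPn => // /asboolP BA /BA.
  have [d /= d0 dA] : exists2 d : R, 0 < d & ball (vec t) d `<=` A.
    by have /nbhs_ballP[d d0 dA] := open_nbhs_nbhs (conj oA At); exists d.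
  have [n _ nd] : exists2 n, True & n.+1%:R^-1 + n.+1%:R^-1 < d :> R.
    have /ltr_add_invr[n nd] : 0 < d / 2 by rewrite divr_gt0.
    by rewrite add0r in nd; exists n => //; rewrite [ltRHS]splitr ltrD.
  have n0 : 0 < n.+1%:R^-1 :> R by rewrite invr_gt0.
  have q_ (y : R) : exists q : rat, `|y - ratr q| <= n.+1%:R^-1.
    move: n0; set u := n.+1%:R^-1 => u0.
    have /rat_in_itvoo[q] : y - u < y + u by lra.
    rewrite in_itv /= => /andP[q1 q2]; exists q.
    by rewrite ler_distl; lra.
  pose q := [tuple projT1 (cid (q_ (tnth t i))) | i < N].
  have qE i : `|tnth t i - ratr (tnth q i)| <= n.+1%:R^-1.
    by rewrite tnth_mktuple; exact: projT2 (cid (q_ (tnth t i))).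
  exists (q, n) => //; rewrite /F ifT /=; first by move=> i; rewrite mxE.
  apply/asboolP => x /= Bx; apply: dA; split=> // i0 j; rewrite (ord1 i0).
  rewrite /ball /= /vec mxE; apply: le_lt_trans nd.
  rewrite -(subrKA (ratr (tnth q j))); apply: (le_trans (ler_normD _ _)).
  by rewrite lerD// distrC.
apply: countable_bigcupT_measurable => [|p]; first exact: countableP.
rewrite /F; case: ifPn => // _.
have := measurable_slab (p.2.+1%:R^-1) (fun i => ratr (tnth p.1 i)).
congr measurable; apply/seteqP; split=> t /= H i; have := H i; by rewrite mxE.
Qed.

Lemma measurable_vec_closed N (A : set 'rV[R]_N) :
  closed A -> measurable (vec @^-1` A).
Proof.
move=> /closed_openC/measurable_vec_open/measurableC.
by rewrite -preimage_setC setCK.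
Qed.

Lemma measurable_fun_vec N (U : set 'rV[R]_N) (f : 'rV[R]_N -> R) : open U ->
  (forall x, U x -> {for x, continuous f}) ->
  measurable_fun (vec @^-1` U) (f \o vec).
Proof.
move=> oU cf; apply: (measurability _ (RGenOpens.measurableE R)).
move=> _ [_ [a [b ->] <-]].
rewrite (_ : _ `&` _ = vec @^-1` (U `&` f @^-1` `]a, b[))//; apply: measurable_vec_open.
rewrite openE => x [Ux fx]; apply: filterI; first exact: open_nbhs_nbhs.
by apply: cf => //; apply: open_nbhs_nbhs; split=> //; exact: interval_open.
Qed.

Lemma compact_box N (K : set 'rV[R]_N) : compact K ->
  exists2 r : R, 0 < r & forall x, K x -> forall i, `|x ord0 i| <= r.
Proof.
move=> /compact_bounded[M [Mr H]].
exists (`|M| + 1); first by rewrite ltr_wpDl.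
move=> x Kx i; apply: le_trans (H (`|M| + 1) _ x Kx); last first.
  by rewrite (le_lt_trans (ler_norm _))// ltrDl.
rewrite [leRHS]/Num.norm /= mx_normrE.
by apply: (le_bigmax _ (fun ij => `|x ij.1 ij.2|) (ord0, i)).
Qed.

Lemma compact_bound N (K : set 'rV[R]_N) (f : 'rV[R]_N -> R) : compact K ->
  (forall x, K x -> {for x, continuous f}) ->
  exists2 C : R, 0 <= C & forall x, K x -> `|f x| <= C.
Proof.
move=> cK cf.
have : compact (f @` K).
  apply: continuous_compact => //; apply: continuous_in_subspaceT => x.
  by rewrite inE; exact: cf.
move=> /compact_bounded[M [Mr H]]; exists (`|M| + 1); first by rewrite addr_ge0.
by move=> x Kx; apply: (H (`|M| + 1)); [rewrite (le_lt_trans (ler_norm _))// ltrDl|exists x].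
Qed.

Lemma integrable_compact N (U K : set 'rV[R]_N) (f : 'rV[R]_N -> R) : open U ->
  compact K -> K `<=` U ->
  (forall x, U x -> {for x, continuous f}) ->
  (forall x, U x -> ~ K x -> f x = 0) ->
  (mu N).-integrable (vec @^-1` U) (EFin \o (f \o vec)).
Proof.
move=> oU cK KU cf f0.
have mU := measurable_vec_open oU.
have mK : measurable (vec @^-1` K).
  apply: measurable_vec_closed; apply: (compact_closed (@norm_hausdorff _ _) cK).

have muK : (mu N (vec @^-1` K) < +oo)%E.
  have [r r0 Kr] := compact_box cK.
  apply: (@le_lt_trans _ _ (((2 * r) ^+ N)%:E)); last exact: ltry.
  rewrite -(lebesgue_tuple_box (fun=> 0) (ltW r0)).
  apply: le_measure; rewrite ?inE; [exact: mK|exact: (measurable_slab r (fun=> 0))|].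
  by move=> t /= Kt i; have := Kr _ Kt i; rewrite mxE subr0.
have [C C0 HC] := compact_bound cK (fun x Kx => cf x (KU x Kx)).
have iK : (mu N).-integrable (vec @^-1` K) (EFin \o (f \o vec)).
  apply: measurable_bounded_integrable => //.
    apply: measurable_funS (measurable_fun_vec oU cf) => //.
    by move=> t /=; exact: KU.
  exists C; split=> [|M CM t /= Kt]; first exact: num_real.
  by rewrite (le_trans (HC _ Kt))// ltW.
apply/integrable_mkcond => //; have /integrable_mkcond-/(_ mK) := iK.
congr integrable; apply/funext => t; rewrite !patchE.
case: ifPn; rewrite ?inE ?notin_setE /= => Kt; case: ifPn; rewrite ?inE ?notin_setE //=.
  by move=> /(_ (KU _ Kt)).
by move=> Ut; rewrite f0.
Qed.

(** If f were positive at x, it would exceed f(x)/2 on a box around x, and boxes of positive radius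
    have positive measure. *)
Lemma integral_eq0_continuous N (U : set 'rV[R]_N) (f : 'rV[R]_N -> R) : open U ->
  (forall x, U x -> {for x, continuous f}) -> (forall x, U x -> 0 <= f x) ->
  (\int[mu N]_(t in vec @^-1` U) (f (vec t))%:E <= 0)%E ->
  forall x, U x -> f x = 0.
Proof.
move=> oU cf f0 If x Ux; apply/eqP; rewrite eq_le f0// andbT leNgt; apply/negP => fx.
have fx2 : 0 < f x / 2 by rewrite divr_gt0.
have : \forall y \near x, U y /\ f x / 2 <= f y.
  near=> y; split; first by near: y; exact: open_nbhs_nbhs.
  have : `|f x - f y| < f x / 2 by near: y; move: (cf x Ux) => /cvgrPdist_lt; apply.
  by rewrite ltr_norml => /andP[_]; lra.
move=> /nbhs_ballP[d /= d0 dU].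
pose r := d / 2; have r0 : 0 < r by rewrite divr_gt0.
pose B := [set t : N.-tuple RR | forall i, `|tnth t i - x ord0 i| <= r].
have mB : measurable B by exact: measurable_slab.
have BU t : B t -> U (vec t) /\ f x / 2 <= f (vec t).
  move=> Bt; apply: dU; split=> // i j; rewrite (ord1 i) /ball /= mxE distrC.
  by apply: le_lt_trans (Bt j) _; rewrite /r; lra.
have := lebesgue_tuple_box (fun i => x ord0 i) (ltW r0); rewrite -/B => muB.
have /measurable_EFinP mf := measurable_fun_vec oU cf.
have : (\int[mu N]_(t in B) (f x / 2)%:E <= 0)%E.
  apply: le_trans If.
  apply: (@le_trans _ _ (\int[mu N]_(t in B) (f (vec t))%:E)%E).
    apply: ge0_le_integral => //.
    - by move=> t _; rewrite lee_fin ltW.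
    - by apply: measurable_funS mf => [|t /BU[]//]; exact: measurable_vec_open.
    - by move=> t /BU[_]; rewrite lee_fin.
  apply: ge0_subset_integral => //; first exact: measurable_vec_open.
  - by move=> t Ut; rewrite lee_fin f0.
  - by move=> t /BU[].
rewrite integral_cst// [X in (_ * X)%E]muB -EFinM lee_fin leNgt => /negP; apply.
by rewrite mulr_gt0// exprn_gt0// mulr_gt0.
Unshelve. all: by end_near. Qed.

End lebesgue_rV.

(** * The divergence theorem for compactly supported fields *)

Section divergence.
Variable R : realType.
Local Notation RR := (measurableTypeR R).
Local Notation mu n := (@lebesgue_tuple R n).
Local Notation vec := (@rV_of_tuple R _).

Definition tset n (t : n.-tuple RR) (i : 'I_n) (x : R) : n.-tuple RR :=
  [tuple if j == i then x else tnth t j | j < n].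

Lemma tnth_tcons0 n x (t : n.-tuple RR) : tnth (tcons (x, t)) ord0 = x.
Proof. by rewrite (tnth_nth x). Qed.

Lemma tnth_tconsS n x (t : n.-tuple RR) i :
  tnth (tcons (x, t)) (lift ord0 i) = tnth t i.
Proof. by rewrite !(tnth_nth x). Qed.

Lemma tset_tcons0 n x y (t : n.-tuple RR) : tset (tcons (x, t)) ord0 y = tcons (y, t).
Proof.
apply: eq_from_tnth => j; rewrite tnth_mktuple.
by case: (unliftP ord0 j) => [k ->|->] /=; rewrite ?tnth_tconsS ?tnth_tcons0.
Qed.

Lemma tset_tconsS n x y (t : n.-tuple RR) i :
  tset (tcons (x, t)) (lift ord0 i) y = tcons (x, tset t i y).
Proof.
apply: eq_from_tnth => j; rewrite tnth_mktuple.
case: (unliftP ord0 j) => [k ->|->]; last by rewrite !tnth_tcons0.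
by rewrite (inj_eq lift_inj) !tnth_tconsS tnth_mktuple.
Qed.

(** Both orders of integration are recorded: [integral_slices0] integrates the head coordinate
    innermost when it is the distinguished one, and outermost otherwise. *)
Lemma integral_lebesgue_tupleS n (G : n.+1.-tuple RR -> R) :
  measurable_fun setT G ->
  (lebesgue_measure \x mu n)%E.-integrable setT (EFin \o (G \o @tcons R n)) ->
  (\int[mu n.+1]_t (G t)%:E =
   \int[lebesgue_measure]_x \int[mu n]_t (G (tcons (x, t)))%:E)%E /\
  (\int[mu n.+1]_t (G t)%:E =
   \int[mu n]_t \int[lebesgue_measure]_x (G (tcons (x, t)))%:E)%E.
Proof.
move=> mG iG.
have mEG : measurable_fun setT (EFin \o G) by exact/measurable_EFinP.
pose nu := measure_function_pushforward__canonical__measure_function_Measure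
    (lebesgue_measure \x mu n)%E (@measurable_tcons R n).
have E : (\int[mu n.+1]_t (G t)%:E =
    \int[(lebesgue_measure \x mu n)%E]_p (EFin \o (G \o @tcons R n)) p)%E.
  rewrite (@eq_measure_integral _ _ _ _ nu)//.
  exact: (integral_pushforward (@measurable_tcons R n) mEG iG measurableT).
have F := Fubini iG; have P := integral12_prod_meas1 iG.
by rewrite E -P; split=> //; exact: F.
Qed.

Lemma bounded_support_integrable d (T : measurableType d)
    (nu : {measure set T -> \bar R}) (B : set T) (C : R) (G : T -> R) :
  measurable B -> (nu B < +oo)%E -> measurable_fun setT G ->
  (forall t, `|G t| <= C) -> (forall t, ~ B t -> G t = 0) ->
  nu.-integrable setT (EFin \o G).
Proof.
move=> mB nB mG GC G0.
have : nu.-integrable B (EFin \o G).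
  apply: measurable_bounded_integrable => //; first exact: measurable_funS mG.
  by exists C; split=> [|M CM t _ /=]; [exact: num_real|rewrite (le_trans (GC t))// ltW].
move/(integrable_mkcond _ mB); congr integrable; apply/funext => t.
by rewrite patchE; case: ifPn => //; rewrite notin_setE => /G0 /= ->.
Qed.

Lemma bounded_box_integrable_tcons n (r C : R) (G : n.+1.-tuple RR -> R) : 0 <= r ->
  measurable_fun setT G -> (forall t, `|G t| <= C) ->
  (forall t, ~ (forall i, `|tnth t i| <= r) -> G t = 0) ->
  (lebesgue_measure \x mu n)%E.-integrable setT (EFin \o (G \o @tcons R n)).
Proof.
move=> r0 mG GC G0.
pose B := [set t : n.+1.-tuple RR | forall i, `|tnth t i - 0| <= r].
have mB : measurable B by exact: (measurable_slab r (fun=> 0)).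
apply: (@bounded_support_integrable _ _ _ (@tcons R n @^-1` B) C) => //.
- by rewrite -[X in measurable X]setTI; exact: measurable_tcons.
- have := lebesgue_tuple_box (n := n.+1) (fun=> 0) r0.
  by rewrite /= /pushforward => ->; rewrite ltry.
- by apply: measurableT_comp => //; exact: measurable_tcons.
- by move=> t; exact: GC.
- move=> t nB; apply: G0 => H; apply: nB => i; by rewrite subr0.
Qed.

(** Fubini, reaching the i-th coordinate by induction on the dimension. Boundedness and support in a
    box supply the integrability at every stage. *)
Lemma integral_slices0 n (i : 'I_n) (r C : R) (G : n.-tuple RR -> R) : 0 <= r ->
  measurable_fun setT G -> (forall t, `|G t| <= C) ->
  (forall t, ~ (forall i, `|tnth t i| <= r) -> G t = 0) ->
  (forall t, \int[lebesgue_measure]_x (G (tset t i x))%:E = 0)%E ->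
  (\int[mu n]_t (G t)%:E = 0)%E.
Proof.
move=> r0; elim: n i G => [[]//|n IH] i G mG GC G0 Gs.
have iG := bounded_box_integrable_tcons r0 mG GC G0.
have [E1 E2] := integral_lebesgue_tupleS mG iG.
case: (unliftP ord0 i) Gs => [j ->|->] Gs.
  rewrite E1 integral0_eq// => x _; apply: (IH j (fun t => G (tcons (x, t)))).
  - have -> : (fun t => G (tcons (x, t))) = (G \o @tcons R n) \o pair x by [].
    apply: measurableT_comp; last exact: pair1_measurable.
    by apply: measurableT_comp => //; exact: measurable_tcons.
  - by move=> t; exact: GC.
  - move=> t nt; apply: G0 => H; apply: nt => k.
    by have := H (lift ord0 k); rewrite tnth_tconsS.
  - move=> t; rewrite -[RHS](Gs (tcons (x, t))).
    by apply: eq_integral => y _; rewrite tset_tconsS.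
rewrite E2 integral0_eq// => t _; rewrite -[RHS](Gs (tcons (0, t))).
by apply: eq_integral => y _; rewrite tset_tcons0.
Qed.

Lemma integral_deriv0 (f df : R -> R) (r : R) : 0 < r ->
  (forall x : R, is_derive x 1 f (df x)) -> continuous df ->
  (forall x, r < `|x| -> f x = 0) -> (forall x, r < `|x| -> df x = 0) ->
  (\int[lebesgue_measure]_x (df x)%:E = 0)%E.
Proof.
move=> r0 fdf cdf f0 df0.
have cf : continuous f.
  move=> x; apply/differentiable_continuous/derivable1_diffP.
  by have [] := fdf x.
(* The endpoints are moved out to r + 1 because f is known to vanish only strictly beyond r. *)
have rr : - (r + 1) < r + 1 by lra.
transitivity (\int[lebesgue_measure]_(x in `[(- (r + 1))%R, (r + 1)%R]) (df x)%:E)%E.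
  rewrite [RHS]integral_mkcond; apply: eq_integral => x _; rewrite patchE.
  case: ifPn => //; rewrite notin_setE /= in_itv /= => H; rewrite df0//.
  rewrite ltNge; apply/negP; rewrite ler_norml => /andP[h1 h2]; apply: H; lra.
rewrite (@continuous_FTC2 _ df f)//.
- by rewrite !f0 ?subee// ?normrN ger0_norm; lra.
- exact: continuous_subspaceT.
- split=> [x _||]; first by have [] := fdf x.
    by apply: cvg_at_right_filter; exact: cf.
  by apply: cvg_at_left_filter; exact: cf.
- by move=> x _; have [_] := fdf x; rewrite derive1E.
Qed.

Lemma integral_dpartial0 N i (F : 'rV[R]_N -> R) (K : set 'rV[R]_N) :
  smooth_on setT F -> compact K -> (forall x, ~ K x -> F x = 0) ->
  (\int[mu N]_t (dpartial i F (vec t))%:E = 0)%E.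
Proof.
move=> sF cK F0.
have oT : open [set: 'rV[R]_N] by exact: openT.
have clK : closed K by apply: (compact_closed (@norm_hausdorff _ _) cK).
have dF0 x : ~ K x -> dpartial i F x = 0.
  move=> nK; rewrite (@dpartial_eq _ _ (~` K) _ _ (fun=> 0))// ?dpartial_cst//.
  exact: closed_openC.
have [r r0 Kr] := compact_box cK.
have cdF x : {for x, continuous (dpartial i F)}.
  exact: (smooth_continuous (smooth_dpartial i sF)).
have [C C0 HC] := compact_bound cK (fun x _ => cdF x).
apply: (@integral_slices0 _ i r C) => //.
- exact: ltW.
- have := measurable_fun_vec oT (fun x _ => cdF x).
  by rewrite preimage_setT.
- move=> t; have [Kt|/dF0 ->] := pselect (K (vec t)); first exact: HC.
  by rewrite normr0.
- move=> t nt; apply: dF0 => Kt; apply: nt => j.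
  by have := Kr _ Kt j; rewrite mxE.
move=> t; pose y := vec (tset t i 0).
have vE x : vec (tset t i x) = x *: delta_mx ord0 i + y.
  apply/rowP => j; rewrite !mxE !tnth_mktuple eqxx /=.
  by case: eqP => _; rewrite ?mulr1 ?addr0// mulr0 add0r.
have far x : r < `|x| -> ~ K (vec (tset t i x)).
  move=> rx /Kr/(_ i); rewrite mxE tnth_mktuple eqxx leNgt rx//.
apply: (@integral_deriv0 (fun x => F (x *: delta_mx ord0 i + y)) _ r) => //.
- move=> x; rewrite vE; apply: is_derive_along_line.
  exact: smooth_is_derive.
- move=> x.
  have -> : (fun z => dpartial i F (vec (tset t i z))) =
      dpartial i F \o (fun z => z *: delta_mx ord0 i + y).
    by apply/funext => z; rewrite vE.
  apply: continuous_comp; last exact: cdF.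
  apply: cvgD; last exact: cvg_cst.
  exact: scalel_continuous.
- by move=> x /far nK; rewrite F0// -vE.
- by move=> x /far nK; rewrite dF0.
Qed.

Lemma Cn_setU N n (U V : set 'rV[R]_N) f : Cn n U f -> Cn n V f -> Cn n (U `|` V) f.
Proof.
elim: n f => [|n IH] f [cU dU] [cV dV].
  by split=> // x [/cU|/cV].
split=> [x [/cU|/cV]//|i]; have [du ?] := dU i; have [dv ?] := dV i.
by split=> [x [/du|/dv]//|]; exact: IH.
Qed.

(** U and the complement of K are open and cover the space; the extension by zero is F on the first
    and 0 on the second. *)
Lemma smooth_extend N (U K : set 'rV[R]_N) (F : 'rV[R]_N -> R) : open U ->
  compact K -> K `<=` U -> smooth_on U F ->
  (forall x, U x -> ~ K x -> F x = 0) -> smooth_on setT (F \_ U).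
Proof.
move=> oU cK KU sF F0 n.
have clK : closed K by apply: (compact_closed (@norm_hausdorff _ _) cK).
have <- : U `|` ~` K = setT.
  by apply/seteqP; split=> // x _; have [/KU|] := pselect (K x); [left|right].
apply: Cn_setU.
  by apply: Cn_eq (sF n) => // x Ux; rewrite patchE mem_set.
have oK := closed_openC clK.
apply: Cn_eq (smooth_cst (U := ~` K) oK 0 n) => // x nK.
by rewrite patchE; case: ifPn => //; rewrite inE => Ux; rewrite F0.
Qed.

Lemma integral_divergence0 N (U K : set 'rV[R]_N) (F : 'I_N -> 'rV[R]_N -> R) :
  open U -> compact K -> K `<=` U -> (forall i, smooth_on U (F i)) ->
  (forall i x, U x -> ~ K x -> F i x = 0) ->
  (\int[mu N]_(t in vec @^-1` U) (\sum_i dpartial i (F i) (vec t))%:E = 0)%E.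
Proof.
move=> oU cK KU sF F0.
have mU := measurable_vec_open oU.
have clK : closed K by apply: (compact_closed (@norm_hausdorff _ _) cK).
have oK := closed_openC clK.
have dF0 i x : U x -> ~ K x -> dpartial i (F i) x = 0.
  move=> Ux nK; rewrite (@dpartial_eq _ _ (U `&` ~` K) _ _ (fun=> 0))// ?dpartial_cst//.
    exact: openI.
  by move=> z [Uz nz]; exact: F0.
under eq_integral do rewrite -sumEFin.
rewrite integral_sum//=; last first.
  move=> i; apply: (@integrable_compact _ _ _ _ (dpartial i (F i)) oU cK KU).
    by move=> x; exact: (smooth_continuous (smooth_dpartial i (sF i))).
  exact: dF0.
apply: big1 => i _.
have sFi := smooth_extend oU cK KU (sF i) (F0 i).
rewrite -[RHS](@integral_dpartial0 _ i _ K sFi cK) => [|x nK]; last first.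
  by rewrite patchE; case: ifPn => //; rewrite inE => Ux; rewrite F0.
rewrite integral_mkcond; apply: eq_integral => t _; rewrite patchE.
case: ifPn; rewrite ?inE ?notin_setE /= => Ut; congr EFin.
  by apply: (dpartial_eq oU) => // x Ux; rewrite patchE mem_set.
rewrite (@dpartial_eq _ _ (~` K) _ _ (fun=> 0)) ?dpartial_cst//.
  by move=> x nK; rewrite patchE; case: ifPn => //; rewrite inE => Ux; rewrite F0.
by move=> /KU.
Qed.

End divergence.

(** * The ball model and its connection in an orthonormal frame *)

Section ball_model.
Variables (R : realType) (N : nat) (a : R).
Local Notation idx k := {ffun 'I_k -> 'I_N}.
Local Notation M := (hyperbolic N a).
Local Notation U := (Defs.dom (hyperbolic N a)).
Local Notation "'e_ i" := (delta_mx ord0 i : 'rV[R]_N) (at level 8, i at level 2).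

Definition rho (x : 'rV[R]_N) : R := 1 - a ^+ 2 * sqeucl x / 4.

(** The components of - d rho ([dpartial_rho]), from which all connection coefficients are built. *)
Definition yy (i : 'I_N) (x : 'rV[R]_N) : R := a ^+ 2 / 2 * x ord0 i.

Lemma smooth_sqeucl (V : set 'rV[R]_N) : open V -> smooth_on V (@sqeucl R N).
Proof.
move=> oV; apply: smooth_sum => // i _; apply: smoothX => //.
exact: smooth_coord.
Qed.

Lemma smooth_rho (V : set 'rV[R]_N) : open V -> smooth_on V rho.
Proof.
move=> oV; apply: smoothB => //; first exact: smooth_cst.
apply: smoothM => //; last exact: smooth_cst.
by apply: smoothM => //; [exact: smooth_cst|exact: smooth_sqeucl].
Qed.

Lemma smooth_yy (V : set 'rV[R]_N) i : open V -> smooth_on V (yy i).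
Proof.
move=> oV; apply: smoothM => //; first exact: smooth_cst.
exact: smooth_coord.
Qed.

Lemma domE x : U x <-> 0 < rho x.
Proof. by rewrite /= /rho; split; lra. Qed.

Lemma open_dom : open U.
Proof.
have -> : U = rho @^-1` `]0, +oo[.
  by apply/seteqP; split=> x; rewrite /= in_itv /= andbT => /domE.
apply: open_comp; last exact: interval_open.
by move=> x _; apply: (smooth_continuous (smooth_rho openT)).
Qed.
Let oU := open_dom.

Lemma sqeucl_ge0 (x : 'rV[R]_N) : 0 <= sqeucl x.
Proof. by rewrite sumr_ge0// => i _; rewrite sqr_ge0. Qed.

Lemma rho_le1 (x : 'rV[R]_N) : rho x <= 1.
Proof.
rewrite /rho lerBlDr lerDl divr_ge0// mulr_ge0 ?sqr_ge0//.
exact: sqeucl_ge0.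
Qed.

Lemma rho_neq0 x : U x -> rho x != 0.
Proof. by move=> /domE/lt0r_neq0. Qed.

Lemma dpartial_sqeucl i x : dpartial i (@sqeucl R N) x = 2 * x ord0 i.
Proof.
have oT : open [set: 'rV[R]_N] by exact: openT.
rewrite (@dpartial_sum _ _ setT)//; last first.
  by move=> j _; apply: smoothX => //; exact: smooth_coord.
rewrite (bigD1 i) //= big1 ?addr0 => [|j ji].
  rewrite (@dpartialX _ _ setT)//; last exact: smooth_coord.
  by rewrite (dpartial_val (is_derive_coord i i x)) eqxx mulr1 expr1.
rewrite (@dpartialX _ _ setT)//; last exact: smooth_coord.
by rewrite (dpartial_val (is_derive_coord i j x)) eq_sym (negbTE ji) mulr0.
Qed.

Lemma dpartial_rho i x : dpartial i rho x = - yy i x.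
Proof.
have oT : open [set: 'rV[R]_N] by exact: openT.
have c1 c := @smooth_cst R N setT oT c.
have sq := smooth_sqeucl oT.
rewrite /rho (@dpartialB _ _ setT (fun=> 1) (fun x => a ^+ 2 * sqeucl x / 4))//; last first.
  by apply: smoothM => //; apply: smoothM.
rewrite (@dpartialM _ _ setT (fun x => a ^+ 2 * sqeucl x) (fun=> 4^-1))//; last exact: smoothM.
rewrite (@dpartialM _ _ setT (fun=> a ^+ 2))// !dpartial_cst dpartial_sqeucl /yy.
by field.
Qed.

Lemma dpartial_yy i j x : dpartial i (yy j) x = a ^+ 2 / 2 * (i == j)%:R.
Proof.
have oT : open [set: 'rV[R]_N] by exact: openT.
rewrite /yy (@dpartialM _ _ setT (fun=> a ^+ 2 / 2) (fun x => x ord0 j))//.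
- by rewrite dpartial_cst (dpartial_val (is_derive_coord i j x)) mul0r add0r.
- exact: smooth_cst.
- exact: smooth_coord.
Qed.

(** The identity rho a^2 + |d rho|^2 = a^2 expresses that the curvature is constant; [nabla_commute]
    uses it to collect its curvature term. *)
Lemma sum_yy2 x : rho x * a ^+ 2 + \sum_m yy m x ^+ 2 = a ^+ 2.
Proof.
have -> : \sum_m yy m x ^+ 2 = a ^+ 4 / 4 * sqeucl x.
  rewrite /sqeucl mulr_sumr; by apply: eq_bigr => m _; rewrite /yy; field.
by rewrite /rho; field.
Qed.

Lemma metricE x : Defs.metric M x = (rho x ^- 2)%:M.
Proof. by []. Qed.

Lemma invmx_metric x : invmx (Defs.metric M x) = (rho x ^+ 2)%:M.
Proof. by rewrite metricE invmx_scalar invrK. Qed.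

Lemma sqrt_det_metric x : U x -> Num.sqrt (\det (Defs.metric M x)) = rho x ^- N.
Proof.
move=> /domE r0; rewrite metricE det_scalar -exprVn -exprM mulnC exprM.
by rewrite sqrtr_sqr ger0_norm ?exprn_ge0 ?invr_ge0 ?ltW// exprVn.
Qed.

Lemma tinnerE k (u v : tensor R N k) x :
  tinner M u v x = rho x ^+ (2 * k) * \sum_I u I x * v I x.
Proof.
rewrite /tinner invmx_metric; set g := _%:M.
rewrite mulr_sumr; apply: eq_bigr => I _.
rewrite (bigD1 I) //= [X in _ + X]big1 ?addr0 => [|J JI].
  rewrite [RHS]mulrA; congr (_ * _); congr (_ * _).
  rewrite exprM -[k in RHS]card_ord -prodr_const.
  by apply: eq_bigr => s _; rewrite mxE eqxx.
have [s Is] : exists s, I s != J s.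
  apply/existsP; rewrite -negb_forall; apply: contra JI => /forallP IJ.
  by apply/eqP/ffunP => s; apply/esym/eqP.
rewrite (bigD1 s) //= mxE (negbTE Is) mulr0n !mul0r//.
Qed.

Lemma volintE (f : 'rV[R]_N -> R) :
  volint M f = (\int[@lebesgue_tuple R N]_(t in @rV_of_tuple R N @^-1` U)
    (f (rV_of_tuple t) * rho (rV_of_tuple t) ^- N)%:E)%E.
Proof.
apply: eq_integral => t; rewrite inE /= => Ut.
by rewrite sqrt_det_metric.
Qed.

(** The usual formula for a conformally flat metric e^(2f) with f = - ln rho, whose partial
    derivatives are [yy i x / rho x]. *)
Lemma christoffelE m i j x : U x ->
  christoffel M m i j x =
  (rho x)^-1 * ((m == i)%:R * yy j x + (m == j)%:R * yy i x - (i == j)%:R * yy m x).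
Proof.
move=> Ux; have r0 := rho_neq0 Ux.
have dg l p q : dpartial l (fun y => Defs.metric M y p q) x =
    (p == q)%:R * (2 * rho x ^- 3 * yy l x).
  have -> : (fun y => Defs.metric M y p q) = (fun y => (rho y ^+ 2)^-1 * (p == q)%:R).
    by apply/funext => y; rewrite metricE mxE mulr_natr.
  have rn0 z : U z -> rho z ^+ 2 != 0 by move=> /rho_neq0 ?; rewrite expf_neq0.
  have s2 : smooth_on U (fun y => rho y ^+ 2).
    by apply: smoothX => //; exact: smooth_rho.
  rewrite (@dpartialM _ _ U (fun y => (rho y ^+ 2)^-1) (fun=> (p == q)%:R))//; first last.
  - exact: smooth_cst.
  - exact: smoothV.
  rewrite dpartial_cst (@dpartialV _ _ U)// (@dpartialX _ _ U)//; last exact: smooth_rho.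
  rewrite dpartial_rho /= expr1; field.
  by rewrite r0.
rewrite /christoffel (bigD1 m) //= big1 ?addr0 => [|l lm]; last first.
  by rewrite invmx_metric mxE eq_sym (negbTE lm) mulr0n mul0r.
rewrite invmx_metric mxE eqxx mulr1n !dg (eq_sym j m) (eq_sym i m); field.
by rewrite r0.
Qed.

(** The connection matrix in the direction of the i-th frame vector, with the sign that lets it be
    added in [nabla]. Being skew ([AmxT]) reflects the orthonormality of the frame. *)
Definition Amx (i : 'I_N) (x : 'rV[R]_N) : 'M[R]_N :=
  \matrix_(p, m) ((i == p)%:R * yy m x - yy p x * (i == m)%:R).

(* The Levi-Civita connection in the orthonormal frame [rho * d/dx_i]. *)
Definition nabla k (i : 'I_N) (u : tensor R N k) : tensor R N k :=
  fun I x => rho x * dpartial i (u I) x + glact (Amx i x) (u^~ x) I.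

(** Components in the frame [rho * d/dx_i]: each slot contributes one factor rho. *)
Definition hat k (u : tensor R N k) : tensor R N k :=
  fun I x => rho x ^+ k * u I x.

Definition fslot k (u : tensor R N k.+1) (j : 'I_N) : tensor R N k :=
  fun J => u (icons j J).

Definition smooth_tensor k (u : tensor R N k) := forall I, smooth_on U (u I).

Lemma smooth_Amx i p m : smooth_on U (fun x => Amx i x p m).
Proof.
apply: (@smooth_eq _ _ _ oU (fun x => (i == p)%:R * yy m x - yy p x * (i == m)%:R)).
  by move=> x _; rewrite mxE.
by apply: smoothB => //; apply: smoothM => //; (exact: smooth_cst || exact: smooth_yy).
Qed.

Lemma smooth_act k (A : 'rV[R]_N -> 'M[R]_N) (u : tensor R N k) I :
  (forall p m, smooth_on U (fun x => A x p m)) -> smooth_tensor u ->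
  smooth_on U (fun x => glact (A x) (u^~ x) I).
Proof.
move=> sA su; apply: smooth_sum => // s _; apply: smooth_sum => // m _.
exact: smoothM.
Qed.

Lemma smooth_nabla k i (u : tensor R N k) : smooth_tensor u ->
  smooth_tensor (nabla i u).
Proof.
move=> su I; apply: smoothD => //; last by apply: smooth_act => //; exact: smooth_Amx.
by apply: smoothM => //; [exact: smooth_rho|exact: smooth_dpartial].
Qed.

Lemma smooth_hat k (u : tensor R N k) : smooth_tensor u -> smooth_tensor (hat u).
Proof.
by move=> su I; apply: smoothM => //; apply: smoothX => //; exact: smooth_rho.
Qed.

Lemma covd_act k (u : tensor R N k) i I x :
  covd M u (icons i I) x = dpartial i (u I) x -
    glact (\matrix_(p, m) christoffel M m i p x) (u^~ x) I.
Proof.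
rewrite /covd itailE iinsK iins_id; congr (_ - _).
by apply: eq_bigr => s _; apply: eq_bigr => m _; rewrite mxE.
Qed.

(** The Christoffel matrix in direction i is rho^-1 (y_i Id - A_i). Its scalar part matches the
    derivative of the factor rho^k in [hat], its skew part is the matrix in [nabla]. *)
Lemma nabla_hat k i (u : tensor R N k) I x : smooth_tensor u -> U x ->
  nabla i (hat u) I x = rho x ^+ k.+1 * covd M u (icons i I) x.
Proof.
move=> su Ux; have r0 := rho_neq0 Ux.
rewrite covd_act /nabla /hat.
rewrite (@dpartialM _ _ U (fun x => rho x ^+ k))//; last first.
  by apply: smoothX => //; exact: smooth_rho.
rewrite (@dpartialX _ _ U)//; last exact: smooth_rho.
rewrite dpartial_rho glactZr.
have -> : (\matrix_(p, m) christoffel M m i p x) =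
    (rho x)^-1 *: ((yy i x)%:M - Amx i x).
  apply/matrixP => p m; rewrite !mxE christoffelE//.
  rewrite (eq_sym p m) (eq_sym i m); ring.
rewrite glactZl glactBl glact_scalar exprS.
by case: k u su I => [|k] u su I /=; rewrite ?mul0r ?exprS; field.
Qed.

(** On the right j is a label that [nabla] does not differentiate; the two extra terms are the
    action of [Amx i x] on slot 0, that is, the rotation of the frame. *)
Lemma nabla_cons k i (u : tensor R N k.+1) j J x :
  nabla i u (icons j J) x = nabla i (fslot u j) J x
    + (i == j)%:R * (\sum_m yy m x * u (icons m J) x) - yy j x * u (icons i J) x.
Proof.
rewrite /nabla glact_cons /fslot.
have -> : \sum_m Amx i x j m * u (icons m J) x =
    (i == j)%:R * (\sum_m yy m x * u (icons m J) x) - yy j x * u (icons i J) x.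
  rewrite mulr_sumr; under eq_bigr do rewrite mxE mulrBl -mulrA.
  rewrite sumrB; congr (_ - _); rewrite (bigD1 i) //= big1 ?addr0 => [|m mi].
    by rewrite eqxx mulr1.
  by rewrite eq_sym (negbTE mi) mulr0 mul0r.
by rewrite /slot; ring.
Qed.

Lemma AmxT i x : (Amx i x)^T = - Amx i x.
Proof. by apply/matrixP => p m; rewrite !mxE; ring. Qed.

Lemma nabla_skew k i (u w : tensor R N k) x :
  smooth_tensor u -> smooth_tensor w -> U x ->
  rho x * dpartial i (fun x => \sum_I u I x * w I x) x =
  \sum_I (nabla i u I x * w I x + u I x * nabla i w I x).
Proof.
move=> su sw Ux.
rewrite (@dpartial_sum _ _ U)//; last by move=> I _; exact: smoothM.
have := glact_adj (Amx i x) (u^~ x) (w^~ x); rewrite AmxT.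
under [X in _ = X -> _]eq_bigr do rewrite glactNl mulrN.
rewrite sumrN => /eqP; rewrite -subr_eq0 opprK => /eqP H.
rewrite -[LHS]addr0 -[X in _ + X = _]H mulr_sumr -!big_split /=; apply: eq_bigr => I _.
rewrite (dpartialM _ (su I) (sw I) Ux) /nabla; ring.
Qed.

Lemma commutator_Amx i j x :
  Amx i x *m Amx j x - Amx j x *m Amx i x =
  yy j x *: Amx i x - yy i x *: Amx j x
  + (\sum_m yy m x ^+ 2) *: (delta_mx j i - delta_mx i j).
Proof.
have mE i' j' p q : (Amx i' x *m Amx j' x) p q =
   (i' == p)%:R * yy j' x * yy q x
   - (i' == p)%:R * (j' == q)%:R * (\sum_m yy m x ^+ 2)
   - yy p x * yy q x * (i' == j')%:R + yy p x * yy i' x * (j' == q)%:R.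
  rewrite mxE.
  transitivity (\sum_m ((j' == m)%:R * ((i' == p)%:R * yy m x * yy q x)
     - (i' == p)%:R * (j' == q)%:R * yy m x ^+ 2
     - (i' == m)%:R * (yy p x * yy q x * (j' == m)%:R)
     + (i' == m)%:R * (yy p x * yy m x * (j' == q)%:R))).
    by apply: eq_bigr => m _; rewrite !mxE; ring.
  have pick (l : 'I_N) (F : 'I_N -> R) : \sum_m (l == m)%:R * F m = F l.
    rewrite (bigD1 l) //= big1 ?addr0 => [|m ml]; first by rewrite eqxx mul1r.
    by rewrite eq_sym (negbTE ml) mul0r.
  rewrite big_split !sumrB /= !pick -mulr_sumr (eq_sym j' i').
  ring.
apply/matrixP => p q.
have sub (A B : 'M[R]_N) : (A - B) p q = A p q - B p q by rewrite !mxE.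
rewrite sub !mE !mxE (eq_sym j i) (eq_sym p j) (eq_sym q i) (eq_sym p i) (eq_sym q j).
rewrite -!mulnb !natrM; ring.
Qed.

(** Here [nabla i] and [nabla j] are composed as operators, so their commutator is the derivative
    along the bracket of the frame fields plus curvature. With e_i = rho d/dx_i the bracket
    [e_i, e_j] is y_j e_i - y_i e_j. *)
Lemma nabla_commute k i j (u : tensor R N k) I x : smooth_tensor u -> U x ->
  nabla i (nabla j u) I x = nabla j (nabla i u) I x
   - yy i x * nabla j u I x + yy j x * nabla i u I x
   + a ^+ 2 * glact (delta_mx j i - delta_mx i j) (u^~ x) I.
Proof.
move=> su Ux; have sr : smooth_on U rho by exact: smooth_rho.
have E i' j' : nabla i' (nabla j' u) I x =
    rho x * (- yy i' x * dpartial j' (u I) x + rho x * dpartial i' (dpartial j' (u I)) x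
      + a ^+ 2 / 2 * glact (delta_mx j' i' - delta_mx i' j') (u^~ x) I
      + glact (Amx j' x) (fun K => dpartial i' (u K) x) I)
    + (rho x * glact (Amx i' x) (fun K => dpartial j' (u K) x) I
       + glact (Amx i' x) (glact (Amx j' x) (u^~ x)) I).
  rewrite {1}/nabla; congr (_ * _ + _); last by rewrite glactDr glactZr.
  have sA : forall p m, smooth_on U (fun x => Amx j' x p m) by exact: smooth_Amx.
  have sd : smooth_on U (dpartial j' (u I)) by exact: smooth_dpartial.
  rewrite {1}/nabla (dpartialD _ (smoothM oU sr sd) (smooth_act I sA su) Ux).
  rewrite (dpartialM _ sr sd Ux) dpartial_rho -!addrA; congr (_ + (_ + _)).
  rewrite /glact (@dpartial_sum _ _ U)//; last first.
    by move=> s _; apply: smooth_sum => // m _; apply: smoothM.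
  rewrite mulr_sumr -big_split /=; apply: eq_bigr => s _.
  rewrite (@dpartial_sum _ _ U)//; last by move=> m _; apply: smoothM.
  rewrite mulr_sumr -big_split /=; apply: eq_bigr => m _.
  rewrite (dpartialM _ (sA _ _) (su _) Ux); congr (_ + _).
  rewrite mulrA; congr (_ * _).
  rewrite (@dpartial_eq _ _ U oU _ (fun x => (j' == I s)%:R * yy m x - yy (I s) x * (j' == m)%:R))//; last first.
    by move=> z _; rewrite mxE.
  have sc c : smooth_on U (fun=> c) by exact: smooth_cst.
  have sy l : smooth_on U (yy l) by exact: smooth_yy.
  rewrite (dpartialB _ (smoothM oU (sc _) (sy _)) (smoothM oU (sy _) (sc _)) Ux).
  rewrite (dpartialM _ (sc _) (sy _) Ux) (dpartialM _ (sy _) (sc _) Ux).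
  rewrite !dpartial_cst !dpartial_yy !mxE.
  rewrite (eq_sym (I s) j') (eq_sym m i') (eq_sym (I s) i') (eq_sym m j').
  rewrite -!mulnb !natrM; ring.
have D : glact (Amx i x) (glact (Amx j x) (u^~ x)) I =
    glact (Amx j x) (glact (Amx i x) (u^~ x)) I
    + (yy j x * glact (Amx i x) (u^~ x) I - yy i x * glact (Amx j x) (u^~ x) I
    + (\sum_m yy m x ^+ 2) * glact (delta_mx j i - delta_mx i j) (u^~ x) I).
  have := glact_commute (Amx i x) (Amx j x) (u^~ x) I.
  rewrite commutator_Amx glactDl glactBl !glactZl => /eqP.
  by rewrite subr_eq addrC => /eqP.
rewrite !E D (dpartialC oU i j (su I) Ux) /nabla.
have -> : glact (delta_mx i j - delta_mx j i) (u^~ x) I =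
   - glact (delta_mx j i - delta_mx i j) (u^~ x) I by rewrite -glactNl opprB.
set G := glact (delta_mx j i - _) _ _.
(* The derivatives of the connection matrices give rho a^2 and their commutator gives the sum of
   squares; only together do they form the constant a^2. *)
have <- : (rho x * a ^+ 2 + \sum_m yy m x ^+ 2) * G = a ^+ 2 * G by rewrite sum_yy2.
by field.
Qed.

End ball_model.

(** * The Bochner identity for coclosed forms *)

Section weitzenbock.
Variables (R : realType) (N : nat) (a : R).
Local Notation idx k := {ffun 'I_k -> 'I_N}.
Local Notation M := (hyperbolic N a).
Local Notation U := (Defs.dom (hyperbolic N a)).
Local Notation nabla := (nabla a).
Local Notation rho := (rho a).
Local Notation yy := (yy a).
Local Notation smooth_tensor := (smooth_tensor a).
Let oU : open U := @open_dom R N a.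

Lemma sum_delta (l : 'I_N) (F : 'I_N -> R) : \sum_m (l == m)%:R * F m = F l.
Proof.
rewrite (bigD1 l) //= big1 ?addr0 => [|m ml]; first by rewrite eqxx mul1r.
by rewrite eq_sym (negbTE ml) mul0r.
Qed.

(** The case of a fixed J, with v j = h(j, J), t i j = nabla_i h(j, J), D i j = nabla_i nabla_j h(i,
    J), y = [yy], and c = a^2 (degree - N). The hypotheses are coclosedness and the commuted trace
    of second derivatives; what remains is rearranging sums. *)
Lemma bochner_algebra (t : 'I_N -> 'I_N -> R) (v y : 'I_N -> R)
    (D : 'I_N -> 'I_N -> R) c :
  \sum_i t i i = 0 -> (forall j, \sum_i D i j = c * v j - \sum_i y i * t i j) ->
  \sum_i \sum_j t i j * t j i =
  \sum_i \sum_j ((t i j + y j * v i - (i == j)%:R * \sum_m y m * v m) * t j i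
      + v j * (D i j + y i * t j i - \sum_m y m * t j m))
  + (N%:R - 1) * \sum_j v j * \sum_i y i * t j i - c * \sum_j v j ^+ 2.
Proof.
move=> t0 DE; set Y := \sum_m y m * v m.
transitivity (\sum_i (\sum_j t i j * t j i + \sum_j y j * v i * t j i
      - Y * t i i + \sum_j v j * D i j + \sum_j v j * (y i * t j i)
      - \sum_j v j * \sum_m y m * t j m)
   + (N%:R - 1) * \sum_j v j * \sum_i y i * t j i - c * \sum_j v j ^+ 2); last first.
  congr (_ + _ - _); apply: eq_bigr => i _.
  rewrite [RHS](eq_bigr (fun j => t i j * t j i + y j * v i * t j i
      + - ((i == j)%:R * (Y * t j i)) + v j * D i j
      + v j * (y i * t j i) + - (v j * \sum_m y m * t j m))).
    by rewrite !big_split /= !sumrN sum_delta.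
  by move=> j _; ring.
rewrite sumrB !big_split /= sumrN -mulr_sumr t0 mulr0 subr0 sumr_const card_ord -mulr_natl.
have e1 : \sum_i \sum_j v j * D i j = c * \sum_j v j ^+ 2 - \sum_j v j * \sum_i y i * t i j.
  rewrite exchange_big mulr_sumr -sumrB; apply: eq_bigr => j _.
  by rewrite -mulr_sumr DE; ring.
have e2 : \sum_i \sum_j v j * (y i * t j i) = \sum_j v j * \sum_m y m * t j m.
  by rewrite exchange_big; apply: eq_bigr => j _; rewrite -mulr_sumr.
have e3 : \sum_i \sum_j y j * v i * t j i = \sum_j v j * \sum_i y i * t i j.
  by apply: eq_bigr => i _; rewrite mulr_sumr; apply: eq_bigr => j _; ring.
rewrite e1 e2 e3; ring.
Qed.

(** The first sum on the right is the divergence of the field with frame components [W i], that is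
    rho^N sum_i d_i (rho^(1-N) W_i). Coclosedness is assumed on all of U because it gets
    differentiated. The form has degree [k.+1]. *)
Lemma bochner k (u : tensor R N k.+1) x : smooth_tensor u -> U x ->
  alt (u^~ x) ->
  (forall z, U z -> forall J, \sum_i nabla i u (icons i J) z = 0) ->
  let W i x := \sum_j \sum_J u (icons j J) x * nabla j u (icons i J) x in
  \sum_i \sum_j \sum_J nabla i u (icons j J) x * nabla j u (icons i J) x =
  \sum_i (rho x * dpartial i (W i) x + (N%:R - 1) * yy i x * W i x)
  + a ^+ 2 * (N%:R - k.+1%:R) * \sum_j \sum_J u (icons j J) x ^+ 2.
Proof.
move=> su Ux au tr0 W.
pose tt i j (J : idx k) := nabla i u (icons j J) x.
pose uu j (J : idx k) := u (icons j J) x.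
pose DT i j l (J : idx k) := nabla i (nabla j u) (icons l J) x.
have sT j : smooth_tensor (nabla j u) by exact: smooth_nabla.
have sfu j : smooth_tensor (fslot u j) by move=> J; exact: su.
have sfT j i : smooth_tensor (fslot (nabla j u) i) by move=> J; exact: sT.
have F1 i j J : nabla i (fslot u j) J x =
    tt i j J + yy j x * uu i J - (i == j)%:R * \sum_m yy m x * uu m J.
  by rewrite /tt nabla_cons /uu; ring.
have F2 i j J : nabla i (fslot (nabla j u) i) J x =
    DT i j i J + yy i x * tt j i J - \sum_m yy m x * tt j m J.
  by rewrite /DT nabla_cons eqxx mul1r /tt; ring.
(* The trace vanishes identically, hence so does its derivative along j; [nabla_cons] passes from
   the derivative of the contraction to the contraction of the derivative. *)
have F4 j J : \sum_i DT j i i J =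
    \sum_m yy m x * tt j m J - \sum_i yy i x * tt i j J.
  have : \sum_i nabla j (fslot (nabla i u) i) J x = 0.
    rewrite big_split /= -mulr_sumr -(@dpartial_sum _ _ U)//; last first.
      by move=> i _; exact: sT.
    rewrite (@dpartial_eq _ _ U oU _ (fun=> 0))//; last by move=> z Uz; exact: tr0.
    rewrite dpartial_cst mulr0 add0r /glact exchange_big big1 //= => s _.
    rewrite exchange_big big1 //= => m _; rewrite -mulr_sumr.
    by rewrite [X in _ * X]tr0// mulr0.
  have E i : nabla j (fslot (nabla i u) i) J x =
      DT j i i J - (j == i)%:R * (\sum_m yy m x * tt i m J) + yy i x * tt i j J.
    by rewrite /DT nabla_cons /tt; ring.
  under eq_bigr do rewrite E.
  by rewrite big_split sumrB /= sum_delta; lra.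
(* Commuting the two derivatives reduces this trace to [F4], up to bracket terms and the curvature
   evaluated by [glact_curvature]. *)
have F3 j J : \sum_i DT i j i J =
    a ^+ 2 * (k.+1%:R - N%:R) * uu j J - \sum_i yy i x * tt i j J.
  have E i : DT i j i J = DT j i i J - yy i x * tt j i J + yy j x * tt i i J
      + a ^+ 2 * glact (delta_mx j i - delta_mx i j) (u^~ x) (icons i J).
    by rewrite /DT nabla_commute.
  rewrite (eq_bigr _ (fun i _ => E i)) big_split /= -mulr_sumr glact_curvature//.
  rewrite big_split /= -mulr_sumr [\sum_i tt i i J]tr0// mulr0 addr0.
  by rewrite sumrB F4 /uu; ring.
have dW i : rho x * dpartial i (W i) x =
    \sum_j \sum_J ((tt i j J + yy j x * uu i J
                    - (i == j)%:R * \sum_m yy m x * uu m J) * tt j i J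
      + uu j J * (DT i j i J + yy i x * tt j i J - \sum_m yy m x * tt j m J)).
  rewrite /W (@dpartial_sum _ _ U)//; last first.
    by move=> j _; apply: smooth_sum => // J _; apply: smoothM => //; exact: sT.
  rewrite mulr_sumr; apply: eq_bigr => j _.
  rewrite (@nabla_skew _ _ _ _ _ (fslot u j) (fslot (nabla j u) i))//.
  by apply: eq_bigr => J _; rewrite F1 F2.
rewrite big_split /= (eq_bigr _ (fun i _ => dW i)).
have sw (F : 'I_N -> 'I_N -> idx k -> R) :
    \sum_i \sum_j \sum_J F i j J = \sum_J \sum_i \sum_j F i j J.
  by under eq_bigr do rewrite exchange_big /=; rewrite exchange_big.
have yW : \sum_i (N%:R - 1) * yy i x * W i x =
    \sum_J (N%:R - 1) * \sum_j uu j J * \sum_i yy i x * tt j i J.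
  under eq_bigr do rewrite -mulrA; rewrite -[LHS]mulr_sumr -mulr_sumr; congr (_ * _).
  under eq_bigr do rewrite mulr_sumr; under eq_bigr do under eq_bigr do rewrite mulr_sumr.
  rewrite sw; apply: eq_bigr => J _; rewrite exchange_big /=; apply: eq_bigr => j _.
  by rewrite mulr_sumr; apply: eq_bigr => i _; rewrite /uu /tt; ring.
rewrite yW !sw [X in a ^+ 2 * _ * X]exchange_big /= mulr_sumr -!big_split /=.
apply: eq_bigr => J _.
rewrite (@bochner_algebra (fun i j => tt i j J) (fun j => uu j J) (fun i => yy i x)
  (fun i j => DT i j i J) (a ^+ 2 * (k.+1%:R - N%:R))).
- by rewrite /uu; ring.
- exact: tr0.
- by move=> j; exact: F3.
Qed.

End weitzenbock.

(** * Exterior derivative and divergence of differential forms *)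

Section forms.
Variables (R : realType) (N : nat) (a : R).
Local Notation idx k := {ffun 'I_k -> 'I_N}.
Local Notation M := (hyperbolic N a).
Local Notation U := (Defs.dom (hyperbolic N a)).
Local Notation nabla := (nabla a).
Local Notation rho := (rho a).
Local Notation yy := (yy a).
Local Notation smooth_tensor := (smooth_tensor a).
Let oU : open U := @open_dom R N a.

Definition alt_field k (u : tensor R N k) := forall x, U x -> alt (u^~ x).

Lemma diff_formP k (u : tensor R N k) :
  diff_form M u <-> smooth_tensor u /\ alt_field u.
Proof.
split=> -[su au]; split=> //; first by move=> x Ux s I; exact: au.
by move=> s I x Ux; exact: au.
Qed.

Lemma dpartialZ c (f : 'rV[R]_N -> R) i x : smooth_on U f -> U x ->
  dpartial i (fun y => c * f y) x = c * dpartial i f x.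
Proof.
move=> sf Ux; rewrite (dpartialM _ (smooth_cst oU c) sf Ux).
by rewrite dpartial_cst mul0r add0r.
Qed.

Lemma dpartial_alt k (u : tensor R N k) i x : smooth_tensor u -> alt_field u ->
  U x -> alt (fun I => dpartial i (u I) x).
Proof.
move=> su au Ux s I; rewrite -dpartialZ//.
by apply: (dpartial_eq oU) => // z Uz; exact: au.
Qed.

Lemma alt_glact k A (v : idx k -> R) : alt v -> alt (glact A v).
Proof.
move=> av s I; rewrite /glact mulr_sumr [RHS](reindex_inj (@perm_inj _ s)) /=.
apply: eq_bigr => t _; rewrite mulr_sumr; apply: eq_bigr => m _.
rewrite ffunE mulrCA; congr (_ * _); rewrite -av; congr (v _).
by apply/ffunP => r; rewrite !ffunE (inj_eq (@perm_inj _ s)).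
Qed.

(** Deleting slot s + 1 of (i, I) leaves i in front of I without its entry s. Moving i back into
    slot s costs (-1)^s, so every such term ends with the sign -1. *)
Lemma extd_cons k (u : tensor R N k) i I x : smooth_tensor u -> alt_field u ->
  U x -> extd u (icons i I) x =
    dpartial i (u I) x - \sum_s dpartial (I s) (u (isubst I s i)) x.
Proof.
move=> su au Ux; rewrite /extd big_ord_recl /= expr0 mul1r iins_id.
rewrite -/(idel ord0 (icons i I)) iinsK; congr (_ + _).
rewrite -sumrN; apply: eq_bigr => s _; rewrite iins_lift.
case: k u I s su au => [|k] u I s su au; first by case: s.
have -> : [ffun t => icons i I (lift (lift ord0 s) t)] = icons i (idel s I).
  apply/ffunP => t; rewrite ffunE; case: (unliftP ord0 t) => [r ->|->].
    have -> : lift (lift ord0 s) (lift ord0 r) = lift ord0 (lift s r).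
      by apply: val_inj; rewrite /= /bump /= !add1n ltnS addnS.
    by rewrite !iins_lift ffunE.
  have -> : lift (lift ord0 s) ord0 = ord0 by apply: val_inj.
  by rewrite !iins_id.
rewrite /bump leq0n add1n exprS mulN1r mulNr; congr (- _).
rewrite -dpartialZ//; apply: (dpartial_eq oU) => // z Uz.
rewrite -(alt_iins (au z Uz)); congr (u _ _).
by rewrite -(isubst_iins s (I s) i) idelK.
Qed.

Lemma alt_covd k (u : tensor R N k) i x : smooth_tensor u -> alt_field u ->
  U x -> alt (fun I => covd M u (icons i I) x).
Proof.
move=> su au Ux s I; rewrite !covd_act mulrBr.
rewrite (dpartial_alt i su au Ux s I); congr (_ - _).
exact: (alt_glact _ (au x Ux)).
Qed.

(** The equation du = 0 with covariant instead of partial derivatives: the Christoffel terms on both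
    sides agree by [glact_symmetric]. This is the hypothesis of [sqnorm_closed]. *)
Lemma covd_closed k (u : tensor R N k) i I x : smooth_tensor u -> alt_field u ->
  (forall K, extd u K x = 0) -> U x ->
  covd M u (icons i I) x = \sum_s covd M u (icons (I s) (isubst I s i)) x.
Proof.
move=> su au d0 Ux; rewrite covd_act.
under eq_bigr do rewrite covd_act.
have := d0 (icons i I); rewrite extd_cons// => /eqP; rewrite subr_eq0 => /eqP ->.
rewrite sumrB; congr (_ - _).
rewrite (glact_symmetric (G := fun i => \matrix_(p, m) christoffel M m i p x))//.
  exact: au.
move=> j l m; rewrite !mxE !christoffelE// (eq_sym l j); ring.
Qed.

Lemma sqnorm_covd k (u : tensor R N k.+1) x : smooth_tensor u -> alt_field u ->
  (forall K, extd u K x = 0) -> U x ->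
  \sum_K covd M u K x ^+ 2 = k.+1%:R * \sum_i \sum_j \sum_J
    covd M u (icons i (icons j J)) x * covd M u (icons j (icons i J)) x.
Proof.
move=> su au d0 Ux; rewrite (sum_iins ord0).
apply: (@sqnorm_closed _ _ _ (fun i I => covd M u (icons i I) x)).
  by move=> i; exact: alt_covd.
by move=> i I; exact: covd_closed.
Qed.

(** As u is alternating, the k + 1 terms of the exterior derivative pair with it equally. *)
Lemma inner_extd k (f : tensor R N k) (u : tensor R N k.+1) x : alt (u^~ x) ->
  \sum_K extd f K x * u K x =
  k.+1%:R * \sum_i \sum_J dpartial i (f J) x * u (icons i J) x.
Proof.
move=> au; rewrite /extd; under eq_bigr do rewrite mulr_suml.
rewrite exchange_big mulr_natl -[k.+1 in RHS]card_ord -sumr_const /=.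
apply: eq_bigr => s _; rewrite (sum_iins s); do 2![apply: eq_bigr => ? _].
rewrite -/(idel s _) iinsK iins_id (alt_iins au).
by rewrite mulrACA -expr2 sqrr_sign mul1r.
Qed.

(** A_i is minus the sum over q of y_q (E_qi - E_iq), so [glact_curvature] applies to each q. *)
Lemma trace_Amx k (v : idx k.+1 -> R) J x : alt v ->
  \sum_i glact (Amx a i x) v (icons i J) =
  (N%:R - k.+1%:R) * \sum_q yy q x * v (icons q J).
Proof.
move=> av.
have AE i : Amx a i x = - \sum_q yy q x *: (delta_mx q i - delta_mx i q).
  apply/matrixP => p m; rewrite !mxE summxE -sumrN.
  under eq_bigr do rewrite !mxE -!mulnb !natrM.
  rewrite (eq_bigr (fun q => (m == q)%:R * ((i == p)%:R * yy q x)
      + - ((p == q)%:R * (yy q x * (i == m)%:R)))) => [|q _].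
    by rewrite big_split sumrN /= !sum_delta.
  rewrite (eq_sym m q) (eq_sym i p) (eq_sym m i); ring.
under eq_bigr do rewrite AE glactNl glact_suml.
rewrite sumrN exchange_big mulr_sumr -sumrN; apply: eq_bigr => q _ /=.
under eq_bigr do rewrite glactZl.
by rewrite -mulr_sumr glact_curvature//; ring.
Qed.

(** The frame divergence becomes a coordinate divergence whose weight is rho^(2(k+1)) for the raised
    indices times the density rho^-N. In this form it can be integrated by parts against coordinate
    derivatives. *)
Lemma trace_nabla k (u : tensor R N k.+1) J x : smooth_tensor u -> alt_field u ->
  U x -> \sum_i nabla i (hat a u) (icons i J) x =
  rho x ^+ N / rho x ^+ k * \sum_i
    dpartial i (fun y => rho y ^+ (2 * k.+1) * (rho y ^+ N)^-1 * u (icons i J) y) x.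
Proof.
move=> su au Ux; have r0 := rho_neq0 Ux.
have sr n : smooth_on U (fun y => rho y ^+ n).
  by apply: smoothX => //; exact: smooth_rho.
have rn n z : U z -> rho z ^+ n != 0 by move=> /rho_neq0 ?; rewrite expf_neq0.
have srV : smooth_on U (fun y => (rho y ^+ N)^-1).
  by apply: smoothV => // z; exact: rn.
have dr i n z : U z -> dpartial i (fun y => rho y ^+ n) z =
    - n%:R * rho z ^+ n / rho z * yy i z.
  move=> Uz; have r0z := rho_neq0 Uz.
  rewrite (@dpartialX _ _ U)//; last exact: smooth_rho.
  rewrite dpartial_rho; case: n => [|n]; first by rewrite !mulr0n; ring.
  by rewrite /= exprS; field.
rewrite /nabla big_split /= trace_Amx; last first.
  by move=> s I; have /= E := au x Ux s I; rewrite /hat E mulrCA.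
rewrite !mulr_sumr -big_split /=; apply: eq_bigr => i _.
rewrite /hat (dpartialM _ (sr _) (su _) Ux) dr//.
rewrite (dpartialM _ (smoothM oU (sr _) srV) (su _) Ux).
rewrite (dpartialM _ (sr _) srV Ux) (dpartialV _ (rn N) (sr N) Ux).
rewrite !dr// mul2n -addnn exprD exprS natrD -natr1.
have := rn k x Ux; have := rn N x Ux; set p := rho x ^+ N; set q := rho x ^+ k => p0 q0.
by field; rewrite r0 p0 q0.
Qed.

(** The components of df wedge u. *)
Definition ext1 k (f : 'rV[R]_N -> R) (u : tensor R N k) : tensor R N k.+1 :=
  fun K x => \sum_(s < k.+1) (-1) ^+ s * dpartial (K s) f x * u (idel s K) x.

Lemma extd_mul k f (u : tensor R N k) K x : smooth_on U f -> smooth_tensor u ->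
  U x -> extd (fun I y => f y * u I y) K x = f x * extd u K x + ext1 f u K x.
Proof.
move=> sf su Ux; rewrite /extd /ext1 mulr_sumr -big_split; apply: eq_bigr => s _ /=.
by rewrite (dpartialM _ sf (su _) Ux) -/(idel s K); ring.
Qed.

Lemma ext1_sqr k f (u : tensor R N k) K x : smooth_on U f -> U x ->
  ext1 (fun y => f y ^+ 2) u K x = 2 * f x * ext1 f u K x.
Proof.
move=> sf Ux; rewrite /ext1 mulr_sumr; apply: eq_bigr => s _.
by rewrite (@dpartialX _ _ U)//= expr1; ring.
Qed.

Lemma covd_mul k f (u : tensor R N k) i I x : smooth_on U f -> smooth_tensor u ->
  U x -> covd M (fun J y => f y * u J y) (icons i I) x =
  f x * covd M u (icons i I) x + dpartial i f x * u I x.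
Proof.
by move=> sf su Ux; rewrite !covd_act (dpartialM _ sf (su _) Ux) glactZr; ring.
Qed.

Lemma sqr_sum_le n (c : 'I_n -> R) :
  (\sum_s c s) ^+ 2 <= n%:R * \sum_s c s ^+ 2.
Proof.
have -> : n%:R * \sum_s c s ^+ 2 = \sum_s \sum_t (c s ^+ 2 + c t ^+ 2) / 2.
  under [RHS]eq_bigr do rewrite -mulr_suml big_split /= sumr_const card_ord.
  rewrite -mulr_suml big_split /= sumr_const card_ord sumrMnl mulr_natl.
  by set T := _ *+ n; lra.
rewrite expr2 mulr_suml; apply: ler_sum => s _; rewrite mulr_sumr.
apply: ler_sum => t _; have := sqr_ge0 (c s - c t); nra.
Qed.

(** One factor k + 1 is Cauchy-Schwarz over the slots, the other counts the slots, each of which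
    contributes the same product of sums. *)
Lemma ext1_bound k f (u : tensor R N k) x :
  \sum_K ext1 f u K x ^+ 2 <=
  k.+1%:R ^+ 2 * (\sum_i dpartial i f x ^+ 2) * \sum_J u J x ^+ 2.
Proof.
apply: (@le_trans _ _ (\sum_(K : idx k.+1) k.+1%:R *
    \sum_(s < k.+1) (dpartial (K s) f x * u (idel s K) x) ^+ 2)).
  apply: ler_sum => K _; apply: le_trans (sqr_sum_le _) _; rewrite ler_pM2l ?ltr0n//.
  apply: ler_sum => s _; rewrite -mulrA exprMn sqrr_sign mul1r//.
rewrite -mulr_sumr exchange_big /= expr2 -!mulrA ler_pM2l ?ltr0n//.
rewrite mulr_natl -[k.+1 in leRHS]card_ord -sumr_const; apply: ler_sum => s _.
rewrite (sum_iins s) mulr_suml; apply: ler_sum => i _.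
rewrite mulr_sumr; apply: ler_sum => J _; by rewrite iins_id iinsK exprMn.
Qed.

End forms.

(** * Cutoff functions with small gradient *)

Section cutoff.
Variables (R : realType) (N : nat) (a : R).
Local Notation U := (Defs.dom (hyperbolic N a)).
Local Notation rho := (rho a).
Local Notation yy := (yy a).
Let oU : open U := @open_dom R N a.

Lemma dpartial_ln (f : 'rV[R]_N -> R) i x : (forall x, U x -> 0 < f x) ->
  smooth_on U f -> U x ->
  dpartial i (fun y => ln (f y)) x = (f x)^-1 * dpartial i f x.
Proof.
move=> f0 sf Ux; apply: dpartial_val.
apply: (is_derive_comp (phi := @ln R)); first exact/is_derive1_ln/f0.
exact: smooth_is_derive sf Ux.
Qed.

Lemma dpartial_flat p (f : 'rV[R]_N -> R) i x : smooth_on U f -> U x ->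
  dpartial i (fun y => flat p (f y)) x = flat (flat_deriv p) (f x) * dpartial i f x.
Proof.
move=> sf Ux; apply: dpartial_val.
apply: (is_derive_comp (phi := flat p)); first exact: is_derive_flat.
exact: smooth_is_derive sf Ux.
Qed.

(* A proper function with [|dh|_g] bounded: [- ln rho] is comparable to the
   geodesic distance when a > 0, and [ln (1 + |x|^2)] takes over when a = 0. *)
Definition exhaustion (x : 'rV[R]_N) : R := ln ((1 + sqeucl x) * (rho x)^-1).
Local Notation h := exhaustion.

Let s1 : smooth_on U (fun x => 1 + sqeucl x).
Proof. by apply: smoothD => //; [exact: smooth_cst|exact: smooth_sqeucl]. Qed.

Let sr : smooth_on U rho. Proof. exact: smooth_rho. Qed.

Let sV : smooth_on U (fun x => (rho x)^-1).
Proof. by apply: smoothV => // x; exact: rho_neq0. Qed.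

Let sH : smooth_on U (fun x => (1 + sqeucl x) * (rho x)^-1).
Proof. exact: smoothM. Qed.

Let sq1 (x : 'rV[R]_N) : 0 < 1 + sqeucl x.
Proof. by rewrite ltr_pwDl// sqeucl_ge0. Qed.

Let H0 x : U x -> 0 < (1 + sqeucl x) * (rho x)^-1.
Proof. by move=> /domE r0; rewrite mulr_gt0 ?invr_gt0. Qed.

Lemma smooth_exhaustion : smooth_on U h.
Proof. exact: smooth_ln. Qed.

Lemma exhaustion_ge0 x : U x -> 0 <= h x.
Proof.
move=> /domE r0; apply: ln_ge0; rewrite ler_pdivlMr// mul1r.
by apply: le_trans (rho_le1 a x) _; rewrite lerDl sqeucl_ge0.
Qed.

Lemma dpartial_exhaustion i x : U x ->
  rho x * dpartial i h x = 2 * rho x * x ord0 i / (1 + sqeucl x) + yy i x.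
Proof.
move=> Ux; have r0 := rho_neq0 Ux; have s0 := lt0r_neq0 (sq1 x).
rewrite /exhaustion (dpartial_ln _ H0 sH Ux) (dpartialM _ s1 sV Ux).
rewrite (dpartialV _ (fun x => @rho_neq0 _ _ _ x) sr Ux) dpartial_rho.
rewrite (dpartialD _ (smooth_cst oU 1) (smooth_sqeucl oU) Ux).
rewrite dpartial_cst dpartial_sqeucl; field.
by rewrite r0 s0.
Qed.

(** The outer 2 comes from (q + p)^2 <= 2 q^2 + 2 p^2. The part from ln (1 + |x|^2) contributes at
    most 1, by rho <= 1 and 4 s <= (1 + s)^2 with s = |x|^2; the part from - ln rho contributes at
    most a^2, by [sum_yy2]. *)
Lemma grad_exhaustion x : U x ->
  rho x ^+ 2 * \sum_i dpartial i h x ^+ 2 <= 2 * (1 + a ^+ 2).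
Proof.
move=> Ux; have /domE r0 := Ux; have r1 := rho_le1 a x; have s0 := sq1 x.
rewrite mulr_sumr.
apply: (@le_trans _ _ (\sum_i (2 * (4 * rho x ^+ 2 / (1 + sqeucl x) ^+ 2 * x ord0 i ^+ 2)
    + 2 * yy i x ^+ 2))).
  apply: ler_sum => i _; rewrite -exprMn dpartial_exhaustion//.
  set p := yy i x; have -> : 4 * rho x ^+ 2 / (1 + sqeucl x) ^+ 2 * x ord0 i ^+ 2 =
     (2 * rho x * x ord0 i / (1 + sqeucl x)) ^+ 2 by field; rewrite lt0r_neq0.
  set q := 2 * rho x * x ord0 i / _; have := sqr_ge0 (q - p); nra.
rewrite big_split /= -!mulr_sumr -/(sqeucl x) -mulrDr ler_pM2l//.
have := sum_yy2 a x => yE; apply: lerD.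
  rewrite mulrAC ler_pdivrMr ?exprn_gt0// mul1r.
  have := sqeucl_ge0 x; set s := sqeucl x => s_ge0.
  apply: (@le_trans _ _ (4 * s)); last by have := sqr_ge0 (1 - s); nra.
  by rewrite -mulrA ler_pM2l// ler_piMl// expr_le1// ltW.
rewrite -yE lerDr mulr_ge0 ?sqr_ge0// ltW//.
Qed.

(** The factor e normalises the value to 1 where h = 0; the function vanishes as soon as h >= n +
    1. *)
Definition chi (n : nat) (x : 'rV[R]_N) : R := expR 1 * flat 1 (1 - n.+1%:R^-1 * h x).

Lemma flat1E (t : R) : 0 < t -> flat 1 t = expR (- t^-1).
Proof. by move=> t0; rewrite /flat leNgt t0 /= hornerC mul1r. Qed.

Lemma flat1_ge0 (t : R) : 0 <= flat 1 t.
Proof. by rewrite /flat; case: ifP => // _; rewrite hornerC mul1r expR_ge0. Qed.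

Lemma flat1_le (s t : R) : s <= t -> flat 1 s <= flat 1 t.
Proof.
move=> st; have [s0|s0] := leP s 0; first by rewrite {1}/flat s0 flat1_ge0.
rewrite !flat1E//; last exact: lt_le_trans st.
by rewrite ler_expR lerN2 lef_pV2 ?posrE//; exact: lt_le_trans st.
Qed.

Lemma flat_deriv1_bound (t : R) : `|flat (flat_deriv 1) t| <= 2.
Proof.
rewrite /flat; case: (leP t 0) => t0; first by rewrite normr0.
rewrite /flat_deriv derivC subr0 mulr1 hornerXn.
rewrite ger0_norm; last by rewrite mulr_ge0 ?exprn_ge0 ?invr_ge0 ?expR_ge0 ?ltW.
by apply: (@expX_expR_bound _ 2 t^-1); rewrite invr_ge0 ltW.
Qed.

Let sharg n : smooth_on U (fun x => 1 - n.+1%:R^-1 * h x).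
Proof.
apply: smoothB => //; first exact: smooth_cst.
by apply: smoothM => //; [exact: smooth_cst|exact: smooth_exhaustion].
Qed.

Lemma smooth_chi n : smooth_on U (chi n).
Proof.
by apply: smoothM => //; [exact: smooth_cst|exact: smooth_flat].
Qed.

Lemma chi_ge0 n x : 0 <= chi n x.
Proof. by rewrite mulr_ge0 ?expR_ge0 ?flat1_ge0. Qed.

Lemma chi_le1 n x : U x -> chi n x <= 1.
Proof.
move=> Ux; apply: (@le_trans _ _ (expR 1 * flat 1 1)).
  rewrite ler_pM2l ?expR_gt0//; apply: flat1_le.
  by rewrite lerBlDr lerDl mulr_ge0 ?exhaustion_ge0.
by rewrite flat1E// invr1 -expRD subrr expR0.
Qed.

Lemma chi_nondecreasing n m x : U x -> (n <= m)%N -> chi n x <= chi m x.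
Proof.
move=> Ux nm; rewrite ler_pM2l ?expR_gt0//; apply: flat1_le.
rewrite lerB// ler_wpM2r ?exhaustion_ge0//.
by rewrite lef_pV2 ?posrE ?ltr0n// ler_nat.
Qed.

Lemma cvg_chi x : chi n x @[n --> \oo] --> (1 : R).
Proof.
have -> : 1 = expR 1 * flat 1 1 :> R.
  by rewrite flat1E// invr1 -expRD subrr expR0.
have A : 1 - n.+1%:R^-1 * h x @[n --> \oo] --> (1 : R).
  rewrite -[X in _ --> X]subr0; apply: cvgB; first exact: cvg_cst.
  rewrite -[X in _ --> X](mul0r (h x)); apply: cvgM; last exact: cvg_cst.
  exact: cvg_harmonic.
apply: cvgM; first exact: cvg_cst.
exact: (cvg_comp _ _ A (@continuous_flat R 1 1)).
Qed.

(** On U this is the sublevel set h <= n + 1. Without the logarithm it is a condition on all of R^N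
    that forces rho > 0 and |x|^2 <= e^(n+1): the set is bounded, closed in R^N and inside U, which
    is how completeness enters. *)
Definition chi_supp (n : nat) : set 'rV[R]_N :=
  [set x | 1 + sqeucl x <= expR n.+1%:R * rho x].

Lemma chi_supp_dom n : chi_supp n `<=` U.
Proof.
move=> x /= H; apply/domE; rewrite -(pmulr_rgt0 _ (expR_gt0 n.+1%:R)).
exact: lt_le_trans (sq1 x) H.
Qed.

Lemma chi_supp_compact n : compact (chi_supp n).
Proof.
have oT : open [set: 'rV[R]_N] by exact: openT.
apply: bounded_closed_compact.
  exists (1 + expR n.+1%:R); split; first exact: num_real.
  move=> B /= EB x Kx; apply: le_trans (ltW EB).
  rewrite [leLHS]/Num.norm /= mx_normrE; apply/bigmax_leP.
  have e0 := expR_gt0 (n.+1%:R : R).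
  split; first by rewrite addr_ge0// ltW.
  move=> [i j] _ /=; rewrite (ord1 i).
  have xs : x ord0 j ^+ 2 <= expR n.+1%:R.
    apply: (@le_trans _ _ (sqeucl x)).
      by rewrite /sqeucl (bigD1 j) //= lerDl sumr_ge0// => l _; rewrite sqr_ge0.
    have r1 := rho_le1 a x; move: Kx; rewrite /chi_supp /= => Kx.
    have : expR n.+1%:R * rho x <= expR n.+1%:R by rewrite ler_piMr// ltW.
    lra.
  have := normr_ge0 (x ord0 j); rewrite -(real_normK (num_real (x ord0 j))) in xs.
  nra.
have -> : chi_supp n = (fun x => expR n.+1%:R * rho x - (1 + sqeucl x)) @^-1` `[0, +oo[.
  by apply/seteqP; split=> x; rewrite /= in_itv /= andbT subr_ge0.
apply: preimage_closed; last exact: interval_closed.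
move=> x _; apply: (@smooth_continuous _ _ setT) => //; apply: smoothB => //.
  by apply: smoothM => //; [exact: smooth_cst|exact: smooth_rho].
by apply: smoothD => //; [exact: smooth_cst|exact: smooth_sqeucl].
Qed.

Lemma chi_eq0 n x : U x -> ~ chi_supp n x -> chi n x = 0.
Proof.
move=> Ux /negP; rewrite -ltNge => H; have /domE r0 := Ux.
rewrite /chi /flat ifT ?mulr0//.
rewrite subr_le0 -ler_pdivrMl ?invr_gt0// invrK mulr1.
rewrite -[leLHS]expRK ler_ln ?posrE ?expR_gt0//; last exact: H0.
by rewrite ler_pdivlMr// ltW.
Qed.

(** The product of e^2 (from [chi]), 4 (the square of the bound in [flat_deriv1_bound]) and 2 (1 +
    a^2) (from [grad_exhaustion]). It bounds (n+1)^2 |d chi_n|^2; being at least 1, it is also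
    bounded by its own square, which avoids a square root in [grad_chi]. *)
Definition grad_const : R := 8 * expR 1 ^+ 2 * (1 + a ^+ 2).

Lemma grad_const_ge1 : 1 <= grad_const.
Proof.
rewrite /grad_const; have := sqr_ge0 a; have : 1 <= expR (1 : R).
  by rewrite -expR0 ler_expR.
nra.
Qed.

Lemma grad_chi n x : U x ->
  rho x ^+ 2 * \sum_i dpartial i (chi n) x ^+ 2 <= (grad_const / n.+1%:R) ^+ 2.
Proof.
move=> Ux; set t := 1 - n.+1%:R^-1 * h x.
have dE i : dpartial i (chi n) x =
    - (expR 1 * flat (flat_deriv 1) t * n.+1%:R^-1) * dpartial i h x.
  rewrite (dpartialZ _ _ (smooth_flat oU 1 (sharg n)) Ux) (dpartial_flat _ _ (sharg n) Ux).
  rewrite (dpartialB _ (smooth_cst oU 1) (smoothM oU (smooth_cst oU _) smooth_exhaustion) Ux).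
  rewrite dpartial_cst (dpartialZ _ _ smooth_exhaustion Ux) -/t; ring.
under eq_bigr do rewrite dE exprMn.
rewrite -mulr_sumr mulrCA sqrrN.
have g := grad_exhaustion Ux.
have f2 : flat (flat_deriv 1) t ^+ 2 <= 4.
  have := flat_deriv1_bound t; have := normr_ge0 (flat (flat_deriv 1) t).
  rewrite -(real_normK (num_real (flat (flat_deriv 1) t))); nra.
have := grad_const_ge1; set G := grad_const => G1.
have GE : G = 8 * expR 1 ^+ 2 * (1 + a ^+ 2) by [].
clearbody G; rewrite !exprMn exprVn.
apply: (@le_trans _ _ ((expR 1 ^+ 2 * 4 * n.+1%:R ^- 2) * (2 * (1 + a ^+ 2)))).
  have e0 : 0 < expR 1 ^+ 2 :> R by rewrite exprn_gt0// expR_gt0.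
  have w0 : 0 < n.+1%:R ^- 2 :> R by rewrite invr_gt0 exprn_gt0.
  apply: ler_pM => //.
  - by rewrite mulr_ge0 ?(ltW w0)// mulr_ge0 ?sqr_ge0// ltW.
  - by rewrite mulr_ge0 ?sqr_ge0// sumr_ge0// => i _; rewrite sqr_ge0.
  - by rewrite ler_pM2r// ler_pM2l.
rewrite (_ : _ * _ = G * n.+1%:R ^- 2); last by rewrite GE; ring.
rewrite ler_pM2r ?invr_gt0 ?exprn_gt0//.
by nra.
Qed.

End cutoff.

(** * Integration against the Riemannian volume *)

Section volume.
Variables (R : realType) (N : nat) (a : R).
Local Notation M := (hyperbolic N a).
Local Notation U := (Defs.dom (hyperbolic N a)).
Local Notation rho := (rho a).
Local Notation vec := (@rV_of_tuple R N).
Local Notation mu := (@lebesgue_tuple R N).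
Local Notation D := (@rV_of_tuple R N @^-1` Defs.dom (hyperbolic N a)).
Let oU : open U := @open_dom R N a.
Let mD : measurable D := measurable_vec_open oU.
Implicit Types f g : 'rV[R]_N -> R.

Definition vint f := mu.-integrable D (EFin \o ((fun x => f x * rho x ^- N) \o vec)).

Let sw : smooth_on U (fun x => rho x ^- N).
Proof.
apply: smoothV => //; last by apply: smoothX => //; exact: smooth_rho.
by move=> x /rho_neq0 ?; rewrite expf_neq0.
Qed.

Let w0 x : U x -> 0 < rho x ^- N.
Proof. by move=> /domE r0; rewrite invr_gt0 exprn_gt0. Qed.

Lemma volint_eq f g : (forall x, U x -> f x = g x) -> volint M f = volint M g.
Proof.
move=> fg; rewrite !volintE; apply: eq_integral => t; rewrite inE /= => Ut.
by rewrite fg.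
Qed.

Lemma measurable_dens f : smooth_on U f ->
  measurable_fun D (EFin \o ((fun x => f x * rho x ^- N) \o vec)).
Proof.
move=> sf; apply/measurable_EFinP; apply: (measurable_fun_vec oU).
by move=> x Ux; apply: (smooth_continuous _ Ux); exact: smoothM.
Qed.

Lemma vint_compact f (K : set 'rV[R]_N) : smooth_on U f -> compact K -> K `<=` U ->
  (forall x, U x -> ~ K x -> f x = 0) -> vint f.
Proof.
move=> sf cK KU f0; apply: (integrable_compact oU cK KU).
  by move=> x Ux; apply: (smooth_continuous _ Ux); exact: smoothM.
by move=> x Ux nK; rewrite f0// mul0r.
Qed.

Lemma volint_ge0 f : (forall x, U x -> 0 <= f x) -> (0 <= volint M f)%E.
Proof.
move=> f0; rewrite volintE; apply: integral_ge0 => t Ut.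
by rewrite lee_fin mulr_ge0 ?f0// ltW// w0.
Qed.

Lemma vint_lty f : smooth_on U f -> (forall x, U x -> 0 <= f x) ->
  (volint M f < +oo)%E -> vint f.
Proof.
move=> sf f0; rewrite volintE => fy; apply/integrableP; split.
  exact: measurable_dens.
apply: le_lt_trans fy; rewrite le_eqVlt; apply/orP; left; apply/eqP.
apply: eq_integral => t; rewrite inE /= => Ut.
by rewrite ger0_norm// mulr_ge0 ?f0// ltW// w0.
Qed.

Lemma volintD f g : vint f -> vint g ->
  volint M (fun x => f x + g x) = (volint M f + volint M g)%E.
Proof.
move=> vf vg; rewrite !volintE -integralD//; apply: eq_integral => t _.
by rewrite /= mulrDl EFinD.
Qed.

Lemma volintZ c f : vint f -> volint M (fun x => c * f x) = (c%:E * volint M f)%E.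
Proof.
move=> vf; rewrite !volintE -integralZl//; apply: eq_integral => t _.
by rewrite /= -mulrA EFinM.
Qed.

Lemma volint_fin f : vint f -> volint M f \is a fin_num.
Proof. by move=> vf; rewrite volintE; exact: integrable_fin_num. Qed.

Lemma vintD f g : vint f -> vint g -> vint (fun x => f x + g x).
Proof.
move=> vf vg; have := integrableD mD vf vg; apply: eq_integrable => // t _.
by rewrite /= mulrDl EFinD.
Qed.

Lemma vintZ c f : vint f -> vint (fun x => c * f x).
Proof.
move=> vf; have := integrableZl mD c vf; apply: eq_integrable => // t _.
by rewrite /= -mulrA EFinM.
Qed.

Lemma volintB f g : vint f -> vint g ->
  volint M (fun x => f x - g x) = (volint M f - volint M g)%E.
Proof.
move=> vf vg; rewrite (@volint_eq _ (fun x => f x + (-1) * g x)) => [|x _].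
  by rewrite volintD ?volintZ//; [rewrite mulN1e|exact: vintZ].
by rewrite mulN1r.
Qed.

Lemma le_volint f g : vint f -> vint g -> (forall x, U x -> f x <= g x) ->
  (volint M f <= volint M g)%E.
Proof.
move=> vf vg fg; rewrite !volintE; apply: le_integral => // t; rewrite inE /= => Ut.
by rewrite lee_fin ler_pM2r ?fg// w0.
Qed.

Lemma volint_eq0 f : smooth_on U f -> (forall x, U x -> 0 <= f x) ->
  (volint M f <= 0)%E -> forall x, U x -> f x = 0.
Proof.
move=> sf f0; rewrite volintE => If x Ux.
have E := @integral_eq0_continuous _ _ U (fun x => f x * rho x ^- N) oU _ _ If x Ux.
have /eqP : f x * rho x ^- N = 0.
  apply: E => z Uz; last by rewrite mulr_ge0 ?f0// ltW// w0.
  by apply: (smooth_continuous _ Uz); exact: smoothM.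
by rewrite mulf_eq0 (gt_eqF (w0 Ux)) orbF => /eqP.
Qed.

(** The factor rho^N cancels the volume density, leaving a Euclidean divergence; F is thus the
    vector field already multiplied by the density. *)
Lemma volint_divergence (F : 'I_N -> 'rV[R]_N -> R) n :
  (forall i, smooth_on U (F i)) ->
  (forall i x, U x -> ~ chi_supp a n x -> F i x = 0) ->
  volint M (fun x => rho x ^+ N * \sum_i dpartial i (F i) x) = 0%E.
Proof.
move=> sF F0; rewrite volintE.
rewrite -[RHS](integral_divergence0 oU (@chi_supp_compact R N a n) (@chi_supp_dom R N a n) sF F0).
apply: eq_integral => t; rewrite inE /= => /rho_neq0 r0.
by rewrite mulrAC mulfV ?expf_neq0// mul1r.
Qed.

Let cvg_chi2 (x : 'rV[R]_N) (c d : R) : chi a n x ^+ 2 * c * d @[n --> \oo] --> c * d.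
Proof.
have : chi a n x * chi a n x * c * d @[n --> \oo] --> 1 * 1 * c * d.
  apply: cvgM; last exact: cvg_cst.
  apply: cvgM; last exact: cvg_cst.
  by apply: cvgM; exact: cvg_chi.
by rewrite !mul1r.
Qed.

Let cvg_1chi2 (x : 'rV[R]_N) (c d : R) : (1 - chi a n x) ^+ 2 * c * d @[n --> \oo] --> (0 : R).
Proof.
have : (1 - chi a n x) * (1 - chi a n x) * c * d @[n --> \oo] --> (1 - 1) * (1 - 1) * c * d.
  apply: cvgM; last exact: cvg_cst.
  apply: cvgM; last exact: cvg_cst.
  by apply: cvgM; (apply: cvgB; [exact: cvg_cst|exact: cvg_chi]).
by rewrite subrr !mul0r.
Qed.

(** Monotone convergence, so the limit may be infinite: this is what allows a bound on |nabla u|^2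
    before its integrability is known. *)
Lemma cvg_volint_chi f : smooth_on U f -> (forall x, U x -> 0 <= f x) ->
  volint M (fun x => chi a n x ^+ 2 * f x) @[n --> \oo] --> volint M f.
Proof.
move=> sf f0.
pose g n (t : N.-tuple (measurableTypeR R)) : \bar R :=
  (chi a n (vec t) ^+ 2 * f (vec t) * rho (vec t) ^- N)%:E.
have mg n : measurable_fun D (g n).
  apply: (@measurable_dens (fun x => chi a n x ^+ 2 * f x)).
  by apply: smoothM => //; apply: smoothX => //; exact: smooth_chi.
have g0 n t : D t -> (0 <= g n t)%E.
  by move=> Ut; rewrite lee_fin (mulr_ge0 (mulr_ge0 (sqr_ge0 _) (f0 _ Ut)) (ltW (w0 Ut))).
have ndg t : D t -> {homo g ^~ t : n m / (n <= m)%N >-> (n <= m)%E}.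
  move=> Ut n m nm; rewrite lee_fin ler_pM2r ?w0// ler_wpM2r ?f0//.
  by rewrite lerXn2r ?nnegrE ?chi_ge0// chi_nondecreasing.
have -> : volint M f = (\int[mu]_(t in D) limn (g ^~ t))%E.
  rewrite volintE; apply: eq_integral => t; rewrite inE /= => Ut.
  apply/esym/cvg_lim => //; apply: cvg_EFin; first by near=> n.
  exact: cvg_chi2.
have E n : volint M (fun x => chi a n x ^+ 2 * f x) = (\int[mu]_(x in D) g n x)%E.
  by rewrite volintE.
rewrite (_ : (fun n => volint _ _) = (fun n => \int[mu]_(x in D) g n x)%E).
  exact: cvg_monotone_convergence.
exact/funext.
Unshelve. all: by end_near. Qed.

(** Here f itself dominates, since 0 <= chi <= 1. *)
Lemma cvg_volint_1chi f : smooth_on U f -> (forall x, U x -> 0 <= f x) ->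
  (volint M f < +oo)%E ->
  volint M (fun x => (1 - chi a n x) ^+ 2 * f x) @[n --> \oo] --> 0%E.
Proof.
move=> sf f0 fy.
pose g n (t : N.-tuple (measurableTypeR R)) : \bar R :=
  ((1 - chi a n (vec t)) ^+ 2 * f (vec t) * rho (vec t) ^- N)%:E.
have mg n : measurable_fun D (g n).
  apply: (@measurable_dens (fun x => (1 - chi a n x) ^+ 2 * f x)).
  apply: smoothM => //; apply: smoothX => //; apply: smoothB => //.
    exact: smooth_cst.
  exact: smooth_chi.
have [] := @dominated_convergence _ _ _ mu D mD g (cst 0%E)
    (EFin \o ((fun x => f x * rho x ^- N) \o vec)) mg _ _ (vint_lty sf f0 fy).
- exact: measurable_cst.
- apply: aeW => t Ut; apply: cvg_EFin; first by near=> n.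
  exact: cvg_1chi2.
- apply: aeW => t n Ut; rewrite lee_fin ger0_norm; last first.
    by rewrite (mulr_ge0 (mulr_ge0 (sqr_ge0 _) (f0 _ Ut)) (ltW (w0 Ut))).
  rewrite /= ler_pM2r ?w0// ler_piMl ?f0//.
  by have := chi_ge0 a n (vec t); have := chi_le1 n Ut; nra.
move=> _ _; rewrite integral0 => cv.
have E n : volint M (fun x => (1 - chi a n x) ^+ 2 * f x) = (\int[mu]_(x in D) g n x)%E.
  by rewrite volintE.
by rewrite (_ : (fun n => volint _ _) = (fun n => \int[mu]_(x in D) g n x)%E)//; apply/funext.
Unshelve. all: by end_near. Qed.

(* Absorption of the cutoff errors, which are O(1/n). *)
Lemma absorb (P Q : 'rV[R]_N -> R) (G : nat -> 'rV[R]_N -> R) (c C : R) :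
  0 <= c -> 0 <= C -> smooth_on U P -> smooth_on U Q ->
  (forall x, U x -> 0 <= P x) -> (forall x, U x -> 0 <= Q x) ->
  (volint M Q < +oo)%E ->
  (forall n, smooth_on U (G n)) ->
  (forall n x, U x -> ~ chi_supp a n x -> G n x = 0) ->
  (forall n, volint M (G n) = 0%E) ->
  (forall n x, U x -> (1 - C / n.+1%:R) * (chi a n x ^+ 2 * P x) <=
     G n x + (c + C / n.+1%:R) * Q x) ->
  (volint M P <= c%:E * volint M Q)%E.
Proof.
move=> c0 C0 sP sQ P0 Q0 Qy sG G0 IG ineq.
have vQ := vint_lty sQ Q0 Qy.
have vG n : vint (G n).
  by apply: (vint_compact (sG n) (@chi_supp_compact R N a n) (@chi_supp_dom R N a n)); exact: G0.
have vP n : vint (fun x => chi a n x ^+ 2 * P x).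
  apply: (vint_compact _ (@chi_supp_compact R N a n) (@chi_supp_dom R N a n)).
    by apply: smoothM => //; apply: smoothX => //; exact: smooth_chi.
  by move=> x Ux nK; rewrite chi_eq0// expr0n mul0r.
have [I IE] : exists I, volint M Q = I%:E.
  by exists (fine (volint M Q)); rewrite fineK ?volint_fin.
have I0 : 0 <= I by rewrite -lee_fin -IE volint_ge0.
pose b n := fine (volint M (fun x => chi a n x ^+ 2 * P x)).
have bE n : volint M (fun x => chi a n x ^+ 2 * P x) = (b n)%:E.
  by rewrite fineK ?volint_fin.
have b0 n : 0 <= b n.
  by rewrite -lee_fin -bE volint_ge0// => x Ux; rewrite mulr_ge0 ?sqr_ge0 ?P0.
have step n : (1 - C / n.+1%:R) * b n <= (c + C / n.+1%:R) * I.
  have := le_volint (vintZ (1 - C / n.+1%:R) (vP n))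
    (vintD (vG n) (vintZ (c + C / n.+1%:R) vQ)) (ineq n).
  rewrite volintZ// (volintD (vG n) (vintZ _ vQ)) volintZ// IG add0e bE IE.
  by rewrite -!EFinM lee_fin.
rewrite IE -EFinM; apply/lee_addgt0Pr => e e0; rewrite -EFinD.
(* With t = C/(n+1), the choice t < e / (I + (c I + e) + 1) gives t (I + c I + e) <= e, hence (c +
   t) I <= (1 - t)(c I + e). The denominator also exceeds e, so t < 1 and one may divide by 1 -
   t. *)
have K0 : 0 < I + (c * I + e) + 1 by have := mulr_ge0 c0 I0; lra.
have d0 : 0 < e / (I + (c * I + e) + 1) by rewrite divr_gt0.
have cv := cvg_volint_chi sP P0.
rewrite -(cvg_lim _ cv)//; apply: lime_le; first by apply/cvg_ex; exists (volint M P).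
have ev : \forall n \near \oo, C / n.+1%:R < e / (I + (c * I + e) + 1).
  have : C * n.+1%:R^-1 @[n --> \oo] --> (C * 0 : R).
    by apply: cvgM; [exact: cvg_cst|exact: cvg_harmonic].
  by rewrite mulr0; move/cvgr_lt; apply.
near=> n; rewrite bE lee_fin.
have tlt : C / n.+1%:R < e / (I + (c * I + e) + 1) by near: n.
have t0 : 0 <= C / n.+1%:R by rewrite divr_ge0.
move: (step n) tlt t0; set t := C / n.+1%:R => st.
rewrite ltr_pdivlMr// => tlt t0.
have t1 : t < 1.
  have cI := mulr_ge0 c0 I0; rewrite ltNge; apply/negP => t1.
  have : 1 * (I + (c * I + e) + 1) <= t * (I + (c * I + e) + 1) by rewrite ler_pM2r.
  lra.
have : (1 - t) * b n <= (1 - t) * (c * I + e) by nra.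
by rewrite ler_pM2l//; lra.
Unshelve. all: by end_near. Qed.

End volume.

(** * Testing the weak codifferential with cut-off forms *)

Section harmonic.
Variables (R : realType) (N : nat) (a : R).
Local Notation M := (hyperbolic N a).
Local Notation U := (Defs.dom (hyperbolic N a)).
Local Notation rho := (rho a).
Local Notation smooth_tensor := (smooth_tensor a).
Local Notation alt_field := (alt_field a).
Local Notation chi := (chi a).
Local Notation chi_supp := (@chi_supp R N a).
Let oU : open U := @open_dom R N a.

Lemma smooth_rhoX n : smooth_on U (fun x => rho x ^+ n).
Proof. by apply: smoothX => //; exact: smooth_rho. Qed.

Lemma smooth_rhoXV n : smooth_on U (fun x => (rho x ^+ n)^-1).
Proof.
apply: smoothV => //; last exact: smooth_rhoX.
by move=> x /rho_neq0 ?; rewrite expf_neq0.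
Qed.

Lemma smooth_inner k (u v : tensor R N k) : smooth_tensor u -> smooth_tensor v ->
  smooth_on U (fun x => \sum_I u I x * v I x).
Proof. by move=> su sv; apply: smooth_sum => // I _; exact: smoothM. Qed.

Lemma smooth_tinner k (u v : tensor R N k) : smooth_tensor u -> smooth_tensor v ->
  smooth_on U (tinner M u v).
Proof.
move=> su sv; rewrite (_ : tinner M u v =
  (fun x => rho x ^+ (2 * k) * \sum_I u I x * v I x)).
  by apply: smoothM => //; [exact: smooth_rhoX|exact: smooth_inner].
by apply/funext => x; rewrite tinnerE.
Qed.

Lemma smooth_extd k (u : tensor R N k) : smooth_tensor u -> smooth_tensor (extd u).
Proof.
move=> su I; apply: smooth_sum => // s _; apply: smoothM => //.
  exact: smooth_cst.
exact: smooth_dpartial.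
Qed.

Lemma smooth_covd k (u : tensor R N k) : smooth_tensor u -> smooth_tensor (covd M u).
Proof.
move=> su K.
apply: (@smooth_eq _ _ _ oU (fun x => (rho x ^+ k.+1)^-1 *
    nabla a (K ord0) (hat a u) (idel ord0 K) x)).
  move=> x Ux; rewrite nabla_hat// mulrA mulVf ?expf_neq0 ?rho_neq0// mul1r.
  by rewrite /icons idelK.
apply: smoothM => //; first exact: smooth_rhoXV.
by apply: smooth_nabla; exact: smooth_hat.
Qed.

Lemma tinner_ge0 k (u : tensor R N k) x : U x -> 0 <= tinner M u u x.
Proof.
move=> /domE r0; rewrite tinnerE mulr_ge0 ?exprn_ge0 ?(ltW r0)// sumr_ge0// => I _.
by rewrite -expr2 sqr_ge0.
Qed.

Lemma tinner_eq0 k (u : tensor R N k) x I : U x -> tinner M u u x = 0 -> u I x = 0.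
Proof.
move=> /rho_neq0 r0; rewrite tinnerE => /eqP; rewrite mulf_eq0 expf_eq0 (negbTE r0) andbF /=.
rewrite psumr_eq0 => [/allP/(_ I)|J _]; last by rewrite -expr2 sqr_ge0.
by rewrite mem_index_enum -expr2 sqrf_eq0 => /(_ isT)/eqP.
Qed.

Lemma open_off_supp n : open (U `&` ~` chi_supp n).
Proof.
apply: openI => //; apply: closed_openC.
exact: (compact_closed (@norm_hausdorff _ _) (@chi_supp_compact R N a n)).
Qed.

Lemma smooth_chi2 n : smooth_on U (fun x => chi n x ^+ 2).
Proof. by apply: smoothX => //; exact: smooth_chi. Qed.

Lemma test_form_cutoff k (w : tensor R N k) (f : 'rV[R]_N -> R) n :
  smooth_tensor w -> alt_field w -> smooth_on U f ->
  (forall x, U x -> ~ chi_supp n x -> f x = 0) ->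
  test_form M (fun I x => f x * w I x).
Proof.
move=> sw aw sf f0; split.
  apply/diff_formP; split; first by move=> I; exact: smoothM.
  by move=> x Ux s I; have /= -> := aw x Ux s I; rewrite mulrCA.
exists (chi_supp n); split; [exact: chi_supp_compact|exact: chi_supp_dom|].
by move=> I x Ux nK; rewrite f0// mul0r.
Qed.

(** The weak identity tested on chi_n^2 w, recorded as a single compactly supported function of
    integral zero, which is the shape in which [absorb] expects its G. The factorials are the
    normalisation in [formip]. *)
Lemma codiff_cutoff k (u : tensor R N k.+1) (v w : tensor R N k) n :
  is_codiff M u v -> smooth_tensor u -> smooth_tensor w -> alt_field w ->
  exists g, [/\ smooth_on U g, forall x, U x -> ~ chi_supp n x -> g x = 0,
    volint M g = 0%E & forall x, U x -> g x =
      (k.+1)`!%:R^-1 * (rho x ^+ (2 * k.+1) *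
         \sum_K extd (fun I y => chi n y ^+ 2 * w I y) K x * u K x)
      - k`!%:R^-1 * (chi n x ^+ 2 * (rho x ^+ (2 * k) * \sum_I w I x * v I x))].
Proof.
move=> [/diff_formP[sv av] H] su sw aw.
pose f I y := chi n y ^+ 2 * w I y.
have sf : smooth_tensor f by move=> I; apply: smoothM => //; exact: smooth_chi2.
have tf : test_form M f.
  apply: (@test_form_cutoff _ w _ n) => //; first exact: smooth_chi2.
  by move=> x Ux nK; rewrite (chi_eq0 Ux nK) expr0n.
have f0 I x : U x -> ~ chi_supp n x -> f I x = 0.
  by move=> Ux nK; rewrite /f chi_eq0// expr0n mul0r.
have df0 K x : U x -> ~ chi_supp n x -> extd f K x = 0.
  move=> Ux nK; apply: big1 => s _.
  rewrite (dpartial_eq (@open_off_supp n) (K s) (g := fun=> 0)) ?dpartial_cst ?mulr0//.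
  by move=> z [Uz nz]; exact: f0.
pose g1 x := (k.+1)`!%:R^-1 * tinner M (extd f) u x.
pose g2 x := k`!%:R^-1 * tinner M f v x.
have sg1 : smooth_on U g1.
  apply: smoothM => //; first exact: smooth_cst.
  by apply: smooth_tinner => //; exact: smooth_extd.
have sg2 : smooth_on U g2.
  by apply: smoothM => //; [exact: smooth_cst|exact: smooth_tinner].
have g10 x : U x -> ~ chi_supp n x -> g1 x = 0.
  by move=> Ux nK; rewrite /g1 tinnerE big1 ?mulr0// => K _; rewrite df0 ?mul0r.
have g20 x : U x -> ~ chi_supp n x -> g2 x = 0.
  by move=> Ux nK; rewrite /g2 tinnerE big1 ?mulr0// => K _; rewrite f0 ?mul0r.
have v1 := vint_compact sg1 (@chi_supp_compact R N a n) (@chi_supp_dom R N a n) g10.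
have v2 := vint_compact sg2 (@chi_supp_compact R N a n) (@chi_supp_dom R N a n) g20.
exists (fun x => g1 x - g2 x); split.
- exact: smoothB.
- by move=> x Ux nK; rewrite g10// g20// subrr.
- have := H f tf; rewrite /formip -/g1 -/g2 => E.
  by rewrite volintB// E subee// volint_fin.
- move=> x Ux; rewrite /g1 /g2 !tinnerE; congr (_ - _ * _).
  rewrite mulrCA; congr (_ * _); rewrite mulr_sumr; apply: eq_bigr => I _.
  by rewrite /f mulrA.
Qed.

Lemma inner_extd_cutoff k (w : tensor R N k) (u : tensor R N k.+1) n x :
  smooth_tensor w -> U x ->
  \sum_K extd (fun I y => chi n y ^+ 2 * w I y) K x * u K x =
  chi n x ^+ 2 * (\sum_K extd w K x * u K x)
  + 2 * chi n x * \sum_K ext1 (chi n) w K x * u K x.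
Proof.
move=> sw Ux; rewrite !mulr_sumr -big_split; apply: eq_bigr => K _ /=.
have sc := smooth_chi N a n.
rewrite (extd_mul _ (smooth_chi2 n) sw Ux) (ext1_sqr _ _ sc Ux); ring.
Qed.

Definition err (n : nat) : R := grad_const a / n.+1%:R.

Lemma err_gt0 n : 0 < err n.
Proof. by rewrite divr_gt0// (lt_le_trans _ (grad_const_ge1 a)). Qed.

(** Young's inequality with weight [err n], since |d chi_n wedge u| is at most (k + 1) [err n] |u|.
    Keeping c and d separate lets the factor chi_n be attached to either side. *)
Lemma cross_bound k (u : tensor R N k) (b : tensor R N k.+1) n x (c d : R) : U x ->
  2 * (c * d) * (rho x ^+ (2 * k.+1) * \sum_K ext1 (chi n) u K x * b K x) <=
  err n * (c ^+ 2 * (rho x ^+ (2 * k.+1) * \sum_K b K x * b K x)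
     + k.+1%:R ^+ 2 * d ^+ 2 * (rho x ^+ (2 * k) * \sum_I u I x * u I x)).
Proof.
move=> Ux; have /domE r0 := Ux; have e0 := err_gt0 n; set E := err n in e0 *.
set S := \sum_K ext1 _ _ _ _ * _; set B := \sum_K b K x * b K x; set V := \sum_I _.
set A := \sum_K ext1 (chi n) u K x ^+ 2.
have sq : 2 * E * (c * d) * S <= E ^+ 2 * c ^+ 2 * B + d ^+ 2 * A.
  rewrite -subr_ge0.
  have -> : E ^+ 2 * c ^+ 2 * B + d ^+ 2 * A - 2 * E * (c * d) * S =
      \sum_K (E * c * b K x - d * ext1 (chi n) u K x) ^+ 2.
    rewrite /A /B /S !mulr_sumr -big_split -sumrB /=.
    by apply: eq_bigr => K _; ring.
  by apply: sumr_ge0 => K _; rewrite sqr_ge0.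
have bA : rho x ^+ 2 * A <= k.+1%:R ^+ 2 * E ^+ 2 * V.
  have V0 : 0 <= V by apply: sumr_ge0 => I _; rewrite -expr2 sqr_ge0.
  apply: (@le_trans _ _ (rho x ^+ 2 * (k.+1%:R ^+ 2 *
      (\sum_i dpartial i (chi n) x ^+ 2) * V))).
    rewrite ler_pM2l ?exprn_gt0//; apply: le_trans (ext1_bound _ _ _) _.
    by rewrite le_eqVlt; apply/orP; left; apply/eqP; congr (_ * _); apply: eq_bigr.
  rewrite -[leRHS]mulrA -[X in rho x ^+ 2 * X]mulrA mulrCA ler_pM2l ?exprn_gt0//.
  by rewrite mulrA ler_wpM2r// grad_chi.
have r2 : 0 < rho x ^+ (2 * k) by rewrite exprn_gt0.
rewrite -(ler_pM2l e0).
have -> : rho x ^+ (2 * k.+1) = rho x ^+ 2 * rho x ^+ (2 * k) by rewrite -exprD mulnS.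
move: r2; set r := rho x ^+ (2 * k) => r2.
have q0 : 0 < rho x ^+ 2 by rewrite exprn_gt0.
have sq' := ler_wpM2l (ltW (mulr_gt0 q0 r2)) sq.
have bA' := ler_wpM2l (mulr_ge0 (sqr_ge0 d) (ltW r2)) bA.
apply: le_trans (_ : _ <= (rho x ^+ 2 * r) * (E ^+ 2 * c ^+ 2 * B)
   + d ^+ 2 * r * (k.+1%:R ^+ 2 * E ^+ 2 * V)) _; last first.
  by rewrite le_eqVlt; apply/orP; left; apply/eqP; ring.
apply: le_trans (_ : _ <= (rho x ^+ 2 * r) * (E ^+ 2 * c ^+ 2 * B + d ^+ 2 * A)) _.
  apply: le_trans sq'; rewrite le_eqVlt; apply/orP; left; apply/eqP; ring.
rewrite mulrDr lerD2l; apply: le_trans bA'.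
by rewrite le_eqVlt; apply/orP; left; apply/eqP; ring.
Qed.

End harmonic.

(** * Square-integrable harmonic forms are closed and coclosed *)

Section harmonic_forms.
Variables (R : realType) (N : nat) (a : R).
Local Notation M := (hyperbolic N a).
Local Notation U := (Defs.dom (hyperbolic N a)).
Local Notation rho := (rho a).
Local Notation yy := (yy a).
Local Notation nabla := (nabla a).
Local Notation smooth_tensor := (smooth_tensor a).
Local Notation alt_field := (alt_field a).
Local Notation chi := (chi a).
Local Notation err := (err a).
Local Notation chi_supp := (@chi_supp R N a).
Let oU : open U := @open_dom R N a.

(** The degree 0 case. Testing with chi_n^2 u shows that chi_n^2 |du|^2 plus a cross term integrates
    to zero, so [absorb] applies with c = 0. *)
Lemma coclosed_function_closed (u w : tensor R N 0) :
  smooth_tensor u -> alt_field u -> is_codiff M (extd u) w ->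
  (forall I x, U x -> w I x = 0) -> (sqL2 M u < +oo)%E ->
  forall x, U x -> forall K, extd u K x = 0.
Proof.
move=> su au cw w0 L2 x Ux K.
have sdu : smooth_tensor (extd u) by exact: smooth_extd.
have /choice[G HG] n := codiff_cutoff n cw sdu su au.
suff : (volint M (tinner M (extd u) (extd u)) <= 0%:E * volint M (tinner M u u))%E.
  rewrite mul0e => H; apply: (@tinner_eq0 _ _ a) => //.
  apply: (volint_eq0 _ _ H) => //.
    exact: smooth_tinner.
  by move=> z; exact: tinner_ge0.
apply: (@absorb _ _ _ _ _ G 0 (grad_const a)) => //.
- by rewrite (le_trans _ (grad_const_ge1 a)).
- exact: smooth_tinner.
- exact: smooth_tinner.
- by move=> z; exact: tinner_ge0.
- by move=> z; exact: tinner_ge0.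
- by move=> n; have [] := HG n.
- by move=> n; have [] := HG n.
- by move=> n; have [] := HG n.
move=> n z Uz; have [_ _ _ ->//] := HG n.
rewrite [\sum_I u I z * w I z]big1 => [|I _]; last by rewrite w0// mulr0.
rewrite inner_extd_cutoff// -/(err n) !tinnerE add0r !mulr0 subr0.
rewrite (_ : 1`! = 1)%N// invr1 mul1r.
(* The cutoff goes with du, whose square integral is not yet known to be finite; the minus sign
   bounds the cross term from below. *)
have := cross_bound u (extd u) n (- chi n z) 1 Uz.
set r := rho z ^+ _; set B := \sum_I _ * _; set S := \sum_I _ * _.
rewrite !expr1n !mulr1 mul1r sqrrN; set q := rho z ^+ _ * _; nra.
Qed.

(** The codifferential of du is tested on chi_n^2 u and that of u on chi_n^2 v. In the difference
    the second-order terms cancel by dv + w = 0, leaving chi_n^2 times P and two cross terms. *)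
Lemma harmonic_closed_coclosed k (u w : tensor R N k.+1) (v : tensor R N k) :
  smooth_tensor u -> alt_field u -> is_codiff M u v -> is_codiff M (extd u) w ->
  (forall I x, U x -> extd v I x + w I x = 0) -> (sqL2 M u < +oo)%E ->
  forall x, U x -> (forall K, extd u K x = 0) /\ (forall J, v J x = 0).
Proof.
move=> su au cv cw vw L2 x Ux.
have sdu : smooth_tensor (extd u) by exact: smooth_extd.
have [/diff_formP[sv av] _] := cv.
have /choice[G HG] n := codiff_cutoff n cw sdu su au.
have /choice[G' HG'] n := codiff_cutoff n cv su sv av.
pose c0 : R := k`!%:R^-1; pose c1 : R := (k.+1)`!%:R^-1; pose c2 : R := (k.+2)`!%:R^-1.
have c0_gt0 : 0 < c0 by rewrite invr_gt0 ltr0n fact_gt0.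
have c1_gt0 : 0 < c1 by rewrite invr_gt0 ltr0n fact_gt0.
have c2_gt0 : 0 < c2 by rewrite invr_gt0 ltr0n fact_gt0.
have c1E : c1 * k.+1%:R = c0.
  by rewrite /c1 /c0 factS natrM invfM mulrAC mulVf ?pnatr_eq0// mul1r.
have c2E : c2 * k.+2%:R = c1.
  by rewrite /c2 /c1 [(k.+2)`!]factS natrM invfM mulrAC mulVf ?pnatr_eq0// mul1r.
have c1_le1 : c1 <= 1 by rewrite invf_le1 ?ltr0n ?fact_gt0// ler1n fact_gt0.
pose P x := c2 * tinner M (extd u) (extd u) x + c0 * tinner M v v x.
have P0 z : U z -> 0 <= P z.
  by move=> Uz; rewrite addr_ge0// mulr_ge0 ?tinner_ge0// ltW.
have sP : smooth_on U P.
  by apply: smoothD => //; apply: smoothM => //;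
    (exact: smooth_cst || exact: smooth_tinner).
suff PE : P x = 0.
  have t1 := tinner_ge0 (extd u) Ux; have t2 := tinner_ge0 v Ux.
  have z1 : tinner M (extd u) (extd u) x = 0 by rewrite /P in PE; nra.
  have z2 : tinner M v v x = 0 by rewrite /P in PE; nra.
  by split=> K; [exact: (tinner_eq0 _ Ux z1)|exact: (tinner_eq0 _ Ux z2)].
apply: volint_eq0 Ux => //.
suff : (volint M P <= 0%:E * volint M (tinner M u u))%E by rewrite mul0e.
(* (k + 2)^2 dominates the three coefficients of the error estimate: 1 for |du|^2, k + 1 for |v|^2
   and c1 (k + 3) for |u|^2. *)
pose K0 : R := k.+2%:R ^+ 2.
apply: (@absorb _ _ _ _ _ (fun n x => G n x - G' n x) 0 (K0 * grad_const a)) => //.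
- by rewrite mulr_ge0 ?sqr_ge0// (le_trans _ (grad_const_ge1 a)).
- exact: smooth_tinner.
- by move=> z; exact: tinner_ge0.
- by move=> n; have [s1 _ _ _] := HG n; have [s2 _ _ _] := HG' n; exact: smoothB.
- move=> n z Uz nK; have [_ z1 _ _] := HG n; have [_ z2 _ _] := HG' n.
  by rewrite z1// z2// subrr.
- move=> n; have [s1 z1 v1 _] := HG n; have [s2 z2 v2 _] := HG' n.
  have i1 := vint_compact s1 (@chi_supp_compact R N a n) (@chi_supp_dom R N a n) z1.
  have i2 := vint_compact s2 (@chi_supp_compact R N a n) (@chi_supp_dom R N a n) z2.
  by rewrite volintB// v1 v2 sube0.
move=> n z Uz; have [_ _ _ ->//] := HG n; have [_ _ _ ->//] := HG' n.
rewrite (inner_extd_cutoff _ _ su Uz) (inner_extd_cutoff _ _ sv Uz) /P !tinnerE -mulrA -/(err n) add0r -/c0 -/c1 -/c2.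
(* The harmonic equation: it makes the terms c1 chi_n^2 g(u, w) of [G] and [G'] cancel. *)
have -> : \sum_K extd v K z * u K z = - \sum_I u I z * w I z.
  rewrite -sumrN; apply: eq_bigr => I _; have /eqP := vw I z Uz.
  by rewrite addr_eq0 => /eqP ->; rewrite mulNr mulrC.
have cb1 := cross_bound u (extd u) n (- chi n z) 1 Uz.
have cb2 := cross_bound v u n 1 (chi n z) Uz.
move: cb1 cb2; rewrite !expr1n !mulr1 !mul1r sqrrN -/K0.
set r2 := rho z ^+ (2 * k.+2); set r1 := rho z ^+ (2 * k.+1); set r0 := rho z ^+ (2 * k).
set S2 := \sum_K ext1 _ _ _ _ * _; set S1 := \sum_K ext1 _ _ _ _ * _.
set B := \sum_K extd _ _ _ * _; set A := \sum_I u I z * u I z.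
set V := \sum_I v I z * _; set X := \sum_I u I z * w I z.
set E := err n; set c := chi n z.
have E0 : 0 < E by exact: err_gt0.
have A0 : 0 <= r1 * A by have := tinner_ge0 u Uz; rewrite tinnerE.
have B0 : 0 <= r2 * B by have := tinner_ge0 (extd u) Uz; rewrite tinnerE.
have V0 : 0 <= r0 * V by have := tinner_ge0 v Uz; rewrite tinnerE.
have c20 : 0 <= c ^+ 2 by exact: sqr_ge0.
rewrite -/(err n) => cb1 cb2.
have h1 := ler_wpM2l (ltW c2_gt0) cb1.
have h2 := ler_wpM2l (ltW c1_gt0) cb2.
have b1 : c2 * (E * (c ^+ 2 * (r2 * B))) <= K0 * E * (c ^+ 2 * (c2 * (r2 * B))).
  have -> : c2 * (E * (c ^+ 2 * (r2 * B))) = 1 * (E * (c ^+ 2 * (c2 * (r2 * B)))) by ring.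
  rewrite -[leRHS]mulrA ler_wpM2r//.
    by rewrite mulr_ge0 ?(ltW E0)// mulr_ge0// mulr_ge0// ltW.
  by rewrite /K0 exprn_ege1// ler1n.
have b2 : c1 * (E * (k.+1%:R ^+ 2 * c ^+ 2 * (r0 * V))) <= K0 * E * (c ^+ 2 * (c0 * (r0 * V))).
  have -> : c1 * (E * (k.+1%:R ^+ 2 * c ^+ 2 * (r0 * V))) =
     k.+1%:R * (E * (c ^+ 2 * (c0 * (r0 * V)))) by rewrite -c1E; ring.
  rewrite -[leRHS]mulrA ler_wpM2r//.
    by rewrite mulr_ge0 ?(ltW E0)// mulr_ge0// mulr_ge0// ltW.
  rewrite /K0 -natrX ler_nat; apply: (@leq_trans k.+2) => //.
  by rewrite -[X in (X <= _)%N]muln1 leq_mul2l.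
have b3 : c2 * (E * (K0 * (r1 * A))) + c1 * (E * (r1 * A)) <= K0 * E * (r1 * A).
  have -> : c2 * (E * (K0 * (r1 * A))) + c1 * (E * (r1 * A)) =
    (c1 * (k.+2%:R + 1)) * (E * (r1 * A)).
    by rewrite -c2E /K0; ring.
  rewrite -[leRHS]mulrA ler_wpM2r//; first by rewrite mulr_ge0 ?(ltW E0).
  apply: (@le_trans _ _ (k.+2%:R + 1)); first by rewrite ler_piMl// addr_ge0.
  by rewrite /K0 -[k.+2%:R]natr1 -[k.+1%:R]natr1; have := ler0n R k; nra.
have := lerD (lerD h1 h2) (lerD (lerD b1 b2) b3).
rewrite -subr_ge0 => H; rewrite -subr_ge0; apply: le_trans H _.
by rewrite le_eqVlt; apply/orP; left; apply/eqP; ring.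
Qed.

(** From weak to pointwise: the identity is tested on chi_n^2 times the coordinate divergence [Df]
    itself, which makes the integral of chi_n^2 |Df|^2 vanish, and the integrand is continuous and
    nonnegative. *)
Lemma coclosed_divergence k (u : tensor R N k.+1) (v : tensor R N k) :
  smooth_tensor u -> alt_field u -> is_codiff M u v ->
  (forall J x, U x -> v J x = 0) ->
  forall x, U x -> forall J,
    \sum_i nabla i (hat a u) (icons i J) x = 0.
Proof.
move=> su au cv v0 x Ux J.
pose b i J y := rho y ^+ (2 * k.+1) * (rho y ^+ N)^-1 * u (icons i J) y.
pose Df : tensor R N k := fun J x => \sum_i dpartial i (b i J) x.
have sb i K : smooth_on U (b i K).
  by apply: smoothM => //; apply: smoothM => //; [exact: smooth_rhoX|exact: smooth_rhoXV].
have sD : smooth_tensor Df.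
  by move=> K; apply: smooth_sum => // i _; exact: smooth_dpartial.
have aD : alt_field Df.
  move=> z Uz s K; rewrite /Df mulr_sumr; apply: eq_bigr => i _.
  rewrite -(dpartialZ _ _ (sb i K) Uz); apply: (dpartial_eq oU) => // y Uy.
  have E : u (icons i [ffun t => K (s t)]) y = (-1) ^+ odd_perm s * u (icons i K) y.
    exact: (alt_slot i (au y Uy) s K).
  by rewrite /b E mulrCA.
rewrite trace_nabla//; suff D0 : Df J x = 0 by rewrite [X in _ * X]D0 mulr0.
(* A single n suffices, with no limit: the cutoff only has to be positive at the given x. *)
have [n cn] : exists n, 0 < chi n x.
  have : \forall n \near \oo, 0 < chi n x.
    have := cvg_chi a x; move/cvgr_gt; apply; exact: ltr01.
  by move=> [n _ Hn]; exists n; exact: (Hn n (leqnn n)).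
have [g [sg g0 Ig gE]] := codiff_cutoff n cv su sD aD.
pose F i y := \sum_K chi n y ^+ 2 * Df K y * b i K y.
have scD K : smooth_on U (fun y => chi n y ^+ 2 * Df K y).
  by apply: smoothM => //; exact: smooth_chi2.
have sF i : smooth_on U (F i).
  by apply: smooth_sum => // K _; exact: smoothM.
have F0 i y : U y -> ~ chi_supp n y -> F i y = 0.
  by move=> Uy nK; apply: big1 => K _; rewrite chi_eq0// expr0n !mul0r.
have dF := volint_divergence sF F0.
pose c : R := (k.+1)`!%:R^-1 * k.+1%:R.
have c0 : c != 0 by rewrite mulf_neq0 ?invr_eq0 ?pnatr_eq0 -?lt0n ?fact_gt0.
pose H y := rho y ^+ N * \sum_K chi n y ^+ 2 * Df K y ^+ 2.
(* Both terms on the right have integral zero, the first by the divergence theorem, the second by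
   the weak identity; c^-1 undoes the factorial and the k + 1 slots of [inner_extd]. *)
have HE y : U y -> H y = rho y ^+ N * \sum_i dpartial i (F i) y - c^-1 * g y.
  move=> Uy; have r0 := rho_neq0 Uy.
  rewrite gE//.
  rewrite [\sum_I Df I y * v I y]big1 => [|I _]; last by rewrite v0// mulr0.
  rewrite !mulr0 subr0 inner_extd; last exact: au.
  set Z := \sum_i \sum_J _.
  have -> : c^-1 * ((k.+1)`!%:R^-1 * (rho y ^+ (2 * k.+1) * (k.+1%:R * Z))) =
     rho y ^+ (2 * k.+1) * Z.
    transitivity (c^-1 * c * (rho y ^+ (2 * k.+1) * Z)); last by rewrite mulVf// mul1r.
    by rewrite -[c^-1 * c * _]mulrA; congr (_ * _); rewrite /c; ring.
  have -> : \sum_i dpartial i (F i) y = (rho y ^+ N)^-1 * rho y ^+ (2 * k.+1) * Z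
      + \sum_K chi n y ^+ 2 * Df K y ^+ 2.
    have -> : \sum_K chi n y ^+ 2 * Df K y ^+ 2 =
        \sum_i \sum_K chi n y ^+ 2 * Df K y * dpartial i (b i K) y.
      rewrite exchange_big; apply: eq_bigr => K _ /=.
      by rewrite -mulr_sumr -/(Df K y); ring.
    rewrite mulr_sumr -big_split; apply: eq_bigr => i _ /=.
    rewrite mulr_sumr -big_split /= (@dpartial_sum _ _ U)//; last first.
      by move=> K _; exact: smoothM.
    apply: eq_bigr => K _; rewrite (dpartialM _ (scD K) (sb i K) Uy) /b; ring.
  by rewrite /H mulrDr !mulrA mulfV ?expf_neq0// mul1r; ring.
have vg := vint_compact sg (@chi_supp_compact R N a n) (@chi_supp_dom R N a n) g0.
have sdF : smooth_on U (fun y => rho y ^+ N * \sum_i dpartial i (F i) y).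
  apply: smoothM => //; first exact: smooth_rhoX.
  by apply: smooth_sum => // i _; exact: smooth_dpartial.
have dF0 y : U y -> ~ chi_supp n y -> rho y ^+ N * \sum_i dpartial i (F i) y = 0.
  move=> Uy nK; rewrite big1 ?mulr0// => i _.
  rewrite (dpartial_eq (@open_off_supp R N a n) i (g := fun=> 0)) ?dpartial_cst//.
  by move=> z [Uz nz]; exact: F0.
have vdF := vint_compact sdF (@chi_supp_compact R N a n) (@chi_supp_dom R N a n) dF0.
have IH : volint M H = 0%E.
  rewrite (volint_eq HE) volintB//; last exact: vintZ.
  by rewrite dF volintZ// Ig mule0 sube0.
have sH : smooth_on U H.
  apply: smoothM => //; first exact: smooth_rhoX.
  apply: smooth_sum => // K _; apply: smoothM => //; first exact: smooth_chi2.
  exact: smoothX.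
have H0 y : U y -> 0 <= H y.
  move=> /domE r0; rewrite mulr_ge0 ?exprn_ge0 ?(ltW r0)// sumr_ge0// => K _.
  by rewrite mulr_ge0 ?sqr_ge0.
have /eqP := volint_eq0 sH H0 (eq_ind_r (fun z => (z <= 0)%E) (lexx _) IH) Ux.
rewrite mulf_eq0 expf_eq0 (negbTE (rho_neq0 Ux)) andbF /=.
rewrite psumr_eq0 => [/allP/(_ J)|K _]; last by rewrite mulr_ge0 ?sqr_ge0.
rewrite mem_index_enum mulf_eq0 !sqrf_eq0 (gt_eqF cn) /= => /(_ isT)/eqP//.
Qed.

End harmonic_forms.

(** * The gradient estimate and approximation in H^1 *)

Section main.
Variables (R : realType) (N : nat) (a : R).
Local Notation M := (hyperbolic N a).
Local Notation U := (Defs.dom (hyperbolic N a)).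
Local Notation rho := (rho a).
Local Notation yy := (yy a).
Local Notation nabla := (nabla a).
Local Notation smooth_tensor := (smooth_tensor a).
Local Notation alt_field := (alt_field a).
Local Notation chi := (chi a).
Local Notation err := (err a).
Local Notation chi_supp := (@chi_supp R N a).
Let oU : open U := @open_dom R N a.

Lemma tinner_hat k (u : tensor R N k) x :
  tinner M u u x = \sum_I hat a u I x ^+ 2.
Proof.
rewrite tinnerE mulr_sumr; apply: eq_bigr => I _.
by rewrite /hat exprMn -exprM mulnC expr2.
Qed.

Lemma tinner_covd k (u : tensor R N k) x : smooth_tensor u -> U x ->
  tinner M (covd M u) (covd M u) x = \sum_i \sum_I nabla i (hat a u) I x ^+ 2.
Proof.
move=> su Ux; rewrite tinner_hat (sum_iins ord0); apply: eq_bigr => i _.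
by apply: eq_bigr => I _; rewrite nabla_hat.
Qed.

(** The divergence theorem for chi_n^2 W combined with [bochner], followed by [absorb]. The
    condition on the degree makes the constant nonnegative. *)
Lemma bochner_bound k (u : tensor R N k.+1) : (k.+1 <= N)%N ->
  smooth_tensor u -> alt_field u ->
  (forall x, U x -> forall K, extd u K x = 0) ->
  (forall x, U x -> forall J, \sum_i nabla i (hat a u) (icons i J) x = 0) ->
  (sqL2 M u < +oo)%E ->
  (sqL2 M (covd M u) <= (a ^+ 2 * k.+1%:R * (N%:R - k.+1%:R))%:E * sqL2 M u)%E.
Proof.
move=> kN su au d0 tr0 L2; set c := a ^+ 2 * _ * _.
have c0 : 0 <= c.
  by apply: (mulr_ge0 (mulr_ge0 (sqr_ge0 a) (ler0n _ _))); rewrite subr_ge0 ler_nat.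
pose h := hat a u.
have sh : smooth_tensor h by exact: smooth_hat.
have sT i : smooth_tensor (nabla i h) by exact: smooth_nabla.
pose W i x := \sum_j \sum_J h (icons j J) x * nabla j h (icons i J) x.
have sW i : smooth_on U (W i).
  apply: smooth_sum => // j _; apply: smooth_sum => // J _; apply: smoothM => //.
  exact: sT.
(* rho^(1-N) turns frame components into coordinate components times the density; its derivative is
   the source of the term (N - 1) y_i W_i. *)
pose wt (x : 'rV[R]_N) := rho x * (rho x ^+ N)^-1.
have srho : smooth_on U rho by exact: smooth_rho.
have sV : smooth_on U (fun x => (rho x ^+ N)^-1) by exact: smooth_rhoXV.
have swt : smooth_on U wt by exact: smoothM.
have dwt i x : U x -> rho x ^+ N * dpartial i wt x = (N%:R - 1) * yy i x.
  move=> Ux; have r0 := rho_neq0 Ux.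
  have rN z : U z -> rho z ^+ N != 0 by move=> /rho_neq0 ?; rewrite expf_neq0.
  rewrite (dpartialM _ srho sV Ux) (dpartialV _ rN (smooth_rhoX N a N) Ux).
  rewrite (dpartialX oU _ _ srho Ux) !dpartial_rho.
  have NE m : m%:R * rho x ^+ m.-1 = m%:R * rho x ^+ m / rho x.
    by case: m => [|m]; [rewrite !mul0r|rewrite exprS; field].
  rewrite NE; have := rN x Ux; set p := rho x ^+ N => p0.
  by field; rewrite r0 p0.
pose F n i x := wt x * (chi n x ^+ 2 * W i x).
have sF n i : smooth_on U (F n i).
  by apply: smoothM => //; apply: smoothM => //; exact: smooth_chi2.
have F0 n i x : U x -> ~ chi_supp n x -> F n i x = 0.
  by move=> Ux nK; rewrite /F chi_eq0// expr0n mul0r mulr0.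
pose X n x := \sum_i rho x * dpartial i (chi n) x * W i x.
have dF n x : U x -> rho x ^+ N * \sum_i dpartial i (F n i) x =
   chi n x ^+ 2 * \sum_i (rho x * dpartial i (W i) x + (N%:R - 1) * yy i x * W i x)
   + 2 * chi n x * X n x.
  move=> Ux; have r0 := rho_neq0 Ux; have sc := smooth_chi N a n.
  rewrite !mulr_sumr -big_split; apply: eq_bigr => i _ /=.
  rewrite (dpartialM _ swt (smoothM oU (smooth_chi2 N a n) (sW i)) Ux).
  rewrite (dpartialM _ (smooth_chi2 N a n) (sW i) Ux).
  rewrite mulrDr mulrA dwt// /wt (dpartialX oU _ _ sc Ux) /= expr1.
  by field; rewrite expf_neq0.
(* Closedness is used here and produces the factor [k.+1]. *)
have PZ x : U x -> tinner M (covd M u) (covd M u) x = k.+1%:R *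
    \sum_i \sum_j \sum_J nabla i h (icons j J) x * nabla j h (icons i J) x.
  move=> Ux; rewrite tinnerE.
  under eq_bigr do rewrite -expr2.
  rewrite (sqnorm_covd su au (d0 x Ux) Ux) mulrCA; congr (_ * _).
  rewrite mulr_sumr; apply: eq_bigr => i _; rewrite mulr_sumr; apply: eq_bigr => j _.
  rewrite mulr_sumr; apply: eq_bigr => J _; rewrite !nabla_hat// mul2n -addnn exprD; ring.
pose G n x := k.+1%:R * (rho x ^+ N * \sum_i dpartial i (F n i) x).
have sdF n : smooth_on U (fun y => rho y ^+ N * \sum_i dpartial i (F n i) y).
  apply: smoothM => //; first exact: smooth_rhoX.
  by apply: smooth_sum => // i _; exact: smooth_dpartial.
have dF0 n y : U y -> ~ chi_supp n y -> rho y ^+ N * \sum_i dpartial i (F n i) y = 0.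
  move=> Uy nK; rewrite big1 ?mulr0// => i _.
  rewrite (dpartial_eq (@open_off_supp R N a n) i (g := fun=> 0)) ?dpartial_cst//.
  by move=> z [Uz nz]; exact: F0.
apply: (@absorb _ _ _ _ _ G c (k.+1%:R * grad_const a)) => //.
- by rewrite mulr_ge0// (le_trans _ (grad_const_ge1 a)).
- by apply: smooth_tinner; exact: smooth_covd.
- exact: smooth_tinner.
- by move=> z; exact: tinner_ge0.
- by move=> z; exact: tinner_ge0.
- by move=> n; apply: smoothM => //; exact: smooth_cst.
- by move=> n y Uy nK; rewrite /G dF0// mulr0.
- move=> n; rewrite volintZ.
    by rewrite (volint_divergence (sF n) (F0 n)) mule0.
  exact: (vint_compact (sdF n) (@chi_supp_compact R N a n) (@chi_supp_dom R N a n) (dF0 n)).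
move=> n x Ux; rewrite -mulrA -/(err n) /G dF//.
have ah : alt (h^~ x).
  move=> s I; rewrite /h /hat.
  have E : u [ffun t => I (s t)] x = (-1) ^+ odd_perm s * u I x by exact: (au x Ux s I).
  by rewrite E mulrCA.
have := bochner sh Ux ah tr0.
have P0 := tinner_ge0 (covd M u) Ux; have Q0 := tinner_ge0 u Ux.
have PE := tinner_covd su Ux.
move: P0 PE (PZ x Ux).
set P := tinner M (covd M u) _ x; set Z := \sum_i \sum_j \sum_J _.
set Y := \sum_i (_ + _) => P0 PE PZx.
have -> : \sum_j \sum_J h (icons j J) x ^+ 2 = tinner M u u x.
  by rewrite tinner_hat (sum_iins ord0).
set Q := tinner M u u x in Q0 *.
move=> ZE; have E0 := err_gt0 a n; set E := err n in E0 *.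
have ch0 := chi_ge0 a n x; have ch1 := chi_le1 n Ux; set ch := chi n x in ch0 ch1 *.
(* Expand the nonnegative sum of squares of E chi nabla_j h(i, J) + rho d_i chi h(j, J), bound the
   gradient of chi by E = [err n], and divide by E. *)
have cross : - (2 * ch * X n x) <= E * (ch ^+ 2 * P + Q).
  have key : 0 <= E ^+ 2 * ch ^+ 2 * P + 2 * E * ch * X n x
      + rho x ^+ 2 * (\sum_i dpartial i (chi n) x ^+ 2) * Q.
    have -> : E ^+ 2 * ch ^+ 2 * P + 2 * E * ch * X n x
        + rho x ^+ 2 * (\sum_i dpartial i (chi n) x ^+ 2) * Q =
      \sum_i \sum_j \sum_J (E * ch * nabla j h (icons i J) x
         + rho x * dpartial i (chi n) x * h (icons j J) x) ^+ 2.
      have P1 : E ^+ 2 * ch ^+ 2 * P =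
          \sum_i \sum_j \sum_J (E * ch * nabla j h (icons i J) x) ^+ 2.
        rewrite PE [RHS]exchange_big mulr_sumr; apply: eq_bigr => j _ /=.
        rewrite (sum_iins ord0) mulr_sumr; apply: eq_bigr => i _.
        by rewrite mulr_sumr; apply: eq_bigr => J _; rewrite -/(icons _ _); ring.
      have X1 : 2 * E * ch * X n x = \sum_i \sum_j \sum_J 2 * (E * ch * nabla j h (icons i J) x)
          * (rho x * dpartial i (chi n) x * h (icons j J) x).
        rewrite /X mulr_sumr; apply: eq_bigr => i _; rewrite /W !mulr_sumr.
        apply: eq_bigr => j _; rewrite !mulr_sumr; apply: eq_bigr => J _; ring.
      have Q1 : rho x ^+ 2 * (\sum_i dpartial i (chi n) x ^+ 2) * Q =
          \sum_i \sum_j \sum_J (rho x * dpartial i (chi n) x * h (icons j J) x) ^+ 2.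
        rewrite mulr_sumr mulr_suml; apply: eq_bigr => i _.
        rewrite /Q tinner_hat (sum_iins ord0) mulr_sumr; apply: eq_bigr => j _.
        by rewrite mulr_sumr; apply: eq_bigr => J _; rewrite -/(icons _ _) -/h; ring.
      rewrite P1 X1 Q1 -!big_split; apply: eq_bigr => i _.
      rewrite -!big_split; apply: eq_bigr => j _ /=.
      by rewrite -!big_split; apply: eq_bigr => J _ /=; ring.
    by apply: sumr_ge0 => i _; apply: sumr_ge0 => j _; apply: sumr_ge0 => J _; exact: sqr_ge0.
  have g := ler_wpM2r Q0 (grad_chi n Ux); rewrite -/(err n) -/E in g.
  rewrite -(ler_pM2l E0).
  have H := le_trans key (lerD (lexx _) g).
  rewrite -subr_ge0; apply: le_trans H _.
  by rewrite le_eqVlt; apply/orP; left; apply/eqP; ring.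
have k0 : 0 <= k.+1%:R :> R by [].
have h1 := ler_wpM2l k0 cross.
(* The Bochner identity provides chi_n^2 c Q, whereas [absorb] asks for c Q; this is the
   difference. *)
have h2 : 0 <= (1 - ch ^+ 2) * (c * Q).
  by apply: mulr_ge0; [rewrite subr_ge0 expr_le1|exact: mulr_ge0].
have YE : Y = Z - a ^+ 2 * (N%:R - k.+1%:R) * Q by apply/eqP; rewrite eq_sym subr_eq; apply/eqP.
rewrite YE -subr_ge0.
rewrite -subr_ge0 in h1; apply: le_trans (addr_ge0 h2 h1) _.
by rewrite le_eqVlt; apply/orP; left; apply/eqP; rewrite /c PZx; ring.
Qed.

Lemma ge0_le_volint (f g : 'rV[R]_N -> R) : smooth_on U f -> smooth_on U g ->
  (forall x, U x -> 0 <= f x) -> (forall x, U x -> f x <= g x) ->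
  (volint M f <= volint M g)%E.
Proof.
move=> sf sg f0 fg.
have w0 x : U x -> 0 <= rho x ^- N.
  by move=> /domE r0; rewrite invr_ge0 exprn_ge0// ltW.
rewrite !volintE; apply: ge0_le_integral.
- exact: measurable_vec_open.
- by move=> t Ut; rewrite lee_fin mulr_ge0 ?f0 ?w0.
- exact: (measurable_dens sf).
- exact: (measurable_dens sg).
- by move=> t Ut; rewrite lee_fin ler_wpM2r ?w0 ?fg.
Qed.

Lemma cvge0_lt (f : nat -> \bar R) d : 0 < d -> f n @[n --> \oo] --> 0%E ->
  \forall n \near \oo, (f n < d%:E)%E.
Proof.
move=> d0 cf; apply: (cf [set y | (y < d%:E)%E]); apply: open_nbhs_nbhs.
by split; [exact: open_ereal_lt_ereal|rewrite /= lte_fin].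
Qed.

(** The approximants are chi_n u. The derivative of (1 - chi_n) u is (1 - chi_n) nabla u - d chi_n
    tensor u, whose first term tends to 0 by dominated convergence and whose second is O(1/n)
    |u|. *)
Lemma inH1_of_finite k (u : tensor R N k) : smooth_tensor u -> alt_field u ->
  (sqL2 M u < +oo)%E -> (sqL2 M (covd M u) < +oo)%E -> inH1 M u.
Proof.
move=> su au L2 L2d e e0.
have sdu := smooth_covd su.
pose Q := tinner M u u; pose P := tinner M (covd M u) (covd M u).
have sQ : smooth_on U Q by exact: smooth_tinner.
have sP : smooth_on U P by exact: smooth_tinner.
have Q0 x : U x -> 0 <= Q x by exact: tinner_ge0.
have P0 x : U x -> 0 <= P x by exact: tinner_ge0.
have vQ := vint_lty sQ Q0 L2.
pose cc n (x : 'rV[R]_N) := 1 - chi n x.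
have scc n : smooth_on U (cc n).
  by apply: smoothB => //; [exact: smooth_cst|exact: smooth_chi].
pose phi n : tensor R N k := fun I x => chi n x * u I x.
have diffE n : tsub u (phi n) = (fun I x => cc n x * u I x).
  by apply/funext => I; apply/funext => x; rewrite /tsub /phi /cc; ring.
have scu n : smooth_tensor (fun I x => cc n x * u I x).
  by move=> I; exact: smoothM.
have dcc n i x : U x -> dpartial i (cc n) x = - dpartial i (chi n) x.
  move=> Ux; rewrite /cc (dpartialB _ (smooth_cst oU 1) (smooth_chi N a n) Ux).
  by rewrite dpartial_cst sub0r.
have b1 n x : tinner M (tsub u (phi n)) (tsub u (phi n)) x = cc n x ^+ 2 * Q x.
  rewrite diffE /Q !tinnerE mulrCA; congr (_ * _); rewrite mulr_sumr.
  by apply: eq_bigr => I _; ring.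
have b2 n x : U x -> tinner M (covd M (tsub u (phi n))) (covd M (tsub u (phi n))) x
    <= 2 * (cc n x ^+ 2 * P x) + 2 * err n ^+ 2 * Q x.
  move=> Ux; have /domE r0 := Ux; rewrite diffE /P /Q !tinnerE.
  set r := rho x ^+ (2 * k).
  have rE : rho x ^+ (2 * k.+1) = rho x ^+ 2 * r by rewrite -exprD mulnS.
  have rr : 0 < r by rewrite exprn_gt0.
  set A := \sum_I u I x * u I x.
  have A0 : 0 <= A by apply: sumr_ge0 => I _; rewrite -expr2 sqr_ge0.
  set B := \sum_I covd M u I x * _.
  set S := \sum_I _.
  have SB : S <= 2 * (cc n x ^+ 2 * B) + 2 * (\sum_i dpartial i (chi n) x ^+ 2) * A.
    rewrite /S /B (sum_iins ord0) [X in 2 * (_ * X)](sum_iins ord0).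
    rewrite [X in _ <= _ + X * _]mulr_sumr [X in _ <= _ + X]mulr_suml.
    rewrite [X in _ <= 2 * X + _]mulr_sumr [X in _ <= X + _]mulr_sumr.
    rewrite -big_split; apply: ler_sum => i _ /=.
    rewrite /A !mulr_sumr -big_split; apply: ler_sum => I _ /=.
    rewrite -!/(icons _ _) (covd_mul _ _ (scc n) su Ux) dcc//.
    have H := sqr_ge0 (cc n x * covd M u (icons i I) x + dpartial i (chi n) x * u I x).
    rewrite -subr_ge0; apply: le_trans H _.
    by rewrite le_eqVlt; apply/orP; left; apply/eqP; ring.
  apply: (@le_trans _ _ (rho x ^+ 2 * r * (2 * (cc n x ^+ 2 * B)
      + 2 * (\sum_i dpartial i (chi n) x ^+ 2) * A))).
    by rewrite rE ler_pM2l// mulr_gt0// exprn_gt0.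
  have g := ler_wpM2r (mulr_ge0 (ltW rr) A0) (grad_chi n Ux).
  rewrite rE -subr_ge0; rewrite -subr_ge0 in g.
  have := mulr_ge0 (ler0n R 2) g => H; apply: le_trans H _.
  by rewrite -/(err n) le_eqVlt; apply/orP; left; apply/eqP; ring.
have [q qE] : exists q, volint M Q = q%:E.
  by exists (fine (volint M Q)); rewrite fineK ?volint_fin.
have q0 : 0 <= q by rewrite -lee_fin -qE volint_ge0.
have cQ := cvg_volint_1chi sQ Q0 L2.
have cP := cvg_volint_1chi sP P0 L2d.
have ec : err n @[n --> \oo] --> (0 : R).
  rewrite -[X in _ --> X](mulr0 (grad_const a)).
  by apply: cvgM; [exact: cvg_cst|exact: cvg_harmonic].
(* The three small quantities enter the squared H^1 norm with weights 1, 2 and 1, so the total stays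
   below e^2 / 2. *)
have d0 : 0 < e ^+ 2 / 8 by rewrite divr_gt0// exprn_gt0.
have n1 : \forall n \near \oo, (volint M (fun x => (cc n x ^+ 2 * Q x)%R) < (e ^+ 2 / 8)%:E)%E.
  exact: cvge0_lt.
have n2 : \forall n \near \oo, (volint M (fun x => (cc n x ^+ 2 * P x)%R) < (e ^+ 2 / 8)%:E)%E.
  exact: cvge0_lt.
have n3 : \forall n \near \oo, 2 * err n ^+ 2 * q < e ^+ 2 / 8.
  have : 2 * (err n * err n) * q @[n --> \oo] --> (2 * (0 * 0) * q : R).
    apply: cvgM; last exact: cvg_cst.
    by apply: cvgM; [exact: cvg_cst|exact: cvgM].
  by rewrite mul0r mulr0 mul0r; move/cvgr_lt; apply.
have [n [h1 h2 h3]] : exists n, [/\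
    (volint M (fun x => (cc n x ^+ 2 * Q x)%R) < (e ^+ 2 / 8)%:E)%E,
    (volint M (fun x => (cc n x ^+ 2 * P x)%R) < (e ^+ 2 / 8)%:E)%E &
    2 * err n ^+ 2 * q < e ^+ 2 / 8].
  have [m _ Hm] : \forall n \near \oo, [/\
    (volint M (fun x => (cc n x ^+ 2 * Q x)%R) < (e ^+ 2 / 8)%:E)%E,
    (volint M (fun x => (cc n x ^+ 2 * P x)%R) < (e ^+ 2 / 8)%:E)%E &
    2 * err n ^+ 2 * q < e ^+ 2 / 8] by apply: filterS3 n1 n2 n3 => n.
  by exists m; exact: (Hm m (leqnn m)).
exists (phi n).
  apply: (@test_form_cutoff _ _ _ _ _ _ n) => //; first exact: smooth_chi.
  by move=> x; exact: chi_eq0.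
have scQ : smooth_on U (fun x => cc n x ^+ 2 * Q x).
  by apply: smoothM => //; exact: smoothX.
have scP : smooth_on U (fun x => cc n x ^+ 2 * P x).
  by apply: smoothM => //; exact: smoothX.
have vcP : vint a (fun x => cc n x ^+ 2 * P x).
  apply: vint_lty => // [x Ux|]; first by rewrite mulr_ge0 ?sqr_ge0 ?P0.
  exact: lt_trans h2 (ltry _).
have e1 : sqL2 M (tsub u (phi n)) = volint M (fun x => (cc n x ^+ 2 * Q x)%R).
  by apply: volint_eq => x _; exact: b1.
have e2 : (sqL2 M (covd M (tsub u (phi n))) <=
    2%:E * volint M (fun x => (cc n x ^+ 2 * P x)%R) + (2 * err n ^+ 2 * q)%:E)%E.
  have := @ge0_le_volint (tinner M (covd M (tsub u (phi n))) (covd M (tsub u (phi n))))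
    (fun x => 2 * (cc n x ^+ 2 * P x) + 2 * err n ^+ 2 * Q x) _ _ _ (b2 n).
  rewrite volintD; [|exact: vintZ|exact: vintZ].
  rewrite volintZ// volintZ// qE -EFinM; apply.
  - by apply: smooth_tinner; apply: smooth_covd; rewrite diffE; exact: scu.
  - by apply: smoothD => //; apply: smoothM => //; exact: smooth_cst.
  - by move=> x; exact: tinner_ge0.
have [p pE] : exists p, volint M (fun x => (cc n x ^+ 2 * P x)%R) = p%:E.
  by exists (fine (volint M (fun x => (cc n x ^+ 2 * P x)%R))); rewrite fineK ?volint_fin.
have [s sE s0] : exists2 s, (sqL2 M (tsub u (phi n)) + sqL2 M (covd M (tsub u (phi n))))%E
    = s%:E & 0 <= s < e ^+ 2.
  have lt : (sqL2 M (tsub u (phi n)) + sqL2 M (covd M (tsub u (phi n))) < (e ^+ 2)%:E)%E.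
    rewrite pE lte_fin in h2; rewrite pE -EFinM -EFinD in e2.
    rewrite e1; apply: (@lt_le_trans _ _ ((e ^+ 2 / 8)%:E + (2 * p + 2 * err n ^+ 2 * q)%:E)%E).
      by apply: le_lt_trans (leeD2l _ e2) _; exact: lte_leD.
    by rewrite -EFinD lee_fin; lra.
  have ge : (0 <= sqL2 M (tsub u (phi n)) + sqL2 M (covd M (tsub u (phi n))))%E.
    by apply: adde_ge0; apply: volint_ge0 => x; exact: tinner_ge0.
  have fin : (sqL2 M (tsub u (phi n)) + sqL2 M (covd M (tsub u (phi n))))%E \is a fin_num.
    by rewrite ge0_fin_numE// (lt_trans lt)// ltry.
  exists (fine (sqL2 M (tsub u (phi n)) + sqL2 M (covd M (tsub u (phi n))))%E).
    by rewrite fineK.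
  by rewrite -lee_fin -lte_fin fineK// ge lt.
rewrite /normH1 sE poweR_EFin lte_fin; case/andP: s0 => s0 s1.
rewrite powR12_sqrt// -[ltRHS](ger0_norm (ltW e0)) -sqrtr_sqr ltr_sqrt//.
by rewrite exprn_gt0.
Qed.

End main.

Theorem theorem3p2 (R : realType) (a : R) (N k : nat) (alpha : tensor R N k)
    (ha : 0 <= a) (hk : (k <= N)%N)
    (hform : diff_form (hyperbolic N a) alpha)
    (hharm : harmonic_form (hyperbolic N a) alpha)
    (hL2 : (sqL2 (hyperbolic N a) alpha < +oo)%E) :
  inH1 (hyperbolic N a) alpha /\
  (sqL2 (hyperbolic N a) (covd (hyperbolic N a) alpha)
     <= (2 * a ^+ 2 * k%:R * (N%:R - k%:R))%:E
        * sqL2 (hyperbolic N a) alpha)%E.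
Proof.
have [su au] := (diff_formP _ _).1 hform.
have Q0 : (0 <= sqL2 (hyperbolic N a) alpha)%E.
  by apply: volint_ge0 => x; exact: tinner_ge0.
have kN : 0 <= N%:R - k%:R :> R by rewrite subr_ge0 ler_nat.
(* The estimate holds with half the stated constant; its finite right-hand side is also what gives
   membership in H^1. *)
have bound : (sqL2 (hyperbolic N a) (covd (hyperbolic N a) alpha)
   <= (a ^+ 2 * k%:R * (N%:R - k%:R))%:E * sqL2 (hyperbolic N a) alpha)%E.
  case: k alpha hk hform hharm hL2 su au {Q0 kN} => [|k] u kN hf hh hL su au.
    (* In degree 0 the covariant derivative consists of the partial derivatives, which are the
       components of du = 0; both sides of the estimate vanish. *)
    have [w cw w0] := hh.
    have d0 := coclosed_function_closed su au cw w0 hL.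
    rewrite mulr0 mul0r mul0e /sqL2 (@volint_eq _ _ _ _ (fun=> 0)).
      by rewrite volintE integral0_eq// => t _; rewrite mul0r.
    move=> x Ux; rewrite tinnerE big1 ?mulr0// => K _.
    have := d0 x Ux (icons (K ord0) (idel ord0 K)); rewrite (extd_cons _ _ su au Ux).
    rewrite big_ord0 subr0 /covd big_ord0 subr0 itailE => ->; by rewrite mul0r.
  have [v [w [cv cw vw]]] := hh.
  have dv := harmonic_closed_coclosed su au cv cw vw hL.
  apply: bochner_bound => //; first by move=> x /dv[].
  by apply: coclosed_divergence cv _ => // J x /dv[].
split.
  apply: inH1_of_finite => //; apply: le_lt_trans bound _.
  rewrite lte_mul_pinfty// lee_fin.
  exact: (mulr_ge0 (mulr_ge0 (sqr_ge0 a) (ler0n _ _)) kN).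
apply: le_trans bound _; apply: lee_wpmul2r => //; rewrite lee_fin.
have := mulr_ge0 (mulr_ge0 (sqr_ge0 a) (ler0n _ k)) kN; lra.
Qed.
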